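(* Let $\gamma\in C^\infty([a,b];\mathbb{R}^3)$ be an arc-length parametrized curve with unit tangent vector $T=\gamma'\in C^\infty([a,b];S^2)$ and bending stiffness $\varrho\in C^\infty([a,b];\mathbb{R}_{>0})$. The following statements are equivalent: (1) $\gamma$ is a holonomy constrained elastic curve with bending stiffness $\varrho$. (2) There are a smooth function $\Lambda\colon[a,b]\to\mathbb{R}$ and constants $\mu\in\mathbb{R}$, $\mathbf a\in\mathbb{R}^3$ such that $$\varrho T''+\tfrac32\varrho\langle T',T'\rangle T+\varrho'T'-\Lambda T-\mu\,T\times T'+\mathbf a=0.$$ (3) There are constants $\mu\in\mathbb{R}$, $\mathbf a\in\mathbb{R}^3$ such that $$\varrho T''-\varrho\langle T'',T\rangle T+\varrho'T'+\mathbf a-\langle\mathbf a,T\rangle T-\mu\,T\times T'=0.$$ (4) There are constants $\mu\in\mathbb{R}$, $\mathbf a,\mathbf b\in\mathbb{R}^3$ such that $$\varrho(\gamma'\times\gamma'')=-\mu T+\mathbf a\times\gamma+\mathbf b.$$ (5) There are constants $\mathbf a,\mathbf b\in\mathbb{R}^3$ such that $$\varrho\gamma''=(\mathbf a\times\gamma+\mathbf b)\times\gamma'.$$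
   Context: A curve is a map $\gamma\in C^\infty([a,b];\mathbb{R}^3)$ with $\gamma'\ne0$ everywhere; it is arc-length parametrized if $|\gamma'|\equiv1$. For a function $g$ along $\gamma$, $\frac{dg}{ds}:=g'/|\gamma'|$ and $ds=|\gamma'|\,dx$; $T:=\frac{d\gamma}{ds}$. The bending energy of $\gamma$ with bending stiffness $\varrho\in C^\infty([a,b];\mathbb{R}_{>0})$ is $\mathcal B_\varrho(\gamma):=\frac12\int_a^b\varrho\,\langle\frac{dT}{ds},\frac{dT}{ds}\rangle\,ds$ ($\varrho$ is a fixed function on $[a,b]$, not varied). Holonomy: a normal field $Z$ along $\gamma$ ($\langle Z,T\rangle=0$) is parallel if $Z'=\lambda T$ for some smooth function $\lambda$; every normal vector at $\gamma(a)$ extends uniquely to a parallel normal field, whose value at $b$ is its parallel transport along $\gamma$. For unit vectors $W_a\in T(a)^\perp$, $W_b\in T(b)^\perp$ and $W=(W_a,W_b)$, the holonomy of $\gamma$ with respect to $W$ is the unique angle $\mathcal T_W\in\mathbb{R}/2\pi\mathbb{Z}$ with $Z_b=\cos(\mathcal T_W)W_b+\sin(\mathcal T_W)\,T(b)\times W_b$, where $Z_b$ is the parallel transport of $W_a$ along $\gamma$. A smooth variation of $\gamma$ is a smooth one-parameter family $\gamma_t$, $t\in[-\epsilon,\epsilon]$, with $\gamma_0=\gamma$; its variational vector field is $\mathring\gamma:=\frac{d}{dt}|_{t=0}\gamma_t$, and for a functional $\mathcal F$, $d\mathcal F(\mathring\gamma):=\frac{d}{dt}|_{t=0}\mathcal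 F(\gamma_t)$. $C_0^\infty([a,b];\mathbb{R}^3)$ denotes the smooth maps with compact support in the interior of $[a,b]$; variations with compact support in the interior leave $\gamma$ unchanged near the end points, and $d\mathcal T_W(\mathring\gamma)$ is then independent of the choice of $W$. Variations and variational vector fields are treated as synonyms. An arc-length parametrized curve $\gamma$ with bending stiffness $\varrho$ is called holonomy constrained elastic if it is a critical point of $\mathcal B_\varrho$ under all variations $\mathring\gamma\in C_0^\infty([a,b];\mathbb{R}^3)$ constraining the arc-length and the holonomy, i.e. $d\mathcal B_\varrho(\mathring\gamma)=0$ for all $\mathring\gamma\in C_0^\infty([a,b];\mathbb{R}^3)$ satisfying pointwise $\langle\mathring\gamma',\gamma'\rangle=0$ and $d\mathcal T_W(\mathring\gamma)=0$. *)

(* Defs.v *)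
From Stdlib Require Import Reals.
From Coquelicot Require Import Coquelicot.
Open Scope R_scope.

(** * Vectors *)

(* The sums, scalar multiples, etc. below are those of Coquelicot's canonical
   module structure on products. *)
Notation R3 := (R * R * R)%type.

Declare Scope R3_scope.
Delimit Scope R3_scope with R3.

Definition dot (u v : R3) : R :=
  let '(u1, u2, u3) := u in let '(v1, v2, v3) := v in
  u1 * v1 + u2 * v2 + u3 * v3.

Definition cross (u v : R3) : R3 :=
  let '(u1, u2, u3) := u in let '(v1, v2, v3) := v in
  (u2 * v3 - u3 * v2, u3 * v1 - u1 * v3, u1 * v2 - u2 * v1).

Definition norm3 (u : R3) : R := sqrt (dot u u).

Notation "u + v" := (plus (u : R3) (v : R3)) : R3_scope.
Notation "u - v" := (minus (u : R3) (v : R3)) : R3_scope.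
Notation "k *: u" := (scal (k%R : R) (u : R3))
  (at level 40, left associativity) : R3_scope.
Notation "u >< v" := (cross u v)
  (at level 40, left associativity) : R3_scope.
Notation "0" := (zero : R3) : R3_scope.

Definition coord1 (u : R3) : R := fst (fst u).
Definition coord2 (u : R3) : R := snd (fst u).
Definition coord3 (u : R3) : R := snd u.

Definition comp1 {A : Type} (f : A -> R3) : A -> R := fun x => coord1 (f x).
Definition comp2 {A : Type} (f : A -> R3) : A -> R := fun x => coord2 (f x).
Definition comp3 {A : Type} (f : A -> R3) : A -> R := fun x => coord3 (f x).

(** * Calculus on a closed interval *)

(* Functions on [a, b] are represented by total functions on R.  Derivatives
   are taken relative to [a, b] (one-sided at the end points), so that nothing
   below depends on the values outside [a, b]. *)

Definition is_derive_on (a b : R) (f : R -> R) (x l : R) : Prop :=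
  filterdiff f (within (fun y => a <= y <= b) (locally x))
    (fun y => scal y l).

Definition ex_derive_on (a b : R) (f : R -> R) (x : R) : Prop :=
  exists l, is_derive_on a b f x l.

Definition Derive_on (a b : R) (f : R -> R) (x : R) : R :=
  iota (is_derive_on a b f x).

Definition smooth_on (a b : R) (f : R -> R) : Prop :=
  forall (n : nat) (x : R), a <= x <= b ->
    ex_derive_on a b (Nat.iter n (Derive_on a b) f) x.

Definition Derive_on3 (a b : R) (f : R -> R3) (x : R) : R3 :=
  (Derive_on a b (comp1 f) x, Derive_on a b (comp2 f) x,
   Derive_on a b (comp3 f) x).

Definition smooth_on3 (a b : R) (f : R -> R3) : Prop :=
  smooth_on a b (comp1 f) /\ smooth_on a b (comp2 f) /\
  smooth_on a b (comp3 f).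

(* C^k functions of (t, x) in [c, d] x [a, b]. *)
Fixpoint Ck_rect (k : nat) (c d a b : R) (G : R -> R -> R) : Prop :=
  continuous_on (fun p : R * R => c <= fst p <= d /\ a <= snd p <= b)
    (fun p : R * R => G (fst p) (snd p)) /\
  match k with
  | O => True
  | S k' =>
      (forall t x, c <= t <= d -> a <= x <= b ->
        ex_derive_on c d (fun s => G s x) t /\ ex_derive_on a b (G t) x) /\
      Ck_rect k' c d a b (fun t x => Derive_on c d (fun s => G s x) t) /\
      Ck_rect k' c d a b (fun t x => Derive_on a b (G t) x)
  end.

Definition smooth_rect3 (c d a b : R) (G : R -> R -> R3) : Prop :=
  forall k : nat,
    Ck_rect k c d a b (fun t => comp1 (G t)) /\
    Ck_rect k c d a b (fun t => comp2 (G t)) /\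
    Ck_rect k c d a b (fun t => comp3 (G t)).

(** * Curves *)

Definition curve (a b : R) (gamma : R -> R3) : Prop :=
  smooth_on3 a b gamma /\
  forall x, a <= x <= b -> Derive_on3 a b gamma x <> (0)%R3.

Definition arclength_parametrized (a b : R) (gamma : R -> R3) : Prop :=
  forall x, a <= x <= b -> norm3 (Derive_on3 a b gamma x) = 1.

Definition stiffness (a b : R) (rho : R -> R) : Prop :=
  smooth_on a b rho /\ forall x, a <= x <= b -> 0 < rho x.

Definition speed (a b : R) (gamma : R -> R3) (x : R) : R :=
  norm3 (Derive_on3 a b gamma x).

Definition d_ds (a b : R) (gamma g : R -> R3) (x : R) : R3 :=
  (/ speed a b gamma x *: Derive_on3 a b g x)%R3.

Definition tangent (a b : R) (gamma : R -> R3) : R -> R3 :=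
  d_ds a b gamma gamma.

Definition bending_energy (a b : R) (rho : R -> R) (gamma : R -> R3) : R :=
  / 2 * RInt (fun x =>
    let dT_ds := d_ds a b gamma (tangent a b gamma) x in
    rho x * dot dT_ds dT_ds * speed a b gamma x) a b.

(** * Holonomy *)

Definition parallel_normal_field (a b : R) (gamma Z : R -> R3) : Prop :=
  smooth_on3 a b Z /\
  (forall x, a <= x <= b -> dot (Z x) (tangent a b gamma x) = 0) /\
  exists lambda : R -> R, smooth_on a b lambda /\
    forall x, a <= x <= b ->
      Derive_on3 a b Z x = (lambda x *: tangent a b gamma x)%R3.

Definition unit_normal (a b : R) (gamma : R -> R3) (x : R) (w : R3) : Prop :=
  norm3 w = 1 /\ dot w (tangent a b gamma x) = 0.

(* [theta] represents the holonomy of [gamma] with respect to (Wa, Wb), which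
   is an element of R / 2 pi Z. *)
Definition is_holonomy (a b : R) (Wa Wb : R3) (gamma : R -> R3) (theta : R)
  : Prop :=
  exists Z : R -> R3,
    parallel_normal_field a b gamma Z /\ Z a = Wa /\
    Z b = (cos theta *: Wb + sin theta *: (tangent a b gamma b >< Wb))%R3.

(** * Variations *)

Definition variation (a b : R) (gamma : R -> R3) (eps : R) (G : R -> R -> R3)
  : Prop :=
  0 < eps /\
  smooth_rect3 (- eps) eps a b G /\
  (forall t, - eps <= t <= eps -> curve a b (G t)) /\
  (forall x, a <= x <= b -> G 0 x = gamma x).

Definition compactly_supported_variation (a b : R) (gamma : R -> R3) (eps : R)
  (G : R -> R -> R3) : Prop :=
  variation a b gamma eps G /\
  exists c d, a < c /\ d < b /\
    forall t x, - eps <= t <= eps -> a <= x <= b -> x < c \/ d < x ->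
      G t x = gamma x.

Definition variational_field (G : R -> R -> R3) (x : R) : R3 :=
  (Derive (fun t => coord1 (G t x)) 0, Derive (fun t => coord2 (G t x)) 0,
   Derive (fun t => coord3 (G t x)) 0).

(* C_0^infty([a, b]; R^3) *)
Definition test_field (a b : R) (v : R -> R3) : Prop :=
  smooth_on3 a b v /\
  exists c d, a < c /\ d < b /\
    forall x, a <= x <= b -> x < c \/ d < x -> v x = (0)%R3.

(* dF(v) = l, where [is_rate G l] states that the derivative of F (G t) at
   t = 0 is l. *)
Definition is_differential (a b : R) (is_rate : (R -> R -> R3) -> R -> Prop)
  (gamma v : R -> R3) (l : R) : Prop :=
  forall (eps : R) (G : R -> R -> R3),
    compactly_supported_variation a b gamma eps G ->
    (forall x, a <= x <= b -> variational_field G x = v x) ->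
    is_rate G l.

Definition is_d_bending_energy (a b : R) (rho : R -> R) :=
  is_differential a b
    (fun G l => is_derive (fun t => bending_energy a b rho (G t)) 0 l).

(* A map into R / 2 pi Z is differentiated through a real-valued lift near 0;
   since the lift is continuous at 0, it is unique near 0 up to a constant. *)
Definition is_d_holonomy (a b : R) (Wa Wb : R3) :=
  is_differential a b
    (fun G l => exists theta : R -> R,
      locally 0 (fun t => is_holonomy a b Wa Wb (G t) (theta t)) /\
      is_derive theta 0 l).

(* The derivative of the holonomy does not depend on (Wa, Wb). *)
Definition holonomy_constrained_elastic (a b : R) (rho : R -> R)
  (gamma : R -> R3) : Prop :=
  forall Wa Wb : R3,
    unit_normal a b gamma a Wa -> unit_normal a b gamma b Wb ->
  forall v : R -> R3,
    test_field a b v ->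
    (forall x, a <= x <= b ->
      dot (Derive_on3 a b v x) (Derive_on3 a b gamma x) = 0) ->
    is_d_holonomy a b Wa Wb gamma v 0 ->
    is_d_bending_energy a b rho gamma v 0.

(* Main.v *)
(** (1) is equivalent to (2) by the Lagrange multiplier rule.  For a variation with
    variational field [v] such that [<v', T> = 0], the speed is constant to first order
    and [T] changes by [v'], so [dB(v) = int rho <T', v''> = - int <(rho T')', v'>].
    For the holonomy, let [N] be a parallel unit normal field along [gamma].  Projecting
    [N] onto the normal planes of [gamma_t] and normalizing gives a frame, in which the
    parallel fields of [gamma_t] are obtained by rotating through an angle that is an
    explicit integral; differentiating it in [t] gives [dT_W(v) = - int <T x T', v'>].
    Hence (1) says that [(rho T')'], tested against compactly supported normal fields
    [u = v'], vanishes whenever the four functionals [int u] and [int <T x T', u>] do.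
    So the normal part of [(rho T')'] is a combination of those of constant vectors and
    of [T x T'], which is (3).  Conversely (2) makes [dB(v)] a multiple of [dT_W(v)].
    Taking the tangential part of (2) determines [Lambda], (4) is the first integral of
    [T x] (3), and (5) is the cross product of (4) with [T], the constant [mu] being
    [<a x gamma + b, T>]. *)

Require Import Defs.
From Stdlib Require Import Reals Lra Lia List Classical.
From Coquelicot Require Import Coquelicot.
Open Scope R_scope.

(** The holonomy is differentiated without any theory of differential equations depending on a
    parameter. The field [N] is fixed once along [gamma], so for [gamma_t] the parameter occurs only
    in an integrand built from [tangent a b (G t)] and its x-derivative, and differentiation under
    the integral sign suffices. The projection can be normalized only while [N] is nowhere tangent,
    which compactness grants for small t. The same projection, applied to a constant vector on short
    pieces that are then glued, yields [N] itself. Both differentials are statements about every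
    variation with a given field. Hence (1) is exploited through the straight-line variation
    [gamma + t v], whereas vanishing of the holonomy rate must be verified for all variations; in
    the converse, a lift supplied from outside must be compared with the explicit one. The pointwise
    constraint [<v', T> = 0] gets no multiplier from linear algebra: it is built into the space of
    test fields [u], so that finitely many integral constraints are left, and it reappears as a
    projection onto the normal plane. *)

Lemma R3_ext (u v : R3) :
  coord1 u = coord1 v -> coord2 u = coord2 v -> coord3 u = coord3 v -> u = v.
Proof.
  destruct u as [[u1 u2] u3], v as [[v1 v2] v3]; unfold coord1, coord2, coord3; simpl.
  congruence.
Qed.

Lemma dotE (u v : R3) :
  dot u v = coord1 u * coord1 v + coord2 u * coord2 v + coord3 u * coord3 v.
Proof. destruct u as [[u1 u2] u3], v as [[v1 v2] v3]; reflexivity. Qed.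

Lemma crossE (u v : R3) :
  cross u v = (coord2 u * coord3 v - coord3 u * coord2 v,
               coord3 u * coord1 v - coord1 u * coord3 v,
               coord1 u * coord2 v - coord2 u * coord1 v).
Proof. destruct u as [[u1 u2] u3], v as [[v1 v2] v3]; reflexivity. Qed.

Lemma coord1_tuple (x y z : R) : coord1 (x, y, z) = x. Proof. reflexivity. Qed.
Lemma coord2_tuple (x y z : R) : coord2 (x, y, z) = y. Proof. reflexivity. Qed.
Lemma coord3_tuple (x y z : R) : coord3 (x, y, z) = z. Proof. reflexivity. Qed.
Lemma coord1_plus (u v : R3) : coord1 (u + v)%R3 = coord1 u + coord1 v. Proof. reflexivity. Qed.
Lemma coord2_plus (u v : R3) : coord2 (u + v)%R3 = coord2 u + coord2 v. Proof. reflexivity. Qed.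
Lemma coord3_plus (u v : R3) : coord3 (u + v)%R3 = coord3 u + coord3 v. Proof. reflexivity. Qed.
Lemma coord1_minus (u v : R3) : coord1 (u - v)%R3 = coord1 u - coord1 v. Proof. reflexivity. Qed.
Lemma coord2_minus (u v : R3) : coord2 (u - v)%R3 = coord2 u - coord2 v. Proof. reflexivity. Qed.
Lemma coord3_minus (u v : R3) : coord3 (u - v)%R3 = coord3 u - coord3 v. Proof. reflexivity. Qed.
Lemma coord1_scal k (u : R3) : coord1 (k *: u)%R3 = k * coord1 u. Proof. reflexivity. Qed.
Lemma coord2_scal k (u : R3) : coord2 (k *: u)%R3 = k * coord2 u. Proof. reflexivity. Qed.
Lemma coord3_scal k (u : R3) : coord3 (k *: u)%R3 = k * coord3 u. Proof. reflexivity. Qed.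
Lemma coord1_zero : coord1 (0)%R3 = 0. Proof. reflexivity. Qed.
Lemma coord2_zero : coord2 (0)%R3 = 0. Proof. reflexivity. Qed.
Lemma coord3_zero : coord3 (0)%R3 = 0. Proof. reflexivity. Qed.

#[local] Hint Rewrite dotE crossE coord1_tuple coord2_tuple coord3_tuple
  coord1_plus coord2_plus coord3_plus coord1_minus coord2_minus coord3_minus
  coord1_scal coord2_scal coord3_scal coord1_zero coord2_zero coord3_zero : vec.

(* Equations between integrals live in Coquelicot's carrier, on which [ring] fails. *)
Ltac real_eq := match goal with |- ?l = ?r => change (@eq R l r) end.

(** Proves polynomial identities in the coordinates, hence only what holds for arbitrary vectors.
    Geometric facts such as [dot T T = 1] are therefore used in two moves: a [transitivity] to an
    expression in which these products occur explicitly, then a rewriting. *)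
Ltac vec := intros; try apply R3_ext; try real_eq; autorewrite with vec; ring.

Lemma dot_comm (u v : R3) : dot u v = dot v u. Proof. vec. Qed.

Lemma dot_self_ge0 (u : R3) : 0 <= dot u u.
Proof. autorewrite with vec; nra. Qed.

Lemma dot_self_eq0 (u : R3) : dot u u = 0 -> u = (0)%R3.
Proof. intros H; autorewrite with vec in H; apply R3_ext; autorewrite with vec; nra. Qed.

Lemma dot_self_gt0 (u : R3) : u <> (0)%R3 -> 0 < dot u u.
Proof.
  intros H; destruct (dot_self_ge0 u) as [|E]; auto.
  now destruct H; apply dot_self_eq0.
Qed.

Lemma norm3_sqr (u : R3) : norm3 u * norm3 u = dot u u.
Proof. apply sqrt_sqrt, dot_self_ge0. Qed.

Lemma norm3_eq1 (u : R3) : norm3 u = 1 <-> dot u u = 1.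
Proof.
  split; intros H; [rewrite <- norm3_sqr, H; ring|].
  unfold norm3; rewrite H; apply sqrt_1.
Qed.

(** * One-sided derivatives *)

(** Outside [a, b] the function is continued by its tangent line at [x], where the first-order
    remainder is zero. Through this equivalence every rule for two-sided derivatives carries over to
    the end points. *)
Lemma is_derive_on_extend a b f x l : a <= x <= b ->
  is_derive_on a b f x l <->
  exists g, is_derive g x l /\ forall y, a <= y <= b -> g y = f y.
Proof.
  intros Hx; split.
  - intros [Hl H].
    exists (fun y => if Rle_dec a y then if Rle_dec y b then f y
                     else f x + (y - x) * l else f x + (y - x) * l).
    split; [|intros y Hy; destruct (Rle_dec a y), (Rle_dec y b); lra].
    split; [exact Hl|]; intros x0 Hx0 eps.
    assert (E : x = x0) by (apply is_filter_lim_locally_unique; exact Hx0); subst x0.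
    assert (HF : is_filter_lim (within (fun y => a <= y <= b) (locally x)) x).
    { intros P HP; unfold within; revert HP; apply filter_imp; auto. }
    specialize (H x HF eps); unfold within in H.
    revert H; apply filter_imp; intros y Hy.
    assert (Ex : (if Rle_dec a x then if Rle_dec x b then f x
                     else f x + (x - x) * l else f x + (x - x) * l) = f x).
    { destruct (Rle_dec a x), (Rle_dec x b); lra. }
    rewrite Ex.
    assert (E0 : norm (minus (minus (f x + (y - x) * l) (f x)) (scal (minus y x) l)) <=
       eps * norm (minus y x)).
    { change (Rabs ((f x + (y - x) * l - f x) - (y - x) * l) <= eps * Rabs (y - x)).
      replace (f x + (y - x) * l - f x - (y - x) * l) with 0 by ring.
      rewrite Rabs_R0; apply Rmult_le_pos; [apply Rlt_le, cond_pos|apply Rabs_pos]. }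
    destruct (Rle_dec a y), (Rle_dec y b); auto.
  - intros (g & [Hl H] & E). split; [exact Hl|]; intros x0 Hx0 eps.
    assert (Hp : ProperFilter' (within (fun y => a <= y <= b) (locally x))).
    { constructor; [|apply within_filter, locally_filter].
      intros HF; unfold within in HF; apply (locally_singleton _ _ HF), Hx. }
    assert (HF : is_filter_lim (within (fun y => a <= y <= b) (locally x)) x).
    { intros P HP; unfold within; revert HP; apply filter_imp; auto. }
    assert (x = x0) by (eapply is_filter_lim_unique; [exact HF|exact Hx0]).
    subst x0; unfold within.
    assert (HL : is_filter_lim (locally x) x) by (intros P HP; exact HP).
    generalize (H x HL eps); apply filter_imp; intros y Hy Hab.
    rewrite <- !E by auto; exact Hy.
Qed.

Opaque is_derive_on.

Lemma is_derive_on_is_derive a b f x l : a <= x <= b ->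
  is_derive f x l -> is_derive_on a b f x l.
Proof. intros Hx H; apply is_derive_on_extend; auto; exists f; auto. Qed.

Lemma is_derive_on_interior a b f x l : a < x < b ->
  is_derive_on a b f x l -> is_derive f x l.
Proof.
  intros Hx H; apply is_derive_on_extend in H; [|lra].
  destruct H as (g & Hg & E).
  apply (is_derive_ext_loc g); auto.
  apply (locally_interval _ x a b); simpl; try lra.
  intros y H1 H2; apply E; simpl in *; lra.
Qed.

Lemma is_derive_on_ext a b f g x l : a <= x <= b ->
  (forall y, a <= y <= b -> f y = g y) ->
  is_derive_on a b f x l -> is_derive_on a b g x l.
Proof.
  intros Hx E H; apply is_derive_on_extend in H; auto.
  destruct H as (h & Hh & Eh); apply is_derive_on_extend; auto.
  exists h; split; auto; intros y Hy; rewrite Eh, E; auto.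
Qed.

Lemma is_derive_on_subset a b c d f x l : c <= x <= d -> a <= c -> d <= b ->
  is_derive_on a b f x l -> is_derive_on c d f x l.
Proof.
  intros Hx H1 H2 H; apply is_derive_on_extend in H; [|lra].
  destruct H as (h & Hh & Eh); apply is_derive_on_extend; auto.
  exists h; split; auto; intros y Hy; apply Eh; lra.
Qed.

Lemma is_derive_on_ext_loc a b f g x l : a <= x <= b ->
  locally x (fun y => a <= y <= b -> f y = g y) ->
  is_derive_on a b f x l -> is_derive_on a b g x l.
Proof.
  intros Hx E H; apply is_derive_on_extend in H; auto.
  destruct H as (h & Hh & Eh); apply is_derive_on_extend; auto.
  exists (fun y => if Rle_dec a y then if Rle_dec y b then g y else h y else h y); split.
  - apply (is_derive_ext_loc h); auto.
    revert E; apply filter_imp; intros y Hy.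
    destruct (Rle_dec a y); auto; destruct (Rle_dec y b); auto.
    rewrite <- Hy by lra; apply Eh; lra.
  - intros y Hy; destruct (Rle_dec a y), (Rle_dec y b); lra.
Qed.

Lemma is_derive_on_unique a b f x l1 l2 : a < b -> a <= x <= b ->
  is_derive_on a b f x l1 -> is_derive_on a b f x l2 -> l1 = l2.
Proof.
  intros Hab Hx H1 H2.
  apply is_derive_on_extend in H1; auto; apply is_derive_on_extend in H2; auto.
  destruct H1 as (g1 & H1 & E1), H2 as (g2 & H2 & E2).
  assert (H : is_derive (fun y => g1 y - g2 y) x (l1 - l2)).
  { apply (is_derive_minus g1 g2); auto. }
  assert (E0 : forall y, a <= y <= b -> g1 y - g2 y = 0).
  { intros y Hy; rewrite E1, E2; auto; ring. }
  apply is_derive_Reals in H.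
  destruct (Req_dec l1 l2) as [|N]; auto; exfalso.
  destruct (H (Rabs (l1 - l2))) as [d Hd]; [apply Rabs_pos_lt; lra|].
  (* A step of at most half the length of [a, b] stays inside the interval in at least one of the
     two directions. *)
  assert (exists h, h <> 0 /\ Rabs h < d /\ a <= x + h <= b) as (h & Hh0 & Hhd & Hh).
  { pose proof (cond_pos d).
    pose proof (Rmin_l (d / 2) ((b - a) / 2)); pose proof (Rmin_r (d / 2) ((b - a) / 2)).
    assert (0 < Rmin (d / 2) ((b - a) / 2)) by (apply Rmin_glb_lt; lra).
    destruct (Rle_dec (x + Rmin (d / 2) ((b - a) / 2)) b).
    - exists (Rmin (d / 2) ((b - a) / 2)); rewrite Rabs_pos_eq; lra.
    - exists (- Rmin (d / 2) ((b - a) / 2)); rewrite Rabs_Ropp, Rabs_pos_eq; lra. }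
  specialize (Hd h Hh0 Hhd); rewrite !E0 in Hd by lra.
  replace ((0 - 0) / h - (l1 - l2)) with (- (l1 - l2)) in Hd by (field; auto).
  rewrite Rabs_Ropp in Hd; lra.
Qed.

Lemma Derive_on_eq a b f x l : a < b -> a <= x <= b ->
  is_derive_on a b f x l -> Derive_on a b f x = l.
Proof.
  intros Hab Hx H; apply (iota_unique (V := R_CompleteNormedModule)); auto.
  intros y Hy; eapply is_derive_on_unique; eauto.
Qed.

Lemma Derive_on_correct a b f x : a < b -> a <= x <= b ->
  ex_derive_on a b f x -> is_derive_on a b f x (Derive_on a b f x).
Proof. intros Hab Hx [l Hl]; rewrite (Derive_on_eq _ _ _ _ l); auto. Qed.

Lemma is_derive_on_eq a b f x l l' : is_derive_on a b f x l -> l = l' -> is_derive_on a b f x l'.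
Proof. intros; subst; auto. Qed.

Lemma is_derive_on_const a b c x : a <= x <= b -> is_derive_on a b (fun _ => c) x 0.
Proof. intros; apply is_derive_on_is_derive; auto; apply (is_derive_const c). Qed.

Lemma is_derive_on_id a b x : a <= x <= b -> is_derive_on a b (fun y => y) x 1.
Proof. intros; apply is_derive_on_is_derive; auto; apply (is_derive_id x). Qed.

Lemma is_derive_on_plus a b f g x df dg : a <= x <= b ->
  is_derive_on a b f x df -> is_derive_on a b g x dg ->
  is_derive_on a b (fun y => f y + g y) x (df + dg).
Proof.
  intros Hx H1 H2.
  apply is_derive_on_extend in H1; auto; apply is_derive_on_extend in H2; auto.
  destruct H1 as (g1 & H1 & E1), H2 as (g2 & H2 & E2).
  apply is_derive_on_extend; auto; exists (fun y => g1 y + g2 y); split.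
  - apply (is_derive_plus g1 g2); auto.
  - intros y Hy; rewrite E1, E2; auto.
Qed.

Lemma is_derive_on_mult a b f g x df dg : a <= x <= b ->
  is_derive_on a b f x df -> is_derive_on a b g x dg ->
  is_derive_on a b (fun y => f y * g y) x (df * g x + f x * dg).
Proof.
  intros Hx H1 H2.
  apply is_derive_on_extend in H1; auto; apply is_derive_on_extend in H2; auto.
  destruct H1 as (g1 & H1 & E1), H2 as (g2 & H2 & E2).
  apply is_derive_on_extend; auto; exists (fun y => g1 y * g2 y); split.
  - rewrite <- E1, <- E2 by auto.
    apply (is_derive_mult g1 g2 x df dg H1 H2); intros; apply Rmult_comm.
  - intros y Hy; rewrite E1, E2; auto.
Qed.

Lemma is_derive_on_comp a b h f x dh df : a <= x <= b ->
  is_derive h (f x) dh -> is_derive_on a b f x df ->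
  is_derive_on a b (fun y => h (f y)) x (dh * df).
Proof.
  intros Hx H1 H2; apply is_derive_on_extend in H2; auto; destruct H2 as (g2 & H2 & E2).
  apply is_derive_on_extend; auto; exists (fun y => h (g2 y)); split.
  - rewrite Rmult_comm; apply (is_derive_comp h g2); auto; rewrite E2; auto.
  - intros y Hy; rewrite E2; auto.
Qed.

Lemma is_derive_on_opp a b f x df : a <= x <= b ->
  is_derive_on a b f x df -> is_derive_on a b (fun y => - f y) x (- df).
Proof.
  intros Hx H; apply (is_derive_on_ext a b (fun y => -1 * f y)); auto.
  - intros; ring.
  - eapply is_derive_on_eq.
    + apply (is_derive_on_mult a b (fun _ => -1)); eauto using is_derive_on_const.
    + ring.
Qed.

Lemma is_derive_on_minus a b f g x df dg : a <= x <= b ->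
  is_derive_on a b f x df -> is_derive_on a b g x dg ->
  is_derive_on a b (fun y => f y - g y) x (df - dg).
Proof.
  intros Hx H1 H2; apply (is_derive_on_plus a b f (fun y => - g y)); auto.
  now apply is_derive_on_opp.
Qed.

Definition is_derive_on3 (a b : R) (f : R -> R3) (x : R) (l : R3) : Prop :=
  is_derive_on a b (comp1 f) x (coord1 l) /\
  is_derive_on a b (comp2 f) x (coord2 l) /\
  is_derive_on a b (comp3 f) x (coord3 l).

Lemma Derive_on3_eq a b f x l : a < b -> a <= x <= b ->
  is_derive_on3 a b f x l -> Derive_on3 a b f x = l.
Proof.
  intros Hab Hx (H1 & H2 & H3); apply R3_ext; apply Derive_on_eq; auto.
Qed.

Lemma is_derive_on3_ext a b f g x l : a <= x <= b ->
  (forall y, a <= y <= b -> f y = g y) ->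
  is_derive_on3 a b f x l -> is_derive_on3 a b g x l.
Proof.
  intros Hx E (H1 & H2 & H3); split; [|split];
    [apply (is_derive_on_ext a b (comp1 f)) | apply (is_derive_on_ext a b (comp2 f))
    | apply (is_derive_on_ext a b (comp3 f))]; auto;
    intros y Hy; unfold comp1, comp2, comp3; rewrite E; auto.
Qed.

Lemma is_derive_on3_ext_loc a b f g x l : a <= x <= b ->
  locally x (fun y => a <= y <= b -> f y = g y) ->
  is_derive_on3 a b f x l -> is_derive_on3 a b g x l.
Proof.
  intros Hx E (H1 & H2 & H3); split; [|split];
    [apply (is_derive_on_ext_loc a b (comp1 f)) | apply (is_derive_on_ext_loc a b (comp2 f))
    | apply (is_derive_on_ext_loc a b (comp3 f))]; auto;
    revert E; apply filter_imp; intros y Ey Hy; unfold comp1, comp2, comp3; rewrite Ey; auto.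
Qed.

Lemma is_derive_on3_eq a b f x l l' :
  is_derive_on3 a b f x l -> l = l' -> is_derive_on3 a b f x l'.
Proof. intros; subst; auto. Qed.

Lemma is_derive_on3_const a b (c : R3) x : a <= x <= b ->
  is_derive_on3 a b (fun _ => c) x (0)%R3.
Proof. intros Hx; split; [|split];
    [apply (is_derive_on_const a b (coord1 c)) | apply (is_derive_on_const a b (coord2 c))
    | apply (is_derive_on_const a b (coord3 c))]; auto. Qed.

Lemma is_derive_on3_plus a b f g x df dg : a <= x <= b ->
  is_derive_on3 a b f x df -> is_derive_on3 a b g x dg ->
  is_derive_on3 a b (fun y => f y + g y)%R3 x (df + dg)%R3.
Proof.
  intros Hx (F1 & F2 & F3) (G1 & G2 & G3); split; [|split].
  - now apply (is_derive_on_plus a b (comp1 f) (comp1 g)).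
  - now apply (is_derive_on_plus a b (comp2 f) (comp2 g)).
  - now apply (is_derive_on_plus a b (comp3 f) (comp3 g)).
Qed.

Lemma is_derive_on3_minus a b f g x df dg : a <= x <= b ->
  is_derive_on3 a b f x df -> is_derive_on3 a b g x dg ->
  is_derive_on3 a b (fun y => f y - g y)%R3 x (df - dg)%R3.
Proof.
  intros Hx (F1 & F2 & F3) (G1 & G2 & G3); split; [|split].
  - now apply (is_derive_on_minus a b (comp1 f) (comp1 g)).
  - now apply (is_derive_on_minus a b (comp2 f) (comp2 g)).
  - now apply (is_derive_on_minus a b (comp3 f) (comp3 g)).
Qed.

Lemma is_derive_on3_scal a b k f x dk df : a <= x <= b ->
  is_derive_on a b k x dk -> is_derive_on3 a b f x df ->
  is_derive_on3 a b (fun y => k y *: f y)%R3 x (dk *: f x + k x *: df)%R3.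
Proof.
  intros Hx K (F1 & F2 & F3); split; [|split].
  - now apply (is_derive_on_mult a b k (comp1 f)).
  - now apply (is_derive_on_mult a b k (comp2 f)).
  - now apply (is_derive_on_mult a b k (comp3 f)).
Qed.

Lemma is_derive_on3_dot a b f g x df dg : a <= x <= b ->
  is_derive_on3 a b f x df -> is_derive_on3 a b g x dg ->
  is_derive_on a b (fun y => dot (f y) (g y)) x (dot df (g x) + dot (f x) dg).
Proof.
  intros Hx (F1 & F2 & F3) (G1 & G2 & G3).
  apply (is_derive_on_ext a b
    (fun y => comp1 f y * comp1 g y + comp2 f y * comp2 g y + comp3 f y * comp3 g y)); auto.
  - intros y _; rewrite dotE; reflexivity.
  - eapply is_derive_on_eq.
    + repeat apply is_derive_on_plus; auto; apply is_derive_on_mult; eauto.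
    + rewrite !dotE; unfold comp1, comp2, comp3; ring.
Qed.

Lemma is_derive_on3_cross a b f g x df dg : a <= x <= b ->
  is_derive_on3 a b f x df -> is_derive_on3 a b g x dg ->
  is_derive_on3 a b (fun y => f y >< g y)%R3 x (df >< g x + f x >< dg)%R3.
Proof.
  intros Hx (F1 & F2 & F3) (G1 & G2 & G3).
  apply (is_derive_on3_ext a b (fun y =>
    (comp2 f y * comp3 g y - comp3 f y * comp2 g y,
     comp3 f y * comp1 g y - comp1 f y * comp3 g y,
     comp1 f y * comp2 g y - comp2 f y * comp1 g y))); auto.
  - intros y _; rewrite crossE; reflexivity.
  - split; [|split]; (eapply is_derive_on_eq;
     [apply is_derive_on_minus; auto; apply is_derive_on_mult; eauto|
      autorewrite with vec; unfold comp1, comp2, comp3; ring]).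
Qed.

(** * Smooth functions *)

(** Coinduction for smoothness. The iterates of [Derive_on] are matched with members of [P] on
    [a, b] only, since [iota] yields nothing meaningful outside. *)
Lemma smooth_on_coind a b (P : (R -> R) -> Prop) : a < b ->
  (forall f, P f -> exists df, P df /\ forall x, a <= x <= b -> is_derive_on a b f x (df x)) ->
  forall f, P f -> smooth_on a b f.
Proof.
  intros Hab HP f Pf.
  assert (H : forall n, exists g, P g /\
    forall x, a <= x <= b -> g x = Nat.iter n (Derive_on a b) f x).
  { induction n as [|n (g & Pg & E)]; [exists f; auto|].
    destruct (HP g Pg) as (dg & Pdg & Hdg); exists dg; split; auto.
    intros x Hx; symmetry; apply Derive_on_eq; auto.
    apply (is_derive_on_ext a b g); auto. }
  intros n x Hx; destruct (H n) as (g & Pg & E).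
  destruct (HP g Pg) as (dg & Pdg & Hdg); exists (dg x).
  apply (is_derive_on_ext a b g); auto.
Qed.

Lemma smooth_on_derive a b f : smooth_on a b f -> smooth_on a b (Derive_on a b f).
Proof. intros H n x Hx; generalize (H (S n) x Hx); rewrite Nat.iter_succ_r; auto. Qed.

Lemma smooth_on_is_derive_on a b f x : a < b -> smooth_on a b f -> a <= x <= b ->
  is_derive_on a b f x (Derive_on a b f x).
Proof. intros Hab H Hx; apply Derive_on_correct; auto; apply (H O x Hx). Qed.

(* Closing a set of generators under the operations below, and then under
   differentiation, shows that all its elements are smooth. *)
Inductive generated (a b : R) (gen : (R -> R) -> Prop) : (R -> R) -> Prop :=
| gen_base f : gen f -> generated a b gen f
| gen_ext f g : generated a b gen f -> (forall x, a <= x <= b -> f x = g x) ->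
    generated a b gen g
| gen_const c : generated a b gen (fun _ => c)
| gen_plus f g : generated a b gen f -> generated a b gen g ->
    generated a b gen (fun x => f x + g x)
| gen_mult f g : generated a b gen f -> generated a b gen g ->
    generated a b gen (fun x => f x * g x)
| gen_inv f : generated a b gen f -> (forall x, a <= x <= b -> f x <> 0) ->
    generated a b gen (fun x => / f x)
| gen_sqrt f : generated a b gen f -> (forall x, a <= x <= b -> 0 < f x) ->
    generated a b gen (fun x => sqrt (f x))
| gen_cos f : generated a b gen f -> generated a b gen (fun x => cos (f x))
| gen_sin f : generated a b gen f -> generated a b gen (fun x => sin (f x)).

(** The derivative of a generator only has to lie in the closure, so generators may refer to each
    other: solutions of differential equations and the family [flat] are treated in this way. *)
Lemma generated_smooth_on a b gen : a < b ->
  (forall f, gen f -> exists df, generated a b gen df /\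
     forall x, a <= x <= b -> is_derive_on a b f x (df x)) ->
  forall f, generated a b gen f -> smooth_on a b f.
Proof.
  intros Hab Hgen; apply smooth_on_coind; auto.
  intros f Hf; induction Hf as [f Hf|f g Hf [df [IH1 IH2]] E|c
    |f g Hf [df [F1 F2]] Hg [dg [G1 G2]]|f g Hf [df [F1 F2]] Hg [dg [G1 G2]]
    |f Hf [df [F1 F2]] N|f Hf [df [F1 F2]] N|f Hf [df [F1 F2]]|f Hf [df [F1 F2]]].
  - destruct (Hgen f Hf) as (df & H1 & H2); eauto.
  - exists df; split; auto; intros x Hx; apply (is_derive_on_ext a b f); auto.
  - exists (fun _ => 0); split; [apply gen_const|intros; apply is_derive_on_const; auto].
  - exists (fun x => df x + dg x); split; [apply gen_plus; auto|].
    intros; apply is_derive_on_plus; auto.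
  - exists (fun x => df x * g x + f x * dg x); split; [apply gen_plus; apply gen_mult; auto|].
    intros; apply is_derive_on_mult; auto.
  - exists (fun x => (-1 * (/ f x * / f x)) * df x); split.
    + apply gen_mult; auto; apply gen_mult; [apply gen_const|].
      apply gen_mult; apply gen_inv; auto.
    + intros x Hx; apply (is_derive_on_comp a b Rinv); auto.
      replace (-1 * (/ f x * / f x)) with (- 1 / f x ^ 2) by (field; auto).
      apply (is_derive_inv (fun y => y)); auto; apply (is_derive_id (f x)).
  - exists (fun x => (/ 2 * / sqrt (f x)) * df x); split.
    + apply gen_mult; auto; apply gen_mult; [apply gen_const|].
      apply gen_inv; [apply gen_sqrt; auto|].
      intros x Hx; apply Rgt_not_eq, sqrt_lt_R0; auto.
    + intros x Hx; apply (is_derive_on_comp a b sqrt); auto.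
      assert (0 < sqrt (f x)) by (apply sqrt_lt_R0; auto).
      replace (/ 2 * / sqrt (f x)) with (1 / (2 * sqrt (f x))) by (field; lra).
      apply (is_derive_sqrt (fun y => y)); auto; apply (is_derive_id (f x)).
  - exists (fun x => (-1 * sin (f x)) * df x); split.
    + repeat (apply gen_mult || apply gen_const || apply gen_sin); auto.
    + intros x Hx; apply (is_derive_on_comp a b cos); auto.
      replace (-1 * sin (f x)) with (- sin (f x)) by ring; apply is_derive_cos.
  - exists (fun x => cos (f x) * df x); split.
    + repeat (apply gen_mult || apply gen_cos); auto.
    + intros x Hx; apply (is_derive_on_comp a b sin); auto; apply is_derive_sin.
Qed.

Lemma generated_smooth a b f : a < b -> generated a b (smooth_on a b) f -> smooth_on a b f.
Proof.
  intros Hab; apply generated_smooth_on; auto; clear f; intros f Hf.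
  exists (Derive_on a b f); split; [apply gen_base, smooth_on_derive; auto|].
  intros; apply smooth_on_is_derive_on; auto.
Qed.

(** Adjoining [f] itself to the smooth functions gives a set of generators whose derivatives are all
    smooth. *)
Lemma smooth_on_of_derive a b f df : a < b ->
  (forall x, a <= x <= b -> is_derive_on a b f x (df x)) -> smooth_on a b df ->
  smooth_on a b f.
Proof.
  intros Hab H Hdf.
  apply (generated_smooth_on a b (fun g => smooth_on a b g \/ g = f)); auto.
  - intros g [Hg| ->].
    + exists (Derive_on a b g); split; [apply gen_base; left; apply smooth_on_derive; auto|].
      intros; apply smooth_on_is_derive_on; auto.
    + exists df; split; auto; apply gen_base; auto.
  - apply gen_base; auto.
Qed.

Section Closure.
Context (a b : R) (hab : a < b).

Lemma smooth_on_ext f g : (forall x, a <= x <= b -> f x = g x) ->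
  smooth_on a b f -> smooth_on a b g.
Proof.
  intros E Hf; apply generated_smooth; auto; apply (gen_ext a b _ f); auto.
  now apply gen_base.
Qed.

Lemma smooth_on_const c : smooth_on a b (fun _ => c).
Proof. apply generated_smooth; auto; apply gen_const. Qed.

Lemma smooth_on_plus f g : smooth_on a b f -> smooth_on a b g ->
  smooth_on a b (fun x => f x + g x).
Proof. intros; apply generated_smooth; auto; apply gen_plus; apply gen_base; auto. Qed.

Lemma smooth_on_mult f g : smooth_on a b f -> smooth_on a b g ->
  smooth_on a b (fun x => f x * g x).
Proof. intros; apply generated_smooth; auto; apply gen_mult; apply gen_base; auto. Qed.

Lemma smooth_on_opp f : smooth_on a b f -> smooth_on a b (fun x => - f x).
Proof.
  intros H; apply (smooth_on_ext (fun x => -1 * f x)); [intros; ring|].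
  apply smooth_on_mult; auto; apply smooth_on_const.
Qed.

Lemma smooth_on_minus f g : smooth_on a b f -> smooth_on a b g ->
  smooth_on a b (fun x => f x - g x).
Proof. intros Hf Hg; apply (smooth_on_plus f (fun x => - g x)); auto; now apply smooth_on_opp. Qed.

Lemma smooth_on_inv f : smooth_on a b f -> (forall x, a <= x <= b -> f x <> 0) ->
  smooth_on a b (fun x => / f x).
Proof. intros; apply generated_smooth; auto; apply gen_inv; auto; apply gen_base; auto. Qed.

Lemma smooth_on_sqrt f : smooth_on a b f -> (forall x, a <= x <= b -> 0 < f x) ->
  smooth_on a b (fun x => sqrt (f x)).
Proof. intros; apply generated_smooth; auto; apply gen_sqrt; auto; apply gen_base; auto. Qed.

Lemma smooth_on_cos f : smooth_on a b f -> smooth_on a b (fun x => cos (f x)).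
Proof. intros; apply generated_smooth; auto; apply gen_cos; apply gen_base; auto. Qed.

Lemma smooth_on_sin f : smooth_on a b f -> smooth_on a b (fun x => sin (f x)).
Proof. intros; apply generated_smooth; auto; apply gen_sin; apply gen_base; auto. Qed.

Lemma smooth_on3_ext f g : (forall x, a <= x <= b -> f x = g x) ->
  smooth_on3 a b f -> smooth_on3 a b g.
Proof.
  intros E (H1 & H2 & H3); split; [|split];
  [apply (smooth_on_ext (comp1 f)) | apply (smooth_on_ext (comp2 f))
  | apply (smooth_on_ext (comp3 f))]; auto;
  intros x Hx; unfold comp1, comp2, comp3; rewrite E; auto.
Qed.

Lemma smooth_on3_const c : smooth_on3 a b (fun _ => c).
Proof.
  split; [|split]; [apply (smooth_on_const (coord1 c)) |
  apply (smooth_on_const (coord2 c)) | apply (smooth_on_const (coord3 c))].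
Qed.

Lemma smooth_on3_plus f g : smooth_on3 a b f -> smooth_on3 a b g ->
  smooth_on3 a b (fun x => f x + g x)%R3.
Proof.
  intros (F1 & F2 & F3) (G1 & G2 & G3); split; [|split].
  - now apply (smooth_on_plus (comp1 f) (comp1 g)).
  - now apply (smooth_on_plus (comp2 f) (comp2 g)).
  - now apply (smooth_on_plus (comp3 f) (comp3 g)).
Qed.

Lemma smooth_on3_minus f g : smooth_on3 a b f -> smooth_on3 a b g ->
  smooth_on3 a b (fun x => f x - g x)%R3.
Proof.
  intros (F1 & F2 & F3) (G1 & G2 & G3); split; [|split].
  - now apply (smooth_on_minus (comp1 f) (comp1 g)).
  - now apply (smooth_on_minus (comp2 f) (comp2 g)).
  - now apply (smooth_on_minus (comp3 f) (comp3 g)).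
Qed.

Lemma smooth_on3_scal k f : smooth_on a b k -> smooth_on3 a b f ->
  smooth_on3 a b (fun x => k x *: f x)%R3.
Proof.
  intros K (F1 & F2 & F3); split; [|split].
  - now apply (smooth_on_mult k (comp1 f)).
  - now apply (smooth_on_mult k (comp2 f)).
  - now apply (smooth_on_mult k (comp3 f)).
Qed.

Lemma smooth_on3_dot f g : smooth_on3 a b f -> smooth_on3 a b g ->
  smooth_on a b (fun x => dot (f x) (g x)).
Proof.
  intros (F1 & F2 & F3) (G1 & G2 & G3).
  apply (smooth_on_ext (fun x =>
    comp1 f x * comp1 g x + comp2 f x * comp2 g x + comp3 f x * comp3 g x)).
  - intros x _; rewrite dotE; reflexivity.
  - repeat apply smooth_on_plus; apply smooth_on_mult; auto.
Qed.

Lemma smooth_on3_cross f g : smooth_on3 a b f -> smooth_on3 a b g ->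
  smooth_on3 a b (fun x => f x >< g x)%R3.
Proof.
  intros (F1 & F2 & F3) (G1 & G2 & G3).
  apply (smooth_on3_ext (fun x =>
    (comp2 f x * comp3 g x - comp3 f x * comp2 g x,
     comp3 f x * comp1 g x - comp1 f x * comp3 g x,
     comp1 f x * comp2 g x - comp2 f x * comp1 g x))).
  - intros x _; rewrite crossE; reflexivity.
  - split; [|split]; apply smooth_on_minus; apply smooth_on_mult; auto.
Qed.

Lemma smooth_on3_derive f : smooth_on3 a b f -> smooth_on3 a b (Derive_on3 a b f).
Proof. intros (F1 & F2 & F3); split; [|split]; now apply smooth_on_derive. Qed.

Lemma smooth_on3_is_derive_on3 f x : smooth_on3 a b f -> a <= x <= b ->
  is_derive_on3 a b f x (Derive_on3 a b f x).
Proof.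
  intros (F1 & F2 & F3) Hx; split; [|split]; now apply smooth_on_is_derive_on.
Qed.

End Closure.

(** * Integrals over a closed interval *)

(** The projection of R onto [a, b]. Composition with it turns continuity relative to [a, b] into
    continuity on all of R, where the theorems on integrals apply. *)
Definition clamp (a b x : R) : R := Rmax a (Rmin b x).

Lemma clamp_in a b x : a <= b -> a <= clamp a b x <= b.
Proof.
  intros H; unfold clamp; split; [apply Rmax_l|].
  apply Rmax_lub; auto; apply Rmin_l.
Qed.

Lemma clamp_id a b x : a <= x <= b -> clamp a b x = x.
Proof. intros H; unfold clamp; rewrite Rmin_right, Rmax_right; lra. Qed.

Lemma clamp_continuous a b x : continuous (clamp a b) x.
Proof.
  assert (L : forall u v, Rabs (clamp a b u - clamp a b v) <= Rabs (u - v)).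
  { intros u v; unfold clamp, Rmax, Rmin.
    destruct (Rle_dec b u), (Rle_dec b v);
      repeat destruct (Rle_dec a _); unfold Rabs; repeat destruct Rcase_abs; lra. }
  intros P [d Hd]; exists d; intros y Hy; apply Hd.
  eapply Rle_lt_trans; [apply L|exact Hy].
Qed.

(* Continuity of the restriction to [a, b]. *)
Definition ccont (a b : R) (f : R -> R) : Prop :=
  forall x, continuous (fun y => f (clamp a b y)) x.

Section Integrals.
Context (a b : R) (hab : a < b).

Lemma ccont_of_derive f df :
  (forall x, a <= x <= b -> is_derive_on a b f x (df x)) -> ccont a b f.
Proof.
  intros H x.
  assert (Hc : a <= clamp a b x <= b) by (apply clamp_in; lra).
  specialize (H _ Hc); apply is_derive_on_extend in H; auto.
  destruct H as (g & Hg & E).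
  apply (continuous_ext (fun y => g (clamp a b y))).
  - intros y; apply E, clamp_in; lra.
  - apply (continuous_comp (clamp a b) g); [apply clamp_continuous|].
    apply (ex_derive_continuous g); eexists; apply Hg.
Qed.

Lemma smooth_on_ccont f : smooth_on a b f -> ccont a b f.
Proof.
  intros H; apply (ccont_of_derive f (Derive_on a b f)).
  intros; apply smooth_on_is_derive_on; auto.
Qed.

Lemma ccont_const c : ccont a b (fun _ => c).
Proof. intros x; apply continuous_const. Qed.

Lemma RInt_clamp (f : R -> R) c d : a <= c <= b -> a <= d <= b ->
  RInt f c d = RInt (fun y => f (clamp a b y)) c d.
Proof.
  intros Hc Hd; apply RInt_ext; intros x Hx; rewrite clamp_id; auto.
  pose proof (Rmin_glb c d a); pose proof (Rmax_lub c d b); lra.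
Qed.

Lemma ex_RInt_ccont (f : R -> R) c d : ccont a b f -> a <= c <= b -> a <= d <= b -> ex_RInt f c d.
Proof.
  intros H Hc Hd; apply (ex_RInt_ext (fun y => f (clamp a b y))).
  - intros x Hx; rewrite clamp_id; auto.
    pose proof (Rmin_glb c d a); pose proof (Rmax_lub c d b); lra.
  - apply (ex_RInt_continuous (V := R_CompleteNormedModule)); intros z _; apply H.
Qed.

Lemma is_derive_on_RInt (f : R -> R) x : ccont a b f -> a <= x <= b ->
  is_derive_on a b (fun y => RInt f a y) x (f x).
Proof.
  intros H Hx; apply is_derive_on_extend; auto.
  exists (fun y => RInt (fun z => f (clamp a b z)) a y); split.
  - replace (f x) with (f (clamp a b x)) by (rewrite clamp_id; auto).
    apply (is_derive_RInt (fun z => f (clamp a b z)) _ a); [|apply H].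
    apply filter_forall; intros y; apply (RInt_correct (V := R_CompleteNormedModule)).
    apply (ex_RInt_continuous (V := R_CompleteNormedModule)); intros z _; apply H.
  - intros y Hy; rewrite <- RInt_clamp; auto; lra.
Qed.

Lemma is_derive_on_zero_const h :
  (forall x, a <= x <= b -> is_derive_on a b h x 0) ->
  forall x, a <= x <= b -> h x = h a.
Proof.
  intros H x Hx.
  destruct (MVT_gen (fun y => h (clamp a b y)) a x (fun _ => 0)) as (c & Hc & E).
  - rewrite Rmin_left, Rmax_right by lra; intros y Hy.
    apply (is_derive_ext_loc h).
    + apply (locally_interval _ y a b); simpl; try lra.
      intros z H1 H2; simpl in *; rewrite clamp_id; lra.
    + apply (is_derive_on_interior a b); [lra|]; apply H; lra.
  - intros y _; apply continuity_pt_filterlim.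
    apply (ccont_of_derive h (fun _ => 0)); auto.
  - rewrite !clamp_id in E by lra; lra.
Qed.

Lemma RInt_derive_on (f df : R -> R) x :
  (forall y, a <= y <= b -> is_derive_on a b f y (df y)) -> ccont a b df ->
  a <= x <= b -> RInt df a x = f x - f a.
Proof.
  intros H Hc Hx.
  pose proof (is_derive_on_zero_const (fun y => RInt df a y - f y)) as K; simpl in K.
  specialize (fun h => K h x Hx).
  assert (E : RInt df a a = 0) by apply (RInt_point (V := R_CompleteNormedModule)).
  rewrite E in K; cut (RInt df a x - f x = 0 - f a); [lra|]; apply K.
  intros y Hy; eapply is_derive_on_eq.
  - apply is_derive_on_minus; auto; apply is_derive_on_RInt; auto.
  - simpl; ring.
Qed.

Lemma smooth_on_RInt (f : R -> R) : smooth_on a b f -> smooth_on a b (fun x => RInt f a x).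
Proof.
  intros H; apply (smooth_on_of_derive a b _ f); auto.
  intros; apply is_derive_on_RInt; auto; now apply smooth_on_ccont.
Qed.

Lemma ccont_zero_interior (f : R -> R) : ccont a b f -> (forall x, a < x < b -> f x = 0) ->
  forall x, a <= x <= b -> f x = 0.
Proof.
  intros Hc H x Hx.
  destruct (Req_dec (f x) 0) as [|N]; auto; exfalso.
  assert (L : locally x (fun y => f (clamp a b y) <> 0)).
  { apply (Hc x (fun z => z <> 0)); rewrite clamp_id by auto.
    apply (open_neq 0); auto. }
  destruct L as [d Hd]; pose proof (cond_pos d).
  (* A step of at most a third of the length, to the right unless [x] is close to [b], ends strictly
     inside the interval. *)
  assert (exists y, a < y < b /\ Rabs (y - x) < d) as (y & Hy & Hyd).
  { pose proof (Rmin_l (d / 2) ((b - a) / 3)); pose proof (Rmin_r (d / 2) ((b - a) / 3)).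
    assert (0 < Rmin (d / 2) ((b - a) / 3)) by (apply Rmin_glb_lt; lra).
    destruct (Rle_dec (x + Rmin (d / 2) ((b - a) / 3)) ((b + b + a) / 3)).
    - exists (x + Rmin (d / 2) ((b - a) / 3)); split; [lra|].
      rewrite Rabs_pos_eq; lra.
    - exists (x - Rmin (d / 2) ((b - a) / 3)); split; [lra|].
      rewrite Rabs_left; lra. }
  apply (Hd y); [exact Hyd|]; rewrite clamp_id by lra; auto.
Qed.

(** The integrals over [a, x] and [x, b] are nonnegative with sum zero, so the primitive is
    identically zero, and [f] is its derivative. *)
Lemma RInt_nonneg_eq0 (f : R -> R) : ccont a b f -> (forall x, a <= x <= b -> 0 <= f x) ->
  RInt f a b = 0 -> forall x, a <= x <= b -> f x = 0.
Proof.
  intros Hc Hp H0.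
  assert (K : forall x, a <= x <= b -> RInt f a x = 0).
  { intros x Hx.
    assert (E : RInt f a x + RInt f x b = RInt f a b).
    { apply (RInt_Chasles (V := R_CompleteNormedModule) f); apply ex_RInt_ccont; auto; lra. }
    assert (0 <= RInt f a x) by (apply RInt_ge_0; [lra|apply ex_RInt_ccont; auto; lra|];
      intros; apply Hp; lra).
    assert (0 <= RInt f x b) by (apply RInt_ge_0; [lra|apply ex_RInt_ccont; auto; lra|];
      intros; apply Hp; lra).
    lra. }
  intros x Hx; apply (is_derive_on_unique a b (fun y => RInt f a y) x); auto.
  - apply is_derive_on_RInt; auto.
  - apply (is_derive_on_ext a b (fun _ => 0)); auto.
    + intros; symmetry; auto.
    + apply is_derive_on_const; auto.
Qed.

End Integrals.

(** * Bump functions *)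

(* The family is closed under differentiation, see [is_derive_flat]. *)
Definition flat (n : nat) (x : R) : R :=
  if Rlt_dec 0 x then (/ x) ^ n * exp (- / x) else 0.

(** With [z = y / (n + 1)] one has [z <= exp z] and [1 <= exp z], hence [z ^ n <= exp z ^ n <= exp z
    ^ (n + 1) = exp y]. Dividing by [n + 1] rather than [n] also covers [n = 0]. *)
Lemma pow_le_exp (n : nat) (y : R) : 0 <= y -> y ^ n <= INR (S n) ^ n * exp y.
Proof.
  intros Hy.
  assert (HN : 0 < INR (S n)) by (apply lt_0_INR; lia).
  assert (E : exp y = exp (y / INR (S n)) ^ S n).
  { assert (K : forall m z, exp (INR m * z) = exp z ^ m).
    { induction m as [|m IH]; intros z; [rewrite Rmult_0_l; apply exp_0|].
      rewrite S_INR, Rmult_plus_distr_r, exp_plus, IH, Rmult_1_l; simpl; ring. }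
    rewrite <- K; f_equal; field; lra. }
  assert (H0 : 0 <= y / INR (S n)) by (apply Rdiv_le_0_compat; auto).
  pose proof (exp_ineq1_le (y / INR (S n))) as H1.
  assert (H2 : (y / INR (S n)) ^ n <= exp (y / INR (S n)) ^ n) by (apply pow_incr; lra).
  assert (H3 : exp (y / INR (S n)) ^ n <= exp y).
  { rewrite E; apply Rle_pow; [lra|lia]. }
  replace (y ^ n) with (INR (S n) ^ n * (y / INR (S n)) ^ n).
  - apply Rmult_le_compat_l; [apply pow_le; lra|lra].
  - rewrite <- Rpow_mult_distr; f_equal; field; lra.
Qed.

Lemma flat_nonneg n x : 0 <= flat n x.
Proof.
  unfold flat; destruct (Rlt_dec 0 x) as [H|]; [|lra].
  apply Rmult_le_pos; [apply pow_le, Rlt_le, Rinv_0_lt_compat; auto|apply Rlt_le, exp_pos].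
Qed.

(** The quadratic bound is what forces the derivative at 0 to vanish. It is [pow_le_exp] at [/ x]
    with exponent [n + 2]. *)
Lemma flat_le_sqr n : exists C, 0 < C /\ forall x, flat n x <= C * x ^ 2.
Proof.
  exists (INR (S (n + 2)) ^ (n + 2)); split; [apply pow_lt, lt_0_INR; lia|].
  intros x; unfold flat; destruct (Rlt_dec 0 x) as [H|].
  - assert (0 < / x) by (apply Rinv_0_lt_compat; auto).
    pose proof (pow_le_exp (n + 2) (/ x)) as K.
    apply (Rmult_le_reg_r ((/ x) ^ 2 * exp (/ x))).
    + apply Rmult_lt_0_compat; [apply pow_lt; auto|apply exp_pos].
    + replace ((/ x) ^ n * exp (- / x) * ((/ x) ^ 2 * exp (/ x)))
        with ((/ x) ^ (n + 2) * (exp (- / x) * exp (/ x))) by (rewrite pow_add; ring).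
      rewrite <- exp_plus; replace (- / x + / x) with 0 by ring.
      rewrite exp_0, Rmult_1_r.
      replace (INR (S (n + 2)) ^ (n + 2) * x ^ 2 * ((/ x) ^ 2 * exp (/ x)))
        with (INR (S (n + 2)) ^ (n + 2) * exp (/ x)) by (field; lra).
      apply K; lra.
  - apply Rmult_le_pos; [apply pow_le, pos_INR|apply pow2_ge_0].
Qed.

(** For positive [x] this is the product rule for [x ^ (-n) exp (-1 / x)]; at 0 the difference
    quotient is at most [C |h|]. *)
Lemma is_derive_flat n x :
  is_derive (flat n) x (flat (S (S n)) x - INR n * flat (S n) x).
Proof.
  destruct (Rtotal_order x 0) as [H|[->|H]].
  - apply (is_derive_ext_loc (fun _ => 0)).
    + apply (locally_interval _ x m_infty 0); simpl; auto.
      intros y _ Hy; unfold flat; destruct (Rlt_dec 0 y); simpl in *; lra.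
    + unfold flat; destruct (Rlt_dec 0 x); [lra|].
      replace (0 - INR n * 0) with 0 by ring; apply (is_derive_const 0).
  - destruct (flat_le_sqr n) as (C & HC & K).
    assert (E : forall m, flat m 0 = 0) by (intros m; unfold flat; destruct (Rlt_dec 0 0); lra).
    rewrite !E; replace (0 - INR n * 0) with 0 by ring.
    apply is_derive_Reals; intros eps Heps.
    assert (Hd : 0 < eps / C) by (apply Rdiv_lt_0_compat; auto).
    exists (mkposreal _ Hd); intros h Hh Hhd; simpl in Hhd.
    rewrite Rplus_0_l, E, !Rminus_0_r.
    unfold Rdiv; rewrite Rabs_mult, (Rabs_pos_eq _ (flat_nonneg n h)), Rabs_inv.
    assert (0 < Rabs h) by (apply Rabs_pos_lt; auto).
    apply (Rmult_lt_reg_r (Rabs h)); auto.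
    rewrite Rmult_assoc, Rinv_l, Rmult_1_r by lra.
    apply Rle_lt_trans with (1 := K h).
    assert (E2 : h ^ 2 = Rabs h * Rabs h).
    { rewrite <- Rabs_mult, Rabs_pos_eq; [ring|nra]. }
    rewrite E2, <- Rmult_assoc; apply Rmult_lt_compat_r; auto.
    apply (Rmult_lt_reg_r (/ C)); [apply Rinv_0_lt_compat; auto|].
    replace (C * Rabs h * / C) with (Rabs h) by (field; lra); auto.
  - apply (is_derive_ext_loc (fun y => (/ y) ^ n * exp (- / y))).
    + apply (locally_interval _ x 0 p_infty); simpl; auto.
      intros y Hy _; unfold flat; destruct (Rlt_dec 0 y); simpl in *; lra.
    + unfold flat; destruct (Rlt_dec 0 x); [|lra].
      auto_derive; [lra|].
      destruct n as [|n]; [simpl; field; lra|].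
      replace (Nat.pred (S n)) with n by reflexivity.
      rewrite <- !tech_pow_Rmult; field; lra.
Qed.

(** The product of [flat 0] at the distances to [c] and to [d]. All orders [n] serve as generators,
    because differentiation raises the order. *)
Lemma bump_exists a b c d : a < b -> exists phi, smooth_on a b phi /\
  (forall x, 0 <= phi x) /\ (forall x, c < x < d -> 0 < phi x) /\
  (forall x, x <= c \/ d <= x -> phi x = 0).
Proof.
  intros Hab; exists (fun x => flat 0 (x - c) * flat 0 (d - x)); split; [|split; [|split]].
  - apply (generated_smooth_on a b (fun f => exists n,
      f = (fun x => flat n (x - c)) \/ f = (fun x => flat n (d - x)))); auto.
    + assert (D1 : forall u x, a <= x <= b -> is_derive_on a b (fun x => x - u) x 1).
      { intros; eapply is_derive_on_eq; [apply is_derive_on_minus;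
          eauto using is_derive_on_id, is_derive_on_const|ring]. }
      assert (D2 : forall u x, a <= x <= b -> is_derive_on a b (fun x => u - x) x (-1)).
      { intros; eapply is_derive_on_eq; [apply is_derive_on_minus;
          eauto using is_derive_on_id, is_derive_on_const|ring]. }
      intros f (n & [-> | ->]).
      * exists (fun x => (flat (S (S n)) (x - c) + (- INR n) * flat (S n) (x - c)) * 1); split.
        -- repeat (apply gen_plus || apply gen_mult || apply gen_const);
             apply gen_base; eauto.
        -- intros x Hx; apply (is_derive_on_comp a b (flat n)); auto.
           replace (_ + _) with (flat (S (S n)) (x - c) - INR n * flat (S n) (x - c)) by ring.
           apply is_derive_flat.
      * exists (fun x => (flat (S (S n)) (d - x) + (- INR n) * flat (S n) (d - x)) * -1); split.
        -- repeat (apply gen_plus || apply gen_mult || apply gen_const);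
             apply gen_base; eauto.
        -- intros x Hx; apply (is_derive_on_comp a b (flat n)); auto.
           replace (_ + _) with (flat (S (S n)) (d - x) - INR n * flat (S n) (d - x)) by ring.
           apply is_derive_flat.
    + apply gen_mult; apply gen_base; eauto.
  - intros; apply Rmult_le_pos; apply flat_nonneg.
  - intros x Hx; unfold flat; destruct (Rlt_dec 0 (x - c)), (Rlt_dec 0 (d - x)); try lra.
    simpl; rewrite !Rmult_1_l; apply Rmult_lt_0_compat; apply exp_pos.
  - intros x [Hx|Hx]; unfold flat; destruct (Rlt_dec 0 (x - c)), (Rlt_dec 0 (d - x)); lra.
Qed.

(** * Families of functions depending on a parameter *)

(* Joint continuity on (-eps, eps) x [a, b]. *)
Definition Ct (a b eps : R) (F : R -> R -> R) : Prop :=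
  forall t x, Rabs t < eps ->
    continuous (fun p : R * R => F (fst p) (clamp a b (snd p))) (t, x).

(** Regularity in the parameter only, with the derivative in [t] as an explicit datum, so that its
    value at [t = 0] can be read off from the formula. *)
Definition C1t (a b eps : R) (F dF : R -> R -> R) : Prop :=
  Ct a b eps F /\ Ct a b eps dF /\
  forall t x, Rabs t < eps -> a <= x <= b -> is_derive (fun s => F s x) t (dF t x).

Definition C1t3 (a b eps : R) (F dF : R -> R -> R3) : Prop :=
  C1t a b eps (fun t => comp1 (F t)) (fun t => comp1 (dF t)) /\
  C1t a b eps (fun t => comp2 (F t)) (fun t => comp2 (dF t)) /\
  C1t a b eps (fun t => comp3 (F t)) (fun t => comp3 (dF t)).

Lemma locally_Rabs_lt eps t : Rabs t < eps -> locally t (fun s => Rabs s < eps).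
Proof.
  intros H; apply Rabs_def2 in H.
  apply (locally_interval _ t (- eps) eps); simpl; try lra.
  intros y H1 H2; simpl in *; apply Rabs_def1; lra.
Qed.

Section Families.
Context (a b : R) (hab : a < b) (eps : R).

Lemma Ct_ext F G : (forall t x, Rabs t < eps -> a <= x <= b -> F t x = G t x) ->
  Ct a b eps F -> Ct a b eps G.
Proof.
  intros E H t x Ht.
  apply (continuous_ext_loc _ (fun p : R * R => F (fst p) (clamp a b (snd p)))); auto.
  destruct (locally_Rabs_lt eps t Ht) as [d Hd]; exists d.
  intros [s y] [Hs _]; simpl in *; apply E; [apply Hd, Hs|apply clamp_in; lra].
Qed.

Lemma Ct_plus F G : Ct a b eps F -> Ct a b eps G -> Ct a b eps (fun t x => F t x + G t x).
Proof.
  intros HF HG t x Ht.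
  apply (continuous_plus (fun p : R * R => F (fst p) (clamp a b (snd p)))); auto.
Qed.

Lemma Ct_mult F G : Ct a b eps F -> Ct a b eps G -> Ct a b eps (fun t x => F t x * G t x).
Proof.
  intros HF HG t x Ht.
  apply (continuous_mult (fun p : R * R => F (fst p) (clamp a b (snd p)))); auto.
Qed.

Lemma Ct_comp h F : (forall t x, Rabs t < eps -> a <= x <= b -> continuous h (F t x)) ->
  Ct a b eps F -> Ct a b eps (fun t x => h (F t x)).
Proof.
  intros Hh HF t x Ht.
  apply (continuous_comp (fun p : R * R => F (fst p) (clamp a b (snd p))) h); auto.
  apply Hh; simpl; auto; apply clamp_in; lra.
Qed.

Lemma Ct_static f : ccont a b f -> Ct a b eps (fun _ x => f x).
Proof.
  intros Hf t x Ht.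
  apply (continuous_comp (fun p : R * R => snd p) (fun y => f (clamp a b y)));
    [apply continuous_snd|apply Hf].
Qed.

Lemma Ct_const c : Ct a b eps (fun _ _ => c).
Proof. apply (Ct_static (fun _ => c)), ccont_const. Qed.

Lemma Ct_slice F t : Rabs t < eps -> Ct a b eps F -> ccont a b (F t).
Proof.
  intros Ht H x.
  apply (continuous_comp (fun y => (t, y)) (fun p : R * R => F (fst p) (clamp a b (snd p)))).
  - apply (continuous_comp_2 (fun _ => t) (fun y => y) (fun u v => (u, v)));
      [apply continuous_const|apply continuous_id|].
    apply (continuous_ext (fun p => p)); [intros []; auto|apply continuous_id].
  - now apply H.
Qed.

Lemma C1t_ext F G dF dG :
  (forall t x, Rabs t < eps -> a <= x <= b -> F t x = G t x) ->
  (forall t x, Rabs t < eps -> a <= x <= b -> dF t x = dG t x) ->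
  C1t a b eps F dF -> C1t a b eps G dG.
Proof.
  intros E1 E2 (H1 & H2 & H3); split; [|split].
  - now apply (Ct_ext F).
  - now apply (Ct_ext dF).
  - intros t x Ht Hx; rewrite <- E2 by auto.
    apply (is_derive_ext_loc (fun s => F s x)); auto.
    generalize (locally_Rabs_lt eps t Ht); apply filter_imp; auto.
Qed.

Lemma C1t_static f : ccont a b f -> C1t a b eps (fun _ x => f x) (fun _ _ => 0).
Proof.
  intros Hf; split; [now apply Ct_static|split; [apply Ct_const|]].
  intros t x _ _; apply (is_derive_const (f x)).
Qed.

Lemma C1t_plus F G dF dG : C1t a b eps F dF -> C1t a b eps G dG ->
  C1t a b eps (fun t x => F t x + G t x) (fun t x => dF t x + dG t x).
Proof.
  intros (F1 & F2 & F3) (G1 & G2 & G3); split; [|split]; try now apply Ct_plus.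
  intros t x Ht Hx; apply (is_derive_plus (fun s => F s x) (fun s => G s x)); auto.
Qed.

Lemma C1t_mult F G dF dG : C1t a b eps F dF -> C1t a b eps G dG ->
  C1t a b eps (fun t x => F t x * G t x) (fun t x => dF t x * G t x + F t x * dG t x).
Proof.
  intros (F1 & F2 & F3) (G1 & G2 & G3); split; [|split].
  - now apply Ct_mult.
  - now apply Ct_plus; apply Ct_mult.
  - intros t x Ht Hx.
    apply (is_derive_mult (fun s => F s x) (fun s => G s x)); auto.
    intros; apply Rmult_comm.
Qed.

Lemma C1t_minus F G dF dG : C1t a b eps F dF -> C1t a b eps G dG ->
  C1t a b eps (fun t x => F t x - G t x) (fun t x => dF t x - dG t x).
Proof.
  intros HF HG.
  apply (C1t_ext (fun t x => F t x + -1 * G t x) _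
    (fun t x => dF t x + (0 * G t x + -1 * dG t x))); try (intros; ring).
  apply C1t_plus; auto; apply (C1t_mult (fun _ _ => -1)); auto.
  apply (C1t_static (fun _ => -1)), ccont_const.
Qed.

Lemma C1t_comp h dh F dF :
  (forall t x, Rabs t < eps -> a <= x <= b ->
     is_derive h (F t x) (dh (F t x)) /\ continuous dh (F t x)) ->
  C1t a b eps F dF ->
  C1t a b eps (fun t x => h (F t x)) (fun t x => dh (F t x) * dF t x).
Proof.
  intros Hh (F1 & F2 & F3); split; [|split].
  - apply Ct_comp; auto; intros t x Ht Hx.
    apply (ex_derive_continuous h); eexists; now apply Hh.
  - apply Ct_mult; auto; apply Ct_comp; auto; intros; now apply Hh.
  - intros t x Ht Hx; rewrite Rmult_comm.
    apply (is_derive_comp h (fun s => F s x)); auto; now apply Hh.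
Qed.

Lemma C1t_inv F dF : (forall t x, Rabs t < eps -> a <= x <= b -> F t x <> 0) ->
  C1t a b eps F dF -> C1t a b eps (fun t x => / F t x) (fun t x => - / (F t x) ^ 2 * dF t x).
Proof.
  intros N; apply (C1t_comp Rinv (fun y => - / y ^ 2)); intros t x Ht Hx.
  specialize (N t x Ht Hx); split.
  - auto_derive; auto; field; auto.
  - apply (ex_derive_continuous (fun y => - / y ^ 2)); auto_derive; simpl.
    apply Rmult_integral_contrapositive_currified; auto; lra.
Qed.

Lemma C1t_sqrt F dF : (forall t x, Rabs t < eps -> a <= x <= b -> 0 < F t x) ->
  C1t a b eps F dF ->
  C1t a b eps (fun t x => sqrt (F t x)) (fun t x => / (2 * sqrt (F t x)) * dF t x).
Proof.
  intros N; apply (C1t_comp sqrt (fun y => / (2 * sqrt y))); intros t x Ht Hx.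
  specialize (N t x Ht Hx); assert (0 < sqrt (F t x)) by now apply sqrt_lt_R0.
  split.
  - auto_derive; auto; field; lra.
  - apply (ex_derive_continuous (fun y => / (2 * sqrt y))); auto_derive; split; auto; lra.
Qed.

Lemma C1t3_static f : smooth_on3 a b f -> C1t3 a b eps (fun _ => f) (fun _ _ => (0)%R3).
Proof.
  intros (H1 & H2 & H3); split; [|split].
  - now apply (C1t_static (comp1 f)), smooth_on_ccont.
  - now apply (C1t_static (comp2 f)), smooth_on_ccont.
  - now apply (C1t_static (comp3 f)), smooth_on_ccont.
Qed.

Lemma C1t3_dot F G dF dG : C1t3 a b eps F dF -> C1t3 a b eps G dG ->
  C1t a b eps (fun t x => dot (F t x) (G t x))
    (fun t x => dot (dF t x) (G t x) + dot (F t x) (dG t x)).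
Proof.
  intros (F1 & F2 & F3) (G1 & G2 & G3).
  eapply C1t_ext; [| |apply (C1t_plus _ _ _ _ (C1t_plus _ _ _ _ (C1t_mult _ _ _ _ F1 G1)
    (C1t_mult _ _ _ _ F2 G2)) (C1t_mult _ _ _ _ F3 G3))];
    intros; simpl; rewrite !dotE; unfold comp1, comp2, comp3; ring.
Qed.

Lemma C1t3_cross F G dF dG : C1t3 a b eps F dF -> C1t3 a b eps G dG ->
  C1t3 a b eps (fun t x => F t x >< G t x)%R3
    (fun t x => dF t x >< G t x + F t x >< dG t x)%R3.
Proof.
  intros (F1 & F2 & F3) (G1 & G2 & G3); split; [|split].
  - eapply C1t_ext; [| |apply (C1t_minus _ _ _ _ (C1t_mult _ _ _ _ F2 G3)
      (C1t_mult _ _ _ _ F3 G2))];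
    intros; unfold comp1, comp2, comp3; autorewrite with vec; ring.
  - eapply C1t_ext; [| |apply (C1t_minus _ _ _ _ (C1t_mult _ _ _ _ F3 G1)
      (C1t_mult _ _ _ _ F1 G3))];
    intros; unfold comp1, comp2, comp3; autorewrite with vec; ring.
  - eapply C1t_ext; [| |apply (C1t_minus _ _ _ _ (C1t_mult _ _ _ _ F1 G2)
      (C1t_mult _ _ _ _ F2 G1))];
    intros; unfold comp1, comp2, comp3; autorewrite with vec; ring.
Qed.

Lemma is_derive_RInt_C1t F dF x : 0 < eps -> C1t a b eps F dF -> a <= x <= b ->
  is_derive (fun t => RInt (F t) a x) 0 (RInt (dF 0) a x).
Proof.
  intros He (H1 & H2 & H3) Hx.
  assert (H0 : Rabs 0 < eps) by (rewrite Rabs_R0; auto).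
  assert (Hl := locally_Rabs_lt eps 0 H0).
  apply (is_derive_ext (fun t => RInt (fun y => F t (clamp a b y)) a x)).
  { intros t; symmetry; apply RInt_clamp; auto; lra. }
  rewrite (RInt_ext _ (fun y => Derive (fun u => F u (clamp a b y)) 0)).
  2: { rewrite Rmin_left, Rmax_right by lra; intros y Hy; symmetry.
       rewrite clamp_id by lra; apply is_derive_unique, H3; auto; lra. }
  apply (is_derive_RInt_param (fun t y => F t (clamp a b y)) a x 0).
  - revert Hl; apply filter_imp; intros t Ht y _; eexists; apply H3; auto.
    apply clamp_in; lra.
  - intros y _.
    apply (continuity_2d_pt_ext_loc (fun u v => dF u (clamp a b v))).
    + destruct Hl as [d Hd]; exists d; intros u v Hu _; symmetry.
      apply is_derive_unique, H3; [apply Hd, Hu|apply clamp_in; lra].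
    + apply continuity_2d_pt_filterlim; apply (H2 0 y); auto.
  - revert Hl; apply filter_imp; intros t Ht.
    apply (ex_RInt_continuous (V := R_CompleteNormedModule)); intros z _.
    now apply (Ct_slice F t).
Qed.

(* Exchanging the two derivatives: differentiate [F t x = F t a + int P t]
   in [t] under the integral sign, then in [x]. *)
Lemma is_derive_on_swap F P dP w : 0 < eps ->
  (forall t x, Rabs t < eps -> a <= x <= b -> is_derive_on a b (F t) x (P t x)) ->
  C1t a b eps P dP ->
  (forall x, a <= x <= b -> is_derive (fun t => F t x) 0 (w x)) ->
  forall x, a <= x <= b -> is_derive_on a b w x (dP 0 x).
Proof.
  intros He HF HP Hw x Hx.
  assert (H0 : Rabs 0 < eps) by (rewrite Rabs_R0; auto).
  assert (E : forall y, a <= y <= b -> w a + RInt (dP 0) a y = w y).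
  { intros y Hy; rewrite <- (is_derive_unique _ _ _ (Hw y Hy)); symmetry.
    apply is_derive_unique.
    apply (is_derive_ext_loc (fun t => F t a + RInt (P t) a y)).
    - generalize (locally_Rabs_lt eps 0 H0); apply filter_imp; intros t Ht.
      rewrite (RInt_derive_on a b hab (F t)); auto; [change (@eq R (F t a + (F t y - F t a)) (F t y)); ring|].
      apply Ct_slice; auto; apply HP.
    - apply (is_derive_plus (fun t => F t a)); [apply Hw; lra|].
      apply is_derive_RInt_C1t; auto. }
  apply (is_derive_on_ext a b (fun y => w a + RInt (dP 0) a y)); auto.
  eapply is_derive_on_eq; [apply is_derive_on_plus; auto;
    [apply is_derive_on_const; auto|apply is_derive_on_RInt; auto]|ring].
  apply Ct_slice; auto; apply HP.
Qed.

(** Clamping sends a full neighbourhood of [(t, x)] into the rectangle, once the neighbourhood of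
    [t] is small enough to stay in (-eps, eps). *)
Lemma continuous_on_Ct F :
  continuous_on (fun p : R * R => - eps <= fst p <= eps /\ a <= snd p <= b)
    (fun p : R * R => F (fst p) (snd p)) -> Ct a b eps F.
Proof.
  intros H t x Ht.
  assert (Hc : a <= clamp a b x <= b) by (apply clamp_in; lra).
  pose proof (Rabs_def2 _ _ Ht).
  intros Q HQ; specialize (H (t, clamp a b x)); simpl in H.
  specialize (H ltac:(split; lra) Q HQ); destruct H as [d Hd].
  assert (Hcl : locally x (fun y => ball (clamp a b x) d (clamp a b y))).
  { apply (clamp_continuous a b x (ball (clamp a b x) d)); exists d; auto. }
  destruct Hcl as [d1 Hd1]; destruct (locally_Rabs_lt eps t Ht) as [d2 Hd2].
  pose proof (cond_pos d); pose proof (cond_pos d1); pose proof (cond_pos d2).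
  assert (Hm : 0 < Rmin d (Rmin d1 d2)) by (repeat apply Rmin_glb_lt; auto).
  exists (mkposreal _ Hm); intros [s y] [Hs Hy]; simpl in *.
  apply (Hd (s, clamp a b y)).
  - split; simpl; [eapply ball_le; [|exact Hs]; apply Rmin_l|].
    apply Hd1; eapply ball_le; [|exact Hy]; simpl.
    eapply Rle_trans; [apply Rmin_r|apply Rmin_l].
  - simpl; split; [|apply clamp_in; lra].
    assert (K : Rabs s < eps).
    { apply Hd2; eapply ball_le; [|exact Hs]; simpl.
      eapply Rle_trans; [apply Rmin_r|apply Rmin_r]. }
    apply Rabs_def2 in K; lra.
Qed.

Lemma Ck_rect_C1t k F : Ck_rect (S k) (- eps) eps a b F ->
  C1t a b eps F (fun t x => Derive_on (- eps) eps (fun s => F s x) t).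
Proof.
  intros (H1 & H2 & H3 & _); split; [|split].
  - now apply continuous_on_Ct.
  - apply continuous_on_Ct; destruct k; apply H3.
  - intros t x Ht Hx; apply Rabs_def2 in Ht.
    apply (is_derive_on_interior (- eps) eps); [lra|].
    apply Derive_on_correct; try lra; apply H2; lra.
Qed.

End Families.

Lemma C1t_shrink a b eps eps' F dF : eps' <= eps -> C1t a b eps F dF -> C1t a b eps' F dF.
Proof.
  intros H (H1 & H2 & H3); split; [|split].
  - intros t x Ht; apply H1; lra.
  - intros t x Ht; apply H2; lra.
  - intros t x Ht; apply H3; lra.
Qed.

(** The minimum of [F 0] on [a, b] is positive and serves as the tolerance in uniform continuity at
    [t = 0]. Applied later to [1 - <N, T_t>^2], it keeps [N] nowhere tangent to the nearby
    curves. *)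
Lemma Ct_gt0_near a b eps F : a < b -> 0 < eps -> Ct a b eps F ->
  (forall x, a <= x <= b -> 0 < F 0 x) ->
  exists delta, 0 < delta /\ delta <= eps /\
    forall t x, Rabs t < delta -> a <= x <= b -> 0 < F t x.
Proof.
  intros Hab He HF Hpos.
  assert (H0 : Rabs 0 < eps) by (rewrite Rabs_R0; auto).
  destruct (continuity_ab_min (fun x => F 0 (clamp a b x)) a b) as (m & Hm1 & Hm2).
  { lra. }
  { intros c _; apply continuity_pt_filterlim; now apply (Ct_slice a b eps F 0). }
  rewrite (clamp_id a b m) in Hm1 by auto.
  destruct (uniform_continuity_2d_1d (fun x t => F t (clamp a b x)) a b 0) with
    (eps := mkposreal _ (Hpos m Hm2)) as [d Hd].
  { intros x _; apply continuity_2d_pt_filterlim; intros Q HQ.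
    destruct (HF 0 x H0 Q HQ) as [d Hd]; exists d; intros [y t] [Hy Ht]; simpl in *.
    apply (Hd (t, y)); split; auto. }
  pose proof (cond_pos d).
  exists (Rmin d eps); split; [apply Rmin_glb_lt; auto|split; [apply Rmin_r|]].
  intros t x Ht Hx.
  assert (Ht' : Rabs t < d) by (eapply Rlt_le_trans; [exact Ht|apply Rmin_l]).
  apply Rabs_def2 in Ht'.
  specialize (Hd x 0 x t Hx ltac:(lra) Hx ltac:(lra)); simpl in Hd.
  rewrite Rminus_diag, Rabs_R0 in Hd; specialize (Hd (cond_pos d)).
  specialize (Hm1 x Hx); rewrite clamp_id in Hd, Hm1 by auto.
  apply Rabs_def2 in Hd; lra.
Qed.

(** * Parallel normal fields *)

(* [parallel_normal_field a b gamma] unfolds to [parallel_along a b (tangent a b gamma)]. *)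
Definition parallel_along (a b : R) (T Z : R -> R3) : Prop :=
  smooth_on3 a b Z /\
  (forall x, a <= x <= b -> dot (Z x) (T x) = 0) /\
  exists lambda : R -> R, smooth_on a b lambda /\
    forall x, a <= x <= b -> Derive_on3 a b Z x = (lambda x *: T x)%R3.

Lemma smooth_on_subset a b c d f : a <= c -> c < d -> d <= b ->
  smooth_on a b f -> smooth_on c d f.
Proof.
  intros H1 H2 H3; revert f; apply smooth_on_coind; auto.
  intros f Hf; exists (Derive_on a b f); split; [now apply smooth_on_derive|].
  intros x Hx; apply (is_derive_on_subset a b); auto.
  apply smooth_on_is_derive_on; auto; lra.
Qed.

Lemma smooth_on3_subset a b c d f : a <= c -> c < d -> d <= b ->
  smooth_on3 a b f -> smooth_on3 c d f.
Proof.
  intros H1 H2 H3 (F1 & F2 & F3); split; [|split]; apply (smooth_on_subset a b); auto.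
Qed.

Lemma is_derive_on3_subset a b c d f x l : c <= x <= d -> a <= c -> d <= b ->
  is_derive_on3 a b f x l -> is_derive_on3 c d f x l.
Proof.
  intros Hx H1 H2 (F1 & F2 & F3); split; [|split]; apply (is_derive_on_subset a b); auto.
Qed.

(** At [c] the two-sided extensions of both pieces share the value and the derivative, and each
    difference quotient of the glued function is one of theirs. *)
Lemma is_derive_on_glue a c d f g x l : a <= c <= d -> a <= x <= d -> f c = g c ->
  (x <= c -> is_derive_on a c f x l) -> (c <= x -> is_derive_on c d g x l) ->
  is_derive_on a d (fun y => if Rle_dec y c then f y else g y) x l.
Proof.
  intros Hc Hx E Hf Hg; destruct (Rtotal_order x c) as [L|[->|L]].
  - specialize (Hf ltac:(lra)); apply is_derive_on_extend in Hf; [|lra].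
    destruct Hf as (h & Hh & Eh).
    apply (is_derive_on_ext_loc a d h); auto; [|apply is_derive_on_is_derive; auto].
    apply (locally_interval _ x m_infty c); simpl; auto.
    intros y _ Hy Hyd; simpl in *; destruct (Rle_dec y c); [apply Eh; lra|lra].
  - specialize (Hf ltac:(lra)); specialize (Hg ltac:(lra)).
    apply is_derive_on_extend in Hf; [|lra]; apply is_derive_on_extend in Hg; [|lra].
    destruct Hf as (h & Hh & Eh), Hg as (k & Hk & Ek).
    apply is_derive_on_extend; auto.
    exists (fun y => if Rle_dec y c then h y else k y); split.
    + apply is_derive_Reals in Hh; apply is_derive_Reals in Hk; apply is_derive_Reals.
      assert (Ehk : h c = k c) by (rewrite Eh, Ek by lra; auto).
      intros eps Heps; destruct (Hh eps Heps) as [d1 D1], (Hk eps Heps) as [d2 D2].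
      assert (Hm : 0 < Rmin d1 d2) by (apply Rmin_glb_lt; apply cond_pos).
      exists (mkposreal _ Hm); intros z Hz Hzd; simpl in Hzd.
      pose proof (Rmin_l d1 d2); pose proof (Rmin_r d1 d2).
      destruct (Rle_dec c c); [|lra]; destruct (Rle_dec (c + z) c).
      * apply D1; auto; lra.
      * rewrite Ehk; apply D2; auto; lra.
    + intros y Hy; destruct (Rle_dec y c); [apply Eh; lra|apply Ek; lra].
  - specialize (Hg ltac:(lra)); apply is_derive_on_extend in Hg; [|lra].
    destruct Hg as (h & Hh & Eh).
    apply (is_derive_on_ext_loc a d h); auto; [|apply is_derive_on_is_derive; auto].
    apply (locally_interval _ x c p_infty); simpl; auto.
    intros y Hy _ Hyd; simpl in *; destruct (Rle_dec y c); [lra|apply Eh; lra].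
Qed.

Lemma is_derive_on3_glue a c d f g x l : a <= c <= d -> a <= x <= d -> f c = g c ->
  (x <= c -> is_derive_on3 a c f x l) -> (c <= x -> is_derive_on3 c d g x l) ->
  is_derive_on3 a d (fun y => if Rle_dec y c then f y else g y) x l.
Proof.
  intros Hc Hx E Hf Hg.
  split; [|split].
  - apply (is_derive_on_ext a d (fun y => if Rle_dec y c then comp1 f y else comp1 g y)); auto.
    + intros y _; unfold comp1; destruct (Rle_dec y c); auto.
    + apply is_derive_on_glue; auto; [unfold comp1; now rewrite E|apply Hf|apply Hg].
  - apply (is_derive_on_ext a d (fun y => if Rle_dec y c then comp2 f y else comp2 g y)); auto.
    + intros y _; unfold comp2; destruct (Rle_dec y c); auto.
    + apply is_derive_on_glue; auto; [unfold comp2; now rewrite E|apply Hf|apply Hg].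
  - apply (is_derive_on_ext a d (fun y => if Rle_dec y c then comp3 f y else comp3 g y)); auto.
    + intros y _; unfold comp3; destruct (Rle_dec y c); auto.
    + apply is_derive_on_glue; auto; [unfold comp3; now rewrite E|apply Hf|apply Hg].
Qed.

Lemma frame_decomposition (T n X : R3) : dot T T = 1 -> dot n n = 1 -> dot n T = 0 ->
  X = (dot X T *: T + dot X n *: n + dot X (T >< n) *: (T >< n))%R3.
Proof.
  intros H1 H2 H3.
  assert (D : dot (T >< n)%R3 (T >< n)%R3 = 1).
  { transitivity (dot T T * dot n n - dot n T * dot n T); [vec|rewrite H1, H2, H3; ring]. }
  (* The expansion of [|T x n|^2 X] in [T], [n] and [T x n] is an identity for arbitrary vectors;
     orthonormality only simplifies its coefficients. *)
  transitivity (dot (T >< n)%R3 (T >< n)%R3 *: X)%R3; [rewrite D; vec|].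
  transitivity (dot X T *: (dot n n *: T - dot n T *: n) +
    dot X n *: (dot T T *: n - dot n T *: T) + dot X (T >< n)%R3 *: (T >< n))%R3; [vec|].
  rewrite H1, H2, H3; vec.
Qed.

(** * Parallel transport as a linear differential equation *)

Section Parallel.
Context (a b : R) (hab : a < b) (T : R -> R3).
Context (hT : smooth_on3 a b T) (hT1 : forall x, a <= x <= b -> dot (T x) (T x) = 1).

Let dT := Derive_on3 a b T.

Lemma is_derive_on3_T x : a <= x <= b -> is_derive_on3 a b T x (dT x).
Proof. intros; now apply smooth_on3_is_derive_on3. Qed.

Lemma dot_const_derive f g df dg c x : a <= x <= b ->
  is_derive_on3 a b f x df -> is_derive_on3 a b g x dg ->
  (forall y, a <= y <= b -> dot (f y) (g y) = c) -> dot df (g x) + dot (f x) dg = 0.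
Proof.
  intros Hx Hf Hg E; apply (is_derive_on_unique a b (fun y => dot (f y) (g y)) x); auto.
  - now apply is_derive_on3_dot.
  - apply (is_derive_on_ext a b (fun _ => c)); auto; [intros; symmetry; auto|].
    now apply is_derive_on_const.
Qed.

Lemma dot_T_dT x : a <= x <= b -> dot (T x) (dT x) = 0.
Proof.
  intros Hx; pose proof (dot_const_derive T T (dT x) (dT x) 1 x Hx) as K.
  rewrite (dot_comm (dT x)) in K.
  cut (dot (T x) (dT x) + dot (T x) (dT x) = 0); [lra|].
  apply K; auto; now apply is_derive_on3_T.
Qed.

(** Differentiating [<Z, T> = 0] determines the factor [lambda = - <Z, T'>]. *)
Lemma parallel_along_ode Z : parallel_along a b T Z -> forall x, a <= x <= b ->
  is_derive_on3 a b Z x ((- dot (Z x) (dT x)) *: T x)%R3.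
Proof.
  intros (HZ & HN & lam & _ & HL) x Hx.
  pose proof (smooth_on3_is_derive_on3 a b hab Z x HZ Hx) as D; rewrite HL in D by auto.
  eapply is_derive_on3_eq; [exact D|]; f_equal.
  pose proof (dot_const_derive Z T _ _ 0 x Hx D (is_derive_on3_T x Hx) HN) as K.
  replace (dot (lam x *: T x)%R3 (T x)) with (lam x * dot (T x) (T x)) in K by vec.
  rewrite hT1 in K by auto; lra.
Qed.

(** The equation makes [<Z, T>] constant. Smoothness is a bootstrap: [Z'] is polynomial in [Z] and
    smooth functions, so adding the components of [Z] to the generators gives a set closed under
    differentiation. This is what makes glued fields smooth at the junction. *)
Lemma ode_parallel_along Z : dot (Z a) (T a) = 0 ->
  (forall x, a <= x <= b -> is_derive_on3 a b Z x ((- dot (Z x) (dT x)) *: T x)%R3) ->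
  parallel_along a b T Z.
Proof.
  intros Ha HZ.
  assert (HdT : smooth_on3 a b dT) by now apply smooth_on3_derive.
  assert (HZs : smooth_on3 a b Z).
  { set (gen := fun f => smooth_on a b f \/ f = comp1 Z \/ f = comp2 Z \/ f = comp3 Z).
    assert (G0 : generated a b gen (fun x => - dot (Z x) (dT x))).
    { apply (gen_ext a b _ (fun x => -1 * (comp1 Z x * comp1 dT x +
        comp2 Z x * comp2 dT x + comp3 Z x * comp3 dT x))).
      - destruct HdT as (D1 & D2 & D3).
        apply gen_mult; [apply gen_const|].
        repeat apply gen_plus; apply gen_mult; apply gen_base; unfold gen; auto.
      - intros x _; rewrite dotE; unfold comp1, comp2, comp3; ring. }
    destruct hT as (T1 & T2 & T3).
    assert (G : forall f, gen f -> exists df, generated a b gen df /\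
      forall x, a <= x <= b -> is_derive_on a b f x (df x)).
    { intros f [Hf|[-> |[-> | ->]]].
      - exists (Derive_on a b f); split; [apply gen_base; left; now apply smooth_on_derive|].
        intros; now apply smooth_on_is_derive_on.
      - exists (fun x => - dot (Z x) (dT x) * comp1 T x); split; [|apply HZ].
        apply gen_mult; auto; apply gen_base; left; auto.
      - exists (fun x => - dot (Z x) (dT x) * comp2 T x); split; [|apply HZ].
        apply gen_mult; auto; apply gen_base; left; auto.
      - exists (fun x => - dot (Z x) (dT x) * comp3 T x); split; [|apply HZ].
        apply gen_mult; auto; apply gen_base; left; auto. }
    split; [|split]; apply (generated_smooth_on a b gen); auto; apply gen_base;
      unfold gen; auto. }
  split; [auto|split].
  - intros x Hx; rewrite <- Ha.
    apply (is_derive_on_zero_const a b hab (fun y => dot (Z y) (T y))); auto.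
    intros y Hy; eapply is_derive_on_eq;
      [apply is_derive_on3_dot; [auto|apply HZ; auto|apply is_derive_on3_T; auto]|].
    replace (dot (- dot (Z y) (dT y) *: T y)%R3 (T y))
      with (- dot (Z y) (dT y) * dot (T y) (T y)) by vec.
    rewrite hT1 by auto; ring.
  - exists (fun x => - dot (Z x) (dT x)); split.
    + apply smooth_on_opp; auto; now apply smooth_on3_dot.
    + intros x Hx; apply Derive_on3_eq; auto.
Qed.

Lemma parallel_along_dot Z Y : parallel_along a b T Z -> parallel_along a b T Y ->
  forall x, a <= x <= b -> dot (Z x) (Y x) = dot (Z a) (Y a).
Proof.
  intros HZ HY; apply (is_derive_on_zero_const a b hab (fun y => dot (Z y) (Y y))).
  intros x Hx; eapply is_derive_on_eq;
    [apply is_derive_on3_dot; [auto|apply parallel_along_ode; auto|apply parallel_along_ode; auto]|].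
  transitivity (- dot (Z x) (dT x) * dot (Y x) (T x) - dot (Y x) (dT x) * dot (Z x) (T x));
    [vec|].
  destruct HZ as (_ & NZ & _), HY as (_ & NY & _); rewrite NZ, NY by auto; ring.
Qed.

(** Parallel transport is isometric: [|Z - Y|^2] expands into three constant products, so it keeps
    its initial value 0. *)
Lemma parallel_along_unique Z Y : parallel_along a b T Z -> parallel_along a b T Y ->
  Z a = Y a -> forall x, a <= x <= b -> Z x = Y x.
Proof.
  intros HZ HY E x Hx.
  assert (K : dot (Z x - Y x)%R3 (Z x - Y x)%R3 = 0).
  { transitivity (dot (Z x) (Z x) - 2 * dot (Z x) (Y x) + dot (Y x) (Y x)); [vec|].
    rewrite (parallel_along_dot Z Z), (parallel_along_dot Z Y), (parallel_along_dot Y Y); auto.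
    rewrite E; ring. }
  apply dot_self_eq0 in K.
  transitivity ((Z x - Y x) + Y x)%R3; [vec|rewrite K; vec].
Qed.

(** With [w = <n', T x n>], the connection form of the frame [n], [T x n], the normal part of the
    derivative of the rotated vector is [(phi' + w) (- sin phi n + cos phi T x n)]. It vanishes for
    [phi' = - w]. *)
Lemma rotated_frame_parallel n phi : smooth_on3 a b n ->
  (forall x, a <= x <= b -> dot (n x) (n x) = 1) ->
  (forall x, a <= x <= b -> dot (n x) (T x) = 0) ->
  (forall x, a <= x <= b ->
     is_derive_on a b phi x (- dot (Derive_on3 a b n x) (T x >< n x)%R3)) ->
  parallel_along a b T (fun x => cos (phi x) *: n x + sin (phi x) *: (T x >< n x))%R3.
Proof.
  intros Hn Hn1 HnT Hphi.
  set (dn := Derive_on3 a b n) in *.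
  assert (Dn : forall x, a <= x <= b -> is_derive_on3 a b n x (dn x))
    by (intros; now apply smooth_on3_is_derive_on3).
  set (w := fun x => dot (dn x) (T x >< n x)%R3).
  assert (Sphi : smooth_on a b phi).
  { apply (smooth_on_of_derive a b _ (fun x => - w x)); auto.
    apply smooth_on_opp; auto; apply smooth_on3_dot; auto;
      [now apply smooth_on3_derive|now apply smooth_on3_cross]. }
  set (Z := fun x => (cos (phi x) *: n x + sin (phi x) *: (T x >< n x))%R3).
  assert (SZ : smooth_on3 a b Z).
  { apply smooth_on3_plus; auto; apply smooth_on3_scal; auto.
    - now apply smooth_on_cos.
    - now apply smooth_on_sin.
    - now apply smooth_on3_cross. }
  split; [exact SZ|split].
  - intros x Hx; transitivity (cos (phi x) * dot (n x) (T x)); [unfold Z; vec|].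
    rewrite HnT by auto; ring.
  - exists (fun x => dot (Derive_on3 a b Z x) (T x)); split.
    { apply smooth_on3_dot; auto; now apply smooth_on3_derive. }
    intros x Hx.
    assert (E : Derive_on3 a b Z x =
      (((- sin (phi x)) * (- w x) *: n x + cos (phi x) *: dn x) +
       (cos (phi x) * (- w x) *: (T x >< n x) +
        sin (phi x) *: (dT x >< n x + T x >< dn x)))%R3).
    { apply Derive_on3_eq; auto; apply is_derive_on3_plus; auto.
      - apply (is_derive_on3_scal a b (fun y => cos (phi y)) n); auto.
        apply (is_derive_on_comp a b cos phi); [auto|apply is_derive_cos|apply Hphi; auto].
      - apply (is_derive_on3_scal a b (fun y => sin (phi y)) (fun y => T y >< n y)%R3); auto.
        + apply (is_derive_on_comp a b sin phi); [auto|apply is_derive_sin|apply Hphi; auto].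
        + apply is_derive_on3_cross; auto; now apply is_derive_on3_T. }
    assert (K1 : dot (dn x) (n x) = 0).
    { pose proof (dot_const_derive n n (dn x) (dn x) 1 x Hx) as K.
      rewrite (dot_comm (n x) (dn x)) in K.
      cut (dot (dn x) (n x) + dot (dn x) (n x) = 0); [lra|]; apply K; auto. }
    assert (K2 : dot (dT x) (T x) = 0) by (rewrite dot_comm; now apply dot_T_dT).
    rewrite (frame_decomposition (T x) (n x) (Derive_on3 a b Z x)) at 1; auto.
    assert (A1 : dot (Derive_on3 a b Z x) (n x) = 0).
    { rewrite E.
      transitivity (sin (phi x) * w x * (dot (n x) (n x) - 1) + cos (phi x) * dot (dn x) (n x)).
      - unfold w; vec.
      - rewrite Hn1, K1 by auto; ring. }
    assert (A2 : dot (Derive_on3 a b Z x) (T x >< n x)%R3 = 0).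
    { rewrite E.
      transitivity (cos (phi x) * w x *
          (1 - (dot (T x) (T x) * dot (n x) (n x) - dot (n x) (T x) * dot (n x) (T x)))
        + sin (phi x) * (dot (dT x) (T x) * dot (n x) (n x) - dot (dT x) (n x) * dot (n x) (T x)
          + dot (T x) (T x) * dot (dn x) (n x) - dot (n x) (T x) * dot (dn x) (T x))).
      - unfold w; vec.
      - rewrite Hn1, K1, K2, hT1, HnT by auto; ring. }
    rewrite A1, A2; vec.
Qed.

(* The covariant rate of rotation of the normalized projection of [N] onto the
   normal planes. *)
Definition rotation_rate (N : R -> R3) (x : R) : R :=
  (dot (Derive_on3 a b N x) (T x >< N x)%R3
   - dot (N x) (T x) * dot (dT x) (T x >< N x)%R3) / (1 - dot (N x) (T x) * dot (N x) (T x)).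

(** The frame vector is [n = (N - <N, T> T) / sqrt m], where [m = 1 - <N, T>^2] is the squared
    length of the projection and [rotation_rate N] turns out to be [<n', T x n>]. Where [N] is
    already normal, [n = N]; this fixes the values at both ends independently of the curve between
    them. *)
Lemma projected_frame_parallel N : smooth_on3 a b N ->
  (forall x, a <= x <= b -> dot (N x) (N x) = 1) ->
  (forall x, a <= x <= b -> 0 < 1 - dot (N x) (T x) * dot (N x) (T x)) ->
  dot (N a) (T a) = 0 ->
  exists Z, parallel_along a b T Z /\ Z a = N a /\
    (dot (N b) (T b) = 0 ->
     Z b = (cos (- RInt (rotation_rate N) a b) *: N b +
            sin (- RInt (rotation_rate N) a b) *: (T b >< N b))%R3).
Proof.
  intros HN HN1 Hm Ha.
  set (m := fun x => 1 - dot (N x) (T x) * dot (N x) (T x)).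
  assert (Hm' : forall x, a <= x <= b -> 0 < m x) by exact Hm; clear Hm; rename Hm' into Hm.
  set (al := fun x => / sqrt (m x)).
  set (w := fun x => (N x - dot (N x) (T x) *: T x)%R3).
  set (n := fun x => (al x *: w x)%R3).
  assert (SNT : smooth_on a b (fun x => dot (N x) (T x))) by now apply smooth_on3_dot.
  assert (Sm : smooth_on a b m).
  { apply smooth_on_minus; auto; [now apply smooth_on_const|now apply smooth_on_mult]. }
  assert (Hal : forall x, a <= x <= b -> al x * al x * m x = 1).
  { intros x Hx; unfold al; rewrite <- Rinv_mult, sqrt_sqrt by (apply Rlt_le, Hm; auto).
    apply Rinv_l, Rgt_not_eq, Hm; auto. }
  assert (Sal : smooth_on a b al).
  { apply smooth_on_inv; auto; [now apply smooth_on_sqrt|].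
    intros; apply Rgt_not_eq, sqrt_lt_R0; auto. }
  assert (Sw : smooth_on3 a b w).
  { apply smooth_on3_minus; auto; now apply smooth_on3_scal. }
  assert (Sn : smooth_on3 a b n) by now apply smooth_on3_scal.
  assert (Hn1 : forall x, a <= x <= b -> dot (n x) (n x) = 1).
  { intros x Hx; rewrite <- (Hal x Hx); unfold n, w, m.
    transitivity (al x * al x * (dot (N x) (N x) - 2 * (dot (N x) (T x) * dot (N x) (T x))
       + dot (N x) (T x) * dot (N x) (T x) * dot (T x) (T x))); [vec|].
    rewrite HN1, hT1 by auto; ring. }
  assert (HnT : forall x, a <= x <= b -> dot (n x) (T x) = 0).
  { intros x Hx; unfold n, w.
    transitivity (al x * dot (N x) (T x) * (1 - dot (T x) (T x))); [vec|].
    rewrite hT1 by auto; ring. }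
  assert (Hn0 : forall x, dot (N x) (T x) = 0 -> n x = N x).
  { intros x H0; unfold n, w, al, m; rewrite H0, Rmult_0_l, Rminus_0_r, sqrt_1, Rinv_1; vec. }
  assert (Srate : smooth_on a b (rotation_rate N)).
  { unfold rotation_rate, Rdiv; apply smooth_on_mult; auto.
    - apply smooth_on_minus; auto.
      + apply smooth_on3_dot; auto; [now apply smooth_on3_derive|now apply smooth_on3_cross].
      + apply smooth_on_mult; auto; apply smooth_on3_dot; auto;
          [now apply smooth_on3_derive|now apply smooth_on3_cross].
    - apply (smooth_on_inv a b hab m); auto; intros; apply Rgt_not_eq, Hm; auto. }
  assert (Hrate : forall x, a <= x <= b ->
    dot (Derive_on3 a b n x) (T x >< n x)%R3 = rotation_rate N x).
  { intros x Hx.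
    assert (E : Derive_on3 a b n x = (Derive_on a b al x *: w x + al x *:
      (Derive_on3 a b N x - (Derive_on a b (fun x => dot (N x) (T x)) x *: T x
         + dot (N x) (T x) *: dT x)))%R3).
    { apply Derive_on3_eq; auto; apply is_derive_on3_scal; auto.
      - now apply smooth_on_is_derive_on.
      - apply is_derive_on3_minus; auto; [now apply smooth_on3_is_derive_on3|].
        apply (is_derive_on3_scal a b (fun x => dot (N x) (T x)) T); auto;
          [now apply smooth_on_is_derive_on|now apply is_derive_on3_T]. }
    (* Both derivatives drop out: [da] multiplies [w x] and [e] multiplies [T x], each orthogonal to
       [T x >< n x]. *)
    rewrite E; set (da := Derive_on a b al x); set (e := Derive_on a b _ x).
    transitivity (al x * al x * (dot (Derive_on3 a b N x) (T x >< N x)%R3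
      - dot (N x) (T x) * dot (dT x) (T x >< N x)%R3)); [unfold n, w; vec|].
    unfold rotation_rate; fold (m x).
    assert (m x <> 0) by (apply Rgt_not_eq, Hm; auto).
    apply (Rmult_eq_reg_r (m x)); auto.
    transitivity (al x * al x * m x * (dot (Derive_on3 a b N x) (T x >< N x)%R3
      - dot (N x) (T x) * dot (dT x) (T x >< N x)%R3)); [ring|].
    rewrite Hal by auto; field; auto. }
  set (phi := fun x => - RInt (rotation_rate N) a x).
  exists (fun x => cos (phi x) *: n x + sin (phi x) *: (T x >< n x))%R3; split; [|split].
  - apply rotated_frame_parallel; auto.
    intros x Hx; rewrite Hrate by auto; unfold phi.
    apply is_derive_on_opp; auto; apply is_derive_on_RInt; auto; now apply smooth_on_ccont.
  - assert (E : phi a = 0).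
    { unfold phi; assert (K : RInt (rotation_rate N) a a = 0)
        by apply (RInt_point (V := R_CompleteNormedModule)).
      rewrite K; ring. }
    rewrite E, cos_0, sin_0, Hn0 by auto; vec.
  - intros Hb; rewrite Hn0 by auto; reflexivity.
Qed.

End Parallel.

(** * Existence of parallel transport *)

Lemma Cauchy_Schwarz (u v : R3) : dot u v * dot u v <= dot u u * dot v v.
Proof.
  assert (E : dot u u * dot v v - dot u v * dot u v = dot (u >< v)%R3 (u >< v)%R3) by vec.
  pose proof (dot_self_ge0 (u >< v)%R3); lra.
Qed.

(* The constant field [W] is nowhere tangent, hence can be projected. *)
Lemma parallel_exists_short c d (T : R -> R3) (W : R3) : c < d -> smooth_on3 c d T ->
  (forall x, c <= x <= d -> dot (T x) (T x) = 1) ->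
  (forall x, c <= x <= d -> dot (T x - T c)%R3 (T x - T c)%R3 < 1) ->
  dot W W = 1 -> dot W (T c) = 0 ->
  exists Z, parallel_along c d T Z /\ Z c = W.
Proof.
  intros Hcd HT HT1 Hnear HW HWT.
  destruct (projected_frame_parallel c d Hcd T HT HT1 (fun _ => W)) as (Z & HZ & HZc & _);
    auto.
  - now apply smooth_on3_const.
  - intros x Hx.
    assert (E : dot W (T x) = dot W (T x - T c)%R3).
    { transitivity (dot W (T x) - dot W (T c)); [rewrite HWT; ring|vec]. }
    rewrite E; pose proof (Cauchy_Schwarz W (T x - T c)%R3) as CS.
    rewrite HW in CS; specialize (Hnear x Hx); lra.
  - exists Z; auto.
Qed.

(** Both pieces solve the same linear equation, so equal values at [c] give equal derivatives there,
    and the glued field solves the equation on the whole interval. *)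
Lemma parallel_along_glue a c d (T Z Y : R -> R3) : a < c -> c < d -> smooth_on3 a d T ->
  (forall x, a <= x <= d -> dot (T x) (T x) = 1) ->
  parallel_along a c T Z -> parallel_along c d T Y -> Z c = Y c ->
  exists X, parallel_along a d T X /\ X a = Z a.
Proof.
  intros Hac Hcd HT HT1 HZ HY E.
  assert (Had : a < d) by lra.
  assert (T1 : smooth_on3 a c T) by (apply (smooth_on3_subset a d); auto; lra).
  assert (T2 : smooth_on3 c d T) by (apply (smooth_on3_subset a d); auto; lra).
  assert (D1 : forall x, a <= x <= c -> Derive_on3 a c T x = Derive_on3 a d T x).
  { intros x Hx; apply Derive_on3_eq; auto; apply (is_derive_on3_subset a d); try lra.
    apply smooth_on3_is_derive_on3; auto; lra. }
  assert (D2 : forall x, c <= x <= d -> Derive_on3 c d T x = Derive_on3 a d T x).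
  { intros x Hx; apply Derive_on3_eq; auto; apply (is_derive_on3_subset a d); try lra.
    apply smooth_on3_is_derive_on3; auto; lra. }
  exists (fun y => if Rle_dec y c then Z y else Y y); split.
  2: { destruct (Rle_dec a c); [auto|lra]. }
  apply ode_parallel_along; auto.
  - destruct (Rle_dec a c); [|lra]; apply HZ; lra.
  - intros x Hx; apply is_derive_on3_glue; auto; try lra; intros Hxc.
    + destruct (Rle_dec x c); [|lra]; rewrite <- D1 by lra.
      apply parallel_along_ode; auto; [intros; apply HT1|]; lra.
    + assert (Ex : (if Rle_dec x c then Z x else Y x) = Y x).
      { destruct (Rle_dec x c); auto; replace x with c by lra; auto. }
      rewrite Ex, <- D2 by lra.
      apply parallel_along_ode; auto; [intros; apply HT1|]; lra.
Qed.

Lemma uniformly_close a b (T : R -> R3) : a < b -> smooth_on3 a b T ->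
  exists delta, 0 < delta /\ forall x y, a <= x <= b -> a <= y <= b ->
    Rabs (x - y) < delta -> dot (T x - T y)%R3 (T x - T y)%R3 < 1.
Proof.
  intros Hab (H1 & H2 & H3).
  (* Coordinate differences below 1/2 bound the squared distance by 3/4. *)
  assert (K : forall f, smooth_on a b f -> exists delta, 0 < delta /\
    forall x y, a <= x <= b -> a <= y <= b -> Rabs (x - y) < delta -> Rabs (f x - f y) < / 2).
  { intros f Hf.
    destruct (unifcont_1d (fun y => f (clamp a b y)) a b) with (eps := mkposreal (/ 2) ltac:(lra))
      as [d Hd].
    { intros x _; now apply smooth_on_ccont. }
    exists d; split; [apply cond_pos|]; intros x y Hx Hy Hxy.
    specialize (Hd x y Hx Hy); rewrite !clamp_id in Hd by auto.
    rewrite Rabs_minus_sym in Hxy; rewrite Rabs_minus_sym.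
    specialize (Hd Hxy); apply Rnot_le_lt; intros N; apply Hd; intros B.
    apply (Rle_not_lt _ _ N); exact B. }
  destruct (K _ H1) as (d1 & P1 & K1), (K _ H2) as (d2 & P2 & K2), (K _ H3) as (d3 & P3 & K3).
  exists (Rmin d1 (Rmin d2 d3)); split; [repeat apply Rmin_glb_lt; auto|].
  intros x y Hx Hy Hxy.
  pose proof (Rmin_l d1 (Rmin d2 d3)); pose proof (Rmin_r d1 (Rmin d2 d3)).
  pose proof (Rmin_l d2 d3); pose proof (Rmin_r d2 d3).
  specialize (K1 x y Hx Hy ltac:(lra)); specialize (K2 x y Hx Hy ltac:(lra)).
  specialize (K3 x y Hx Hy ltac:(lra)).
  unfold comp1, comp2, comp3 in *; autorewrite with vec.
  apply Rabs_def2 in K1; apply Rabs_def2 in K2; apply Rabs_def2 in K3; nra.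
Qed.

Lemma parallel_exists a b (T : R -> R3) (W : R3) : a < b -> smooth_on3 a b T ->
  (forall x, a <= x <= b -> dot (T x) (T x) = 1) -> dot W W = 1 -> dot W (T a) = 0 ->
  exists Z, parallel_along a b T Z /\ Z a = W.
Proof.
  intros Hab HT HT1 HW HWT.
  destruct (uniformly_close a b T Hab HT) as (delta & Hdel & Hclose).
  (* Induction on the number of pieces of length [delta / 2]; the half makes room for the strict
     inequality in [uniformly_close]. Each piece starts from the value of the previous field, which
     is still a unit vector because transport is isometric. *)
  assert (K : forall n d, a < d -> d <= b -> d - a <= INR (S n) * (delta / 2) ->
    exists Z, parallel_along a d T Z /\ Z a = W).
  { induction n as [|n IH]; intros d Had Hdb Hd.
    - simpl in Hd; apply parallel_exists_short; auto.
      + apply (smooth_on3_subset a b); auto; lra.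
      + intros; apply HT1; lra.
      + intros x Hx; apply Hclose; try lra; rewrite Rabs_pos_eq; lra.
    - destruct (Rle_dec (d - a) (INR (S n) * (delta / 2))) as [L|L]; [now apply IH|].
      assert (HN : 0 < INR (S n)) by (apply lt_0_INR; lia).
      assert (HNd : 0 < INR (S n) * (delta / 2)) by (apply Rmult_lt_0_compat; lra).
      rewrite (S_INR (S n)) in Hd.
      set (c := a + INR (S n) * (delta / 2)) in *.
      destruct (IH c) as (Z & HZ & HZa); [unfold c; lra|unfold c; lra|unfold c; lra|].
      assert (Hac : a < c) by (unfold c; lra); assert (Hcd : c < d) by (unfold c; lra).
      destruct (parallel_exists_short c d T (Z c)) as (Y & HY & HYc); auto.
      + apply (smooth_on3_subset a b); auto; lra.
      + intros; apply HT1; lra.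
      + intros x Hx; apply Hclose; try lra; rewrite Rabs_pos_eq; unfold c in *; lra.
      + rewrite (parallel_along_dot a c Hac T) with (Z := Z) (Y := Z); auto; try lra.
        * rewrite HZa; auto.
        * apply (smooth_on3_subset a b); auto; lra.
        * intros; apply HT1; lra.
      + apply HZ; lra.
      + rewrite <- HZa; apply (parallel_along_glue a c d T Z Y); auto.
        * apply (smooth_on3_subset a b); auto; lra.
        * intros; apply HT1; lra. }
  destruct (INR_unbounded ((b - a) / (delta / 2))) as [n Hn].
  apply (K n b); try lra.
  rewrite S_INR; apply (Rmult_lt_compat_r (delta / 2)) in Hn; [|lra].
  replace ((b - a) / (delta / 2) * (delta / 2)) with (b - a) in Hn by (field; lra); lra.
Qed.

(** * First variations *)

Lemma C1t3_ext a b eps F G dF dG : a < b ->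
  (forall t x, Rabs t < eps -> a <= x <= b -> F t x = G t x) ->
  (forall t x, Rabs t < eps -> a <= x <= b -> dF t x = dG t x) ->
  C1t3 a b eps F dF -> C1t3 a b eps G dG.
Proof.
  intros Hab E1 E2 (H1 & H2 & H3); split; [|split];
    [revert H1|revert H2|revert H3]; apply C1t_ext; auto; intros t x Ht Hx;
    unfold comp1, comp2, comp3; rewrite ?E1, ?E2; auto.
Qed.

Lemma C1t3_scal a b eps k F dk dF : a < b -> C1t a b eps k dk -> C1t3 a b eps F dF ->
  C1t3 a b eps (fun t x => k t x *: F t x)%R3
    (fun t x => dk t x *: F t x + k t x *: dF t x)%R3.
Proof.
  intros Hab K (F1 & F2 & F3); split; [|split].
  - apply (C1t_mult a b eps k (fun t => comp1 (F t))); auto.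
  - apply (C1t_mult a b eps k (fun t => comp2 (F t))); auto.
  - apply (C1t_mult a b eps k (fun t => comp3 (F t))); auto.
Qed.

Lemma C1t3_plus a b eps F G dF dG : a < b -> C1t3 a b eps F dF -> C1t3 a b eps G dG ->
  C1t3 a b eps (fun t x => F t x + G t x)%R3 (fun t x => dF t x + dG t x)%R3.
Proof.
  intros Hab (F1 & F2 & F3) (G1 & G2 & G3); split; [|split].
  - apply (C1t_plus a b eps (fun t => comp1 (F t)) (fun t => comp1 (G t))); auto.
  - apply (C1t_plus a b eps (fun t => comp2 (F t)) (fun t => comp2 (G t))); auto.
  - apply (C1t_plus a b eps (fun t => comp3 (F t)) (fun t => comp3 (G t))); auto.
Qed.

Lemma C1t3_swap a b eps F P dF dP : a < b -> 0 < eps ->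
  (forall t x, Rabs t < eps -> a <= x <= b -> is_derive_on3 a b (F t) x (P t x)) ->
  C1t3 a b eps F dF -> C1t3 a b eps P dP ->
  forall x, a <= x <= b -> is_derive_on3 a b (dF 0) x (dP 0 x).
Proof.
  intros Hab He HF (F1 & F2 & F3) (P1 & P2 & P3) x Hx.
  assert (H0 : Rabs 0 < eps) by (rewrite Rabs_R0; auto).
  split; [|split].
  - apply (is_derive_on_swap a b Hab eps (fun t => comp1 (F t)) (fun t => comp1 (P t))
      (fun t => comp1 (dP t))); auto; intros; [apply HF; auto|apply F1; auto].
  - apply (is_derive_on_swap a b Hab eps (fun t => comp2 (F t)) (fun t => comp2 (P t))
      (fun t => comp2 (dP t))); auto; intros; [apply HF; auto|apply F2; auto].
  - apply (is_derive_on_swap a b Hab eps (fun t => comp3 (F t)) (fun t => comp3 (P t))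
      (fun t => comp3 (dP t))); auto; intros; [apply HF; auto|apply F3; auto].
Qed.

Definition Derive_t (eps : R) (F : R -> R -> R3) (t x : R) : R3 :=
  Derive_on3 (- eps) eps (fun s => F s x) t.

Lemma smooth_rect3_C1t3 a b eps G : a < b -> smooth_rect3 (- eps) eps a b G ->
  C1t3 a b eps G (Derive_t eps G) /\
  C1t3 a b eps (fun t => Derive_on3 a b (G t))
    (Derive_t eps (fun t => Derive_on3 a b (G t))) /\
  C1t3 a b eps (fun t => Derive_on3 a b (Derive_on3 a b (G t)))
    (Derive_t eps (fun t => Derive_on3 a b (Derive_on3 a b (G t)))).
Proof.
  (* Order 3 accounts for two derivatives in [x] followed by one in [t]. *)
  intros Hab H; destruct (H 3%nat) as (H1 & H2 & H3); split; [|split].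
  - split; [|split]; eapply Ck_rect_C1t; eauto.
  - destruct H1 as (_ & _ & _ & H1), H2 as (_ & _ & _ & H2), H3 as (_ & _ & _ & H3).
    split; [|split]; eapply Ck_rect_C1t; eauto.
  - destruct H1 as (_ & _ & _ & _ & _ & _ & H1), H2 as (_ & _ & _ & _ & _ & _ & H2),
      H3 as (_ & _ & _ & _ & _ & _ & H3).
    split; [|split]; eapply Ck_rect_C1t; eauto.
Qed.

Lemma speed_gt0 a b c x : curve a b c -> a <= x <= b -> 0 < speed a b c x.
Proof. intros [_ H] Hx; apply sqrt_lt_R0, dot_self_gt0; auto. Qed.

Lemma speed_smooth a b c : a < b -> curve a b c -> smooth_on a b (speed a b c).
Proof.
  intros Hab Hc; apply (smooth_on_sqrt a b Hab
    (fun x => dot (Derive_on3 a b c x) (Derive_on3 a b c x))).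
  - apply smooth_on3_dot; auto; apply smooth_on3_derive, Hc.
  - intros x Hx; apply dot_self_gt0, Hc; auto.
Qed.

Lemma tangent_smooth a b c : a < b -> curve a b c -> smooth_on3 a b (tangent a b c).
Proof.
  intros Hab Hc; apply (smooth_on3_scal a b Hab (fun x => / speed a b c x)).
  - apply smooth_on_inv; auto; [now apply speed_smooth|].
    intros; now apply Rgt_not_eq, speed_gt0.
  - apply smooth_on3_derive, Hc.
Qed.

Lemma tangent_unit a b c x : curve a b c -> a <= x <= b ->
  dot (tangent a b c x) (tangent a b c x) = 1.
Proof.
  intros Hc Hx; pose proof (speed_gt0 a b c x Hc Hx) as Hs.
  unfold tangent, d_ds; set (p := Derive_on3 a b c x); set (s := speed a b c x) in *.
  assert (E : s * s = dot p p) by apply norm3_sqr.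
  transitivity (/ s * / s * dot p p); [vec|rewrite <- E; field; lra].
Qed.

Lemma tangent_arclength a b c x : arclength_parametrized a b c -> a <= x <= b ->
  tangent a b c x = Derive_on3 a b c x.
Proof.
  intros H Hx; unfold tangent, d_ds, speed; rewrite H by auto; rewrite Rinv_1.
  apply R3_ext; autorewrite with vec; ring.
Qed.

Lemma Derive_on3_ext_loc a b f g x : a < b -> a <= x <= b -> smooth_on3 a b f ->
  locally x (fun y => a <= y <= b -> f y = g y) -> Derive_on3 a b g x = Derive_on3 a b f x.
Proof.
  intros Hab Hx Hf E; apply Derive_on3_eq; auto.
  apply (is_derive_on3_ext_loc a b f); auto; now apply smooth_on3_is_derive_on3.
Qed.

(** * Speed, tangent and bending energy along a variation *)

Section Variation.
Context (a b : R) (hab : a < b) (gamma : R -> R3) (hgamma : curve a b gamma).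
Context (harc : arclength_parametrized a b gamma).
Context (eps : R) (G : R -> R -> R3) (hG : compactly_supported_variation a b gamma eps G).
Context (v : R -> R3) (hv : smooth_on3 a b v).
Context (hGv : forall x, a <= x <= b -> variational_field G x = v x).
Context (hort : forall x, a <= x <= b ->
  dot (Derive_on3 a b v x) (Derive_on3 a b gamma x) = 0).

Let T := Derive_on3 a b gamma.
Let T' := Derive_on3 a b T.

Lemma variation_eps_gt0 : 0 < eps.
Proof. apply hG. Qed.

Lemma variation_curve t : Rabs t < eps -> curve a b (G t).
Proof. intros Ht; apply Rabs_def2 in Ht; apply hG; lra. Qed.

Lemma Derive_on3_variation0 x : a <= x <= b -> Derive_on3 a b (G 0) x = T x.
Proof.
  intros Hx; apply Derive_on3_ext_loc; auto; [apply hgamma|].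
  apply filter_forall; intros y Hy; symmetry; apply hG; auto.
Qed.

Lemma speed_variation0 x : a <= x <= b -> speed a b (G 0) x = 1.
Proof. intros Hx; unfold speed; rewrite Derive_on3_variation0; auto. Qed.

Lemma tangent_variation0 x : a <= x <= b -> tangent a b (G 0) x = T x.
Proof.
  intros Hx; unfold tangent, d_ds; rewrite speed_variation0, Derive_on3_variation0 by auto.
  rewrite Rinv_1; vec.
Qed.

Lemma T_smooth : smooth_on3 a b T.
Proof. apply smooth_on3_derive, hgamma. Qed.

(** Near the end points all curves of the family coincide with [gamma]; hence [Wa] and [Wb] are
    normal to each of them. *)
Lemma tangent_variation_end t x : Rabs t < eps -> x = a \/ x = b ->
  tangent a b (G t) x = T x.
Proof.
  intros Ht Hx; destruct hG as (_ & c & d & Hc & Hd & E).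
  assert (Hx' : a <= x <= b) by lra.
  assert (ED : Derive_on3 a b (G t) x = T x).
  { apply Derive_on3_ext_loc; auto; [apply hgamma|].
    apply Rabs_def2 in Ht; destruct Hx; subst x.
    - apply (locally_interval _ a m_infty c); simpl; auto.
      intros y _ Hy Hyab; symmetry; apply E; simpl in Hy; lra.
    - apply (locally_interval _ b d p_infty); simpl; auto.
      intros y Hy _ Hyab; symmetry; apply E; simpl in Hy; lra. }
  unfold tangent, d_ds, speed; rewrite ED; unfold T; rewrite harc, Rinv_1 by auto; vec.
Qed.

(* At first order in [t], orthogonality of [v'] and [T] keeps the speed fixed. *)
Lemma tangent_family : exists dS dT dT',
  C1t a b eps (fun t => speed a b (G t)) dS /\
  C1t3 a b eps (fun t => tangent a b (G t)) dT /\
  C1t3 a b eps (fun t => Derive_on3 a b (tangent a b (G t))) dT' /\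
  forall x, a <= x <= b -> dS 0 x = 0 /\ dT 0 x = Derive_on3 a b v x /\
    dT' 0 x = Derive_on3 a b (Derive_on3 a b v) x.
Proof.
  pose proof variation_eps_gt0 as He.
  assert (H0 : Rabs 0 < eps) by (rewrite Rabs_R0; auto).
  assert (Hrect : smooth_rect3 (- eps) eps a b G) by apply hG.
  destruct (smooth_rect3_C1t3 a b eps G hab Hrect) as (CG & Cp & Cq).
  set (p := fun t => Derive_on3 a b (G t)) in *.
  set (q := fun t => Derive_on3 a b (p t)) in *.
  set (dG := Derive_t eps G) in *; set (dp := Derive_t eps p) in *.
  set (dq := Derive_t eps q).
  change (C1t3 a b eps q dq) in Cq.
  assert (EdG : forall x, a <= x <= b -> dG 0 x = v x).
  { intros x Hx; rewrite <- hGv by auto; destruct CG as (C1 & C2 & C3).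
    apply R3_ext; unfold variational_field; autorewrite with vec; symmetry;
      apply is_derive_unique; [apply C1|apply C2|apply C3]; auto. }
  assert (HGp : forall t x, Rabs t < eps -> a <= x <= b ->
    is_derive_on3 a b (G t) x (p t x)).
  { intros t x Ht Hx; apply smooth_on3_is_derive_on3; auto; now apply variation_curve. }
  assert (Hpq : forall t x, Rabs t < eps -> a <= x <= b ->
    is_derive_on3 a b (p t) x (q t x)).
  { intros t x Ht Hx; apply smooth_on3_is_derive_on3; auto.
    apply smooth_on3_derive; now apply variation_curve. }
  assert (Edp : forall x, a <= x <= b -> dp 0 x = Derive_on3 a b v x).
  { intros x Hx; symmetry; apply Derive_on3_eq; auto.
    apply (is_derive_on3_ext a b (dG 0)); auto.
    apply (C1t3_swap a b eps G p dG dp); auto. }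
  assert (Hpp : forall t x, Rabs t < eps -> a <= x <= b -> 0 < dot (p t x) (p t x)).
  { intros t x Ht Hx; apply dot_self_gt0; apply (variation_curve t Ht); auto. }
  assert (Hs : forall t x, Rabs t < eps -> a <= x <= b -> speed a b (G t) x <> 0).
  { intros t x Ht Hx; apply Rgt_not_eq, speed_gt0; auto; now apply variation_curve. }
  pose proof (C1t3_dot a b hab eps _ _ _ _ Cp Cp) as Cpp.
  pose proof (C1t_sqrt a b hab eps _ _ Hpp Cpp) as Cs.
  change (C1t a b eps (fun t => speed a b (G t)) (fun t x => / (2 * speed a b (G t) x) *
    (dot (dp t x) (p t x) + dot (p t x) (dp t x)))) in Cs.
  pose proof (C1t_inv a b hab eps _ _ Hs Cs) as Ck.
  pose proof (C1t3_scal a b eps _ _ _ _ hab Ck Cp) as CT.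
  change (fun t x => (/ speed a b (G t) x *: p t x)%R3)
    with (fun t => tangent a b (G t)) in CT.
  assert (EdS : forall x, a <= x <= b -> / (2 * speed a b (G 0) x) *
    (dot (dp 0 x) (p 0 x) + dot (p 0 x) (dp 0 x)) = 0).
  { intros x Hx; rewrite (dot_comm (p 0 x)), Edp by auto.
    assert (Ep : p 0 x = Derive_on3 a b gamma x) by (apply Derive_on3_variation0; auto).
    rewrite Ep, hort by auto; ring. }
  assert (ET' : forall t x, Rabs t < eps -> a <= x <= b ->
    ((- / speed a b (G t) x ^ 2 * (/ (2 * speed a b (G t) x) *
      (dot (q t x) (p t x) + dot (p t x) (q t x)))) *: p t x
     + / speed a b (G t) x *: q t x)%R3 = Derive_on3 a b (tangent a b (G t)) x).
  { intros t x Ht Hx; symmetry; apply Derive_on3_eq; auto.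
    apply (is_derive_on3_scal a b (fun y => / speed a b (G t) y) (p t)); auto.
    apply (is_derive_on_comp a b Rinv (speed a b (G t))); auto.
    { specialize (Hs t x Ht Hx); auto_derive; auto; field; auto. }
    apply (is_derive_on_comp a b sqrt (fun y => dot (p t y) (p t y))); auto.
    { specialize (Hpp t x Ht Hx); unfold speed, norm3; fold (p t x).
      auto_derive; auto; field; apply Rgt_not_eq, sqrt_lt_R0; auto. }
    apply is_derive_on3_dot; auto. }
  (* The formula [ET'] is used only to see that the x-derivative of the tangent is C^1 in [t]. The
     value of its t-derivative at 0 is not computed from it: exchanging the derivatives gives the
     x-derivative of [dT 0], which is [v']. *)
  assert (CT' : exists dT', C1t3 a b eps
    (fun t => Derive_on3 a b (tangent a b (G t))) dT').
  { pose proof (C1t_plus a b eps _ _ _ _ (C1t3_dot a b hab eps _ _ _ _ Cq Cp)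
      (C1t3_dot a b hab eps _ _ _ _ Cp Cq)) as Cpq.
    assert (exists d, C1t a b eps (fun t x => 2 * speed a b (G t) x) d) as [d2 C2s].
    { eexists; apply (C1t_mult a b eps (fun _ _ => 2)); [|exact Cs].
      apply (C1t_static a b eps (fun _ => 2)), ccont_const. }
    assert (N2 : forall t x, Rabs t < eps -> a <= x <= b -> 2 * speed a b (G t) x <> 0).
    { intros t x Ht Hx; specialize (Hs t x Ht Hx); lra. }
    assert (exists d, C1t a b eps (fun t x => speed a b (G t) x ^ 2) d) as [ds2 Cs2].
    { eexists; eapply C1t_ext; [exact hab| | |apply (C1t_mult a b eps _ _ _ _ Cs Cs)];
        intros; simpl; [ring|reflexivity]. }
    assert (N3 : forall t x, Rabs t < eps -> a <= x <= b -> speed a b (G t) x ^ 2 <> 0).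
    { intros t x Ht Hx; specialize (Hs t x Ht Hx); now apply pow_nonzero. }
    assert (exists d, C1t a b eps (fun t x => - / speed a b (G t) x ^ 2) d) as [dm Cm].
    { eexists; eapply C1t_ext; [exact hab| | |apply (C1t_mult a b eps (fun _ _ => -1) _ _ _
        (C1t_static a b eps (fun _ => -1) (ccont_const a b (-1)))
        (C1t_inv a b hab eps _ _ N3 Cs2))];
        intros; simpl; [ring|reflexivity]. }
    pose proof (C1t_mult a b eps _ _ _ _ Cm (C1t_mult a b eps _ _ _ _
      (C1t_inv a b hab eps _ _ N2 C2s) Cpq)) as Cdk.
    eexists; eapply C1t3_ext; [exact hab|exact ET'|reflexivity|].
    exact (C1t3_plus a b eps _ _ _ _ hab (C1t3_scal a b eps _ _ _ _ hab Cdk Cp)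
      (C1t3_scal a b eps _ _ _ _ hab Ck Cq)). }
  destruct CT' as (dT' & CT').
  assert (EdT : forall x, a <= x <= b ->
     ((- / (speed a b (G 0%R) x) ^ 2 * (/ (2 * speed a b (G 0%R) x) *
       (dot (dp 0%R x) (p 0%R x) + dot (p 0%R x) (dp 0%R x)))) *: p 0%R x
      + / speed a b (G 0%R) x *: dp 0%R x)%R3 = Derive_on3 a b v x).
  { intros x Hx; rewrite EdS, Edp, speed_variation0, Rinv_1 by auto; vec. }
  eexists _, _, dT'; split; [exact Cs|split; [exact CT|split; [exact CT'|]]].
  intros x Hx; split; [auto|split; [auto|]].
  symmetry; apply Derive_on3_eq; auto.
  eapply is_derive_on3_ext; [auto|exact EdT|].
  refine (C1t3_swap a b eps (fun t => tangent a b (G t))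
    (fun t => Derive_on3 a b (tangent a b (G t))) _ dT' hab He _ CT CT' x Hx).
  intros t y Ht Hy; apply smooth_on3_is_derive_on3; auto.
  apply tangent_smooth; auto; now apply variation_curve.
Qed.

Lemma is_derive_bending_energy rho : smooth_on a b rho ->
  is_derive (fun t => bending_energy a b rho (G t)) 0
    (RInt (fun x => rho x * dot (T' x) (Derive_on3 a b (Derive_on3 a b v) x)) a b).
Proof.
  intros Hrho; pose proof variation_eps_gt0 as He.
  destruct tangent_family as (dS & dT & dT' & CS & CT & CT' & E).
  assert (Hs : forall t x, Rabs t < eps -> a <= x <= b -> speed a b (G t) x <> 0).
  { intros t x Ht Hx; apply Rgt_not_eq, speed_gt0; auto; now apply variation_curve. }
  pose proof (C1t_inv a b hab eps _ _ Hs CS) as Ck.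
  pose proof (C1t3_scal a b eps _ _ _ _ hab Ck CT') as CD.
  pose proof (C1t3_dot a b hab eps _ _ _ _ CD CD) as CDD.
  pose proof (C1t_mult a b eps _ _ _ _ (C1t_static a b eps rho (smooth_on_ccont a b hab rho Hrho))
    CDD) as CR.
  pose proof (C1t_mult a b eps _ _ _ _ CR CS) as CF.
  pose proof (is_derive_RInt_C1t a b hab eps _ _ b He CF ltac:(lra)) as K.
  pose proof (is_derive_scal _ 0 (/ 2) _ K) as K2.
  eapply is_derive_ext; [|eapply (fun H => eq_rect _ (is_derive _ 0) K2 _ H)].
  - intros t; reflexivity.
  - set (h := fun x => rho x * dot (T' x) (Derive_on3 a b (Derive_on3 a b v) x)).
    assert (Hh : ex_RInt h a b).
    { apply (ex_RInt_ccont a b); try lra; apply smooth_on_ccont; auto.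
      apply smooth_on_mult; auto; apply smooth_on3_dot; auto.
      - apply smooth_on3_derive, T_smooth.
      - now do 2 apply smooth_on3_derive. }
    (* At [t = 0] the speed is 1 with derivative zero, so its powers contribute nothing and only the
       square of [T'] is differentiated. The resulting factor 2 cancels the 1/2 of the energy. *)
    rewrite (RInt_ext _ (fun x => 2 * h x)).
    + assert (E2 : RInt (fun x => 2 * h x) a b = 2 * RInt h a b)
        by exact (RInt_scal (V := R_CompleteNormedModule) h a b 2 Hh).
      rewrite E2; unfold scal; simpl; unfold mult; simpl; field.
    + rewrite Rmin_left, Rmax_right by lra; intros x Hx.
      assert (Hx' : a <= x <= b) by lra.
      destruct (E x Hx') as (E1 & E2 & E3).
      assert (E4 : Derive_on3 a b (tangent a b (G 0)) x = T' x).
      { apply Derive_on3_ext_loc; auto; [apply T_smooth|].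
        apply filter_forall; intros y Hy; symmetry; now apply tangent_variation0. }
      rewrite E1, E3, E4, speed_variation0, Rinv_1 by auto; unfold h.
      generalize (T' x) (Derive_on3 a b (Derive_on3 a b v) x); intros; vec.
Qed.

End Variation.

(** * First variation of the holonomy *)

Lemma exists_angle (x y : R) : x * x + y * y = 1 -> exists t, cos t = x /\ sin t = y.
Proof.
  intros H.
  assert (Hx : -1 <= x <= 1) by nra.
  assert (E : 1 - Rsqr x = Rsqr y) by (unfold Rsqr; lra).
  destruct (Rle_dec 0 y).
  - exists (acos x); split; [now apply cos_acos|].
    rewrite sin_acos, E by auto; now apply sqrt_Rsqr.
  - exists (- acos x); split; [rewrite cos_neg; now apply cos_acos|].
    rewrite sin_neg, sin_acos, E, sqrt_Rsqr_abs by auto.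
    rewrite Rabs_left; lra.
Qed.

Lemma unit_normal_polar (T W N : R3) : dot T T = 1 -> dot W W = 1 -> dot N N = 1 ->
  dot W T = 0 -> dot N T = 0 ->
  exists t, N = (cos t *: W + sin t *: (T >< W))%R3.
Proof.
  intros HT HW HN HWT HNT.
  pose proof (frame_decomposition T W N HT HW HWT) as E; rewrite HNT in E.
  destruct (exists_angle (dot N W) (dot N (T >< W)%R3)) as (t & E1 & E2).
  - rewrite <- HN; set (x := dot N W) in *; set (y := dot N (T >< W)%R3) in *.
    transitivity (x * x * dot W W + y * y * (dot T T * dot W W - dot W T * dot W T)).
    + rewrite HT, HW, HWT; ring.
    + set (M := (0%R *: T + x *: W + y *: (T >< W))%R3) in *.
      transitivity (dot M M); [unfold M; vec|now rewrite <- E].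
  - exists t; rewrite E1, E2, E at 1; vec.
Qed.

Section Holonomy.
Context (a b : R) (hab : a < b) (gamma : R -> R3) (hgamma : curve a b gamma).
Context (harc : arclength_parametrized a b gamma).
Context (eps : R) (G : R -> R -> R3) (hG : compactly_supported_variation a b gamma eps G).
Context (v : R -> R3).
Context (hGv : forall x, a <= x <= b -> variational_field G x = v x).
Context (hort : forall x, a <= x <= b ->
  dot (Derive_on3 a b v x) (Derive_on3 a b gamma x) = 0).
Context (Wa Wb : R3) (hWa : unit_normal a b gamma a Wa) (hWb : unit_normal a b gamma b Wb).

Let T := Derive_on3 a b gamma.
Let T' := Derive_on3 a b T.

Lemma unit_normal_arclength x W : a <= x <= b -> unit_normal a b gamma x W ->
  dot W W = 1 /\ dot W (T x) = 0.
Proof.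
  intros Hx [H1 H2]; split; [now apply norm3_eq1|].
  rewrite tangent_arclength in H2; auto.
Qed.

(** Only [T_t] and [T_t'] depend on [t]. Since [<N, T> = 0] at [t = 0], the denominator is 1 to
    first order and the term in [v''] has coefficient zero; with [N' = - <N, T'> T], the remaining
    first-order terms combine to [<v', T x T'>]. *)
Lemma rotation_rate_variation N lam : smooth_on3 a b N ->
  (forall x, a <= x <= b -> dot (N x) (N x) = 1) ->
  (forall x, a <= x <= b -> dot (N x) (T x) = 0) ->
  (forall x, a <= x <= b -> Derive_on3 a b N x = (lam x *: T x)%R3) ->
  exists delta, 0 < delta /\ delta <= eps /\
  (forall t x, Rabs t < delta -> a <= x <= b ->
    0 < 1 - dot (N x) (tangent a b (G t) x) * dot (N x) (tangent a b (G t) x)) /\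
  is_derive (fun t => RInt (rotation_rate a b (tangent a b (G t)) N) a b) 0
    (RInt (fun x => dot (Derive_on3 a b v x) (T x >< T' x)%R3) a b).
Proof.
  intros HN HN1 HNT HN'.
  pose proof (variation_eps_gt0 a b gamma eps G hG) as He.
  destruct (tangent_family a b hab gamma hgamma harc eps G hG v hGv hort)
    as (dS & dT & dT' & _ & CT & CT' & E).
  pose proof (C1t3_static a b hab eps N HN) as CN.
  pose proof (C1t3_static a b hab eps _ (smooth_on3_derive a b N HN)) as CN'.
  pose proof (C1t3_dot a b hab eps _ _ _ _ CN CT) as CNT.
  pose proof (C1t_minus a b hab eps _ _ _ _
    (C1t_static a b eps (fun _ => 1) (ccont_const a b 1)) (C1t_mult a b eps _ _ _ _ CNT CNT)) as Cm.
  assert (ET0 : forall x, a <= x <= b -> tangent a b (G 0) x = T x).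
  { intros; apply (tangent_variation0 a b hab gamma hgamma harc eps G hG); auto. }
  destruct (Ct_gt0_near a b eps _ hab He (proj1 Cm)) as (delta & Hd & Hde & Hm).
  { intros x Hx; rewrite ET0, HNT by auto; lra. }
  exists delta; split; [auto|split; [auto|split; [exact Hm|]]].
  pose proof (C1t3_cross a b hab eps _ _ _ _ CT CN) as CTN.
  pose proof (C1t_minus a b hab eps _ _ _ _ (C1t3_dot a b hab eps _ _ _ _ CN' CTN)
    (C1t_mult a b eps _ _ _ _ CNT (C1t3_dot a b hab eps _ _ _ _ CT' CTN))) as CA.
  pose proof (C1t_mult a b delta _ _ _ _ (C1t_shrink a b eps delta _ _ Hde CA)
    (C1t_inv a b hab delta _ _ (fun t x Ht Hx => Rgt_not_eq _ _ (Hm t x Ht Hx))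
      (C1t_shrink a b eps delta _ _ Hde Cm))) as CR.
  pose proof (is_derive_RInt_C1t a b hab delta _ _ b Hd CR ltac:(lra)) as K.
  eapply (fun H => eq_rect _ (is_derive _ 0) K _ H).
  apply RInt_ext; rewrite Rmin_left, Rmax_right by lra; intros x Hx.
  assert (Hx' : a <= x <= b) by lra.
  destruct (E x Hx') as (_ & E2 & E3).
  assert (E4 : Derive_on3 a b (tangent a b (G 0)) x = T' x).
  { apply Derive_on3_ext_loc; auto; [apply smooth_on3_derive, hgamma|].
    apply filter_forall; intros y Hy; symmetry; now apply ET0. }
  assert (HTx : dot (T x) (T x) = 1) by (apply norm3_eq1; now apply harc).
  assert (DT : is_derive_on3 a b T x (T' x)).
  { apply smooth_on3_is_derive_on3; auto; apply smooth_on3_derive, hgamma. }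
  assert (DN : is_derive_on3 a b N x (lam x *: T x)%R3).
  { rewrite <- HN' by auto; apply smooth_on3_is_derive_on3; auto. }
  assert (Hlam : lam x = - dot (N x) (T' x)).
  { pose proof (dot_const_derive a b hab N T _ _ 0 x Hx' DN DT HNT) as K0.
    replace (dot (lam x *: T x)%R3 (T x)) with (lam x * dot (T x) (T x)) in K0 by vec.
    rewrite HTx in K0; lra. }
  assert (HT'T : dot (T' x) (T x) = 0).
  { pose proof (dot_T_dT a b hab T (smooth_on3_derive a b gamma (proj1 hgamma))) as K0.
    rewrite dot_comm; apply K0; auto; intros; apply norm3_eq1; now apply harc. }
  specialize (hort x Hx'); fold T in hort.
  rewrite E2, E3, E4, ET0, HN', Hlam by auto.
  specialize (HN1 x Hx'); specialize (HNT x Hx').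
  rewrite HNT.
  pose proof (frame_decomposition (T x) (N x) (T' x) HTx HN1 HNT) as FT.
  pose proof (frame_decomposition (T x) (N x) (Derive_on3 a b v x) HTx HN1 HNT) as Fv.
  rewrite HT'T in FT; rewrite hort in Fv.
  clear - HTx HN1 HNT FT Fv.
  revert HTx HN1 HNT FT Fv.
  generalize (T x) (N x) (T' x) (Derive_on3 a b v x)
    (Derive_on3 a b (Derive_on3 a b v) x).
  intros t n s w z Ht Hn Hnt Fs Fw.
  real_eq.
  (* This is the determinant of the components of [v'] and [T'] in the normal frame [n], [t x n],
     that is, up to sign and order the triple product with [t]. *)
  transitivity (dot n s * dot w (t >< n)%R3 - dot w n * dot s (t >< n)%R3).
  - replace (1 - 0 * 0) with 1 by ring; rewrite pow1, Rinv_1; vec.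
  - set (al := dot s n) in *; set (be := dot s (t >< n)%R3) in *.
    set (c := dot w n) in *; set (d := dot w (t >< n)%R3) in *.
    set (S := (0%R *: t + al *: n + be *: (t >< n))%R3) in *.
    set (V := (0%R *: t + c *: n + d *: (t >< n))%R3) in *.
    transitivity (dot V (t >< S)%R3); [|now rewrite <- Fs, <- Fw].
    transitivity ((d * al - c * be) * (dot t t * dot n n - dot n t * dot n t)).
    + rewrite Ht, Hn, Hnt, (dot_comm n s); fold al; ring.
    + unfold V, S; vec.
Qed.

(** The lift is explicit: [t0] is the angle from [Wb] to the transported vector [N b] along [gamma],
    and the minus sign of the integral is that of [phi' = - w] in [rotated_frame_parallel]. The end
    tangents do not move with [t], so one choice of [t0] serves all nearby curves. *)
Lemma holonomy_variation : exists theta : R -> R,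
  locally 0 (fun t => is_holonomy a b Wa Wb (G t) (theta t)) /\
  is_derive theta 0 (- RInt (fun x => dot (Derive_on3 a b v x) (T x >< T' x)%R3) a b).
Proof.
  assert (Ha : a <= a <= b) by lra; assert (Hb : a <= b <= b) by lra.
  destruct (unit_normal_arclength a Wa Ha hWa) as [Wa1 WaT].
  destruct (unit_normal_arclength b Wb Hb hWb) as [Wb1 WbT].
  assert (HT : smooth_on3 a b T) by (apply smooth_on3_derive, hgamma).
  assert (HT1 : forall x, a <= x <= b -> dot (T x) (T x) = 1).
  { intros; apply norm3_eq1; now apply harc. }
  destruct (parallel_exists a b T Wa hab HT HT1 Wa1 WaT) as (N & PN & HNa).
  assert (HN1 : forall x, a <= x <= b -> dot (N x) (N x) = 1).
  { intros x Hx; rewrite (parallel_along_dot a b hab T HT HT1 N N PN PN), HNa; auto. }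
  destruct (PN) as (HN & HNT & lam & _ & HN').
  destruct (rotation_rate_variation N lam HN HN1 HNT HN') as (delta & Hd & Hde & Hm & HD).
  destruct (unit_normal_polar (T b) Wb (N b)) as (t0 & Et0); auto.
  exists (fun t => t0 + - RInt (rotation_rate a b (tangent a b (G t)) N) a b); split.
  - exists (mkposreal delta Hd); intros t Ht.
    assert (Ht' : Rabs t < delta).
    { rewrite <- (Rminus_0_r t); exact Ht. }
    assert (Hte : Rabs t < eps) by lra.
    pose proof (variation_curve a b gamma eps G hG t Hte) as Hc.
    assert (ETa : tangent a b (G t) a = T a)
      by (apply (tangent_variation_end a b hab gamma hgamma harc eps G hG); auto).
    assert (ETb : tangent a b (G t) b = T b)
      by (apply (tangent_variation_end a b hab gamma hgamma harc eps G hG); auto).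
    destruct (projected_frame_parallel a b hab (tangent a b (G t))
      (tangent_smooth a b (G t) hab Hc) (fun x => tangent_unit a b (G t) x Hc) N HN HN1)
      as (Z & PZ & HZa & HZb).
    + intros x Hx; apply Hm; auto.
    + rewrite ETa; auto.
    + exists Z; split; [exact PZ|split; [congruence|]].
      rewrite ETb in *; rewrite HZb, Et0 by auto.
      set (phi := - RInt _ _ _); rewrite cos_plus, sin_plus.
      (* Rotation angles in the normal plane add up, because [T x (T x Wb) = - Wb]. *)
      transitivity (cos phi *: (cos t0 *: Wb + sin t0 *: (T b >< Wb)) +
        sin phi *: (cos t0 *: (T b >< Wb) +
          sin t0 *: (dot Wb (T b) *: T b - dot (T b) (T b) *: Wb)))%R3; [vec|].
      rewrite WbT, HT1 by auto; vec.
  - rewrite <- Rplus_0_l; apply (is_derive_plus (fun _ => t0)); [apply (is_derive_const t0)|].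
    exact (is_derive_opp _ 0 _ HD).
Qed.

(** Uniqueness of transport makes [cos] and [sin] of the two lifts agree near 0. Comparing the
    derivatives of both functions and using [sin^2 + cos^2 = 1] gives equal rates, without
    discussing multiples of 2 pi. *)
Lemma holonomy_rate_unique (theta1 theta2 : R -> R) (l1 l2 : R) :
  locally 0 (fun t => is_holonomy a b Wa Wb (G t) (theta1 t)) ->
  locally 0 (fun t => is_holonomy a b Wa Wb (G t) (theta2 t)) ->
  is_derive theta1 0 l1 -> is_derive theta2 0 l2 -> l1 = l2.
Proof.
  intros H1 H2 D1 D2.
  assert (Ha : a <= a <= b) by lra; assert (Hb : a <= b <= b) by lra.
  destruct (unit_normal_arclength b Wb Hb hWb) as [Wb1 WbT].
  assert (HTb : dot (T b) (T b) = 1) by (apply norm3_eq1; now apply harc).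
  pose proof (variation_eps_gt0 a b gamma eps G hG) as He.
  assert (E : locally 0 (fun t => cos (theta1 t) = cos (theta2 t) /\ sin (theta1 t) = sin (theta2 t))).
  { assert (H0 : Rabs 0 < eps) by (rewrite Rabs_R0; auto).
    generalize (filter_and _ _ (locally_Rabs_lt eps 0 H0) (filter_and _ _ H1 H2)).
    apply filter_imp; intros t (Ht & (Z & PZ & HZa & HZb) & (Y & PY & HYa & HYb)).
    pose proof (variation_curve a b gamma eps G hG t Ht) as Hc.
    assert (ETb : tangent a b (G t) b = T b)
      by (apply (tangent_variation_end a b hab gamma hgamma harc eps G hG); auto).
    assert (EZ : Z b = Y b).
    { apply (parallel_along_unique a b hab (tangent a b (G t))
        (tangent_smooth a b (G t) hab Hc) (fun x => tangent_unit a b (G t) x Hc)); auto.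
      congruence. }
    rewrite HZb, HYb, ETb in EZ.
    assert (K1 : forall th, dot (cos th *: Wb + sin th *: (T b >< Wb))%R3 Wb = cos th).
    { intros th; transitivity (cos th * dot Wb Wb); [vec|rewrite Wb1; ring]. }
    assert (K2 : forall th, dot (cos th *: Wb + sin th *: (T b >< Wb))%R3 (T b >< Wb)%R3 = sin th).
    { intros th; transitivity (sin th * (dot (T b) (T b) * dot Wb Wb - dot Wb (T b) * dot Wb (T b)));
        [vec|rewrite Wb1, WbT, HTb; ring]. }
    split; [rewrite <- K1, EZ, K1|rewrite <- K2, EZ, K2]; auto. }
  assert (C1 : - sin (theta1 0) * l1 = - sin (theta2 0) * l2).
  { assert (A1 : is_derive (fun t => cos (theta1 t)) 0 (l1 * - sin (theta1 0)))
      by exact (is_derive_comp cos theta1 0 _ _ (is_derive_cos _) D1).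
    assert (A2 : is_derive (fun t => cos (theta2 t)) 0 (l2 * - sin (theta2 0)))
      by exact (is_derive_comp cos theta2 0 _ _ (is_derive_cos _) D2).
    apply (is_derive_ext_loc _ (fun t => cos (theta2 t))) in A1;
      [|revert E; apply filter_imp; tauto].
    apply is_derive_unique in A1; apply is_derive_unique in A2; lra. }
  assert (C2 : cos (theta1 0) * l1 = cos (theta2 0) * l2).
  { assert (A1 : is_derive (fun t => sin (theta1 t)) 0 (l1 * cos (theta1 0)))
      by exact (is_derive_comp sin theta1 0 _ _ (is_derive_sin _) D1).
    assert (A2 : is_derive (fun t => sin (theta2 t)) 0 (l2 * cos (theta2 0)))
      by exact (is_derive_comp sin theta2 0 _ _ (is_derive_sin _) D2).
    apply (is_derive_ext_loc _ (fun t => sin (theta2 t))) in A1;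
      [|revert E; apply filter_imp; tauto].
    apply is_derive_unique in A1; apply is_derive_unique in A2; lra. }
  apply locally_singleton in E; destruct E as [E1 E2].
  rewrite E1 in C2; rewrite E2 in C1.
  pose proof (sin2_cos2 (theta2 0)) as S; unfold Rsqr in S.
  replace l1 with ((sin (theta2 0) * sin (theta2 0) + cos (theta2 0) * cos (theta2 0)) * l1)
    by (rewrite S; ring).
  replace l2 with ((sin (theta2 0) * sin (theta2 0) + cos (theta2 0) * cos (theta2 0)) * l2)
    by (rewrite S; ring).
  transitivity (- sin (theta2 0) * (- sin (theta2 0) * l1)
    + cos (theta2 0) * (cos (theta2 0) * l1)); [ring|].
  rewrite C1, C2; ring.
Qed.

End Holonomy.

(** * Lagrange multipliers *)

Section LagrangeMultipliers.
Context {X : Type} (add : X -> X -> X) (mul : R -> X -> X).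

(** The operations on [X] are seen only through the values of functionals, so fields can be combined
    pointwise without any reasoning about equality of functions. *)
Definition closed_under (V : X -> Prop) : Prop :=
  (forall u w, V u -> V w -> V (add u w)) /\ (forall k u, V u -> V (mul k u)).

Definition linear_on (V : X -> Prop) (f : X -> R) : Prop :=
  (forall u w, V u -> V w -> f (add u w) = f u + f w) /\
  (forall k u, V u -> f (mul k u) = k * f u).

Fixpoint lincomb (cs : list R) (gs : list (X -> R)) (u : X) : R :=
  match cs, gs with
  | c :: cs', g :: gs' => c * g u + lincomb cs' gs' u
  | _, _ => 0
  end.

Lemma linear_on_lincomb V gs cs :
  (forall g, In g gs -> linear_on V g) -> linear_on V (lincomb cs gs).
Proof.
  revert cs; induction gs as [|g gs IH]; intros [|c cs] Hg;
    try (split; intros; simpl; ring).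
  destruct (IH cs) as [I1 I2]; [intros; apply Hg; simpl; auto|].
  destruct (Hg g) as [G1 G2]; [simpl; auto|].
  split; intros; simpl; [rewrite I1, G1|rewrite I2, G2]; auto; ring.
Qed.

Lemma linear_on_subset (V W : X -> Prop) f :
  (forall u, W u -> V u) -> linear_on V f -> linear_on W f.
Proof. intros H [F1 F2]; split; auto. Qed.

(** If [g u0 <> 0], then subtracting [(g u / g u0) u0] moves [u] into the kernel of [g], where [f]
    vanishes. *)
Lemma lagrange_multiplier (V : X -> Prop) (f g : X -> R) :
  closed_under V -> linear_on V f -> linear_on V g ->
  (forall u, V u -> g u = 0 -> f u = 0) -> exists c, forall u, V u -> f u = c * g u.
Proof.
  intros [V1 V2] [F1 F2] [G1 G2] H.
  destruct (classic (exists u0, V u0 /\ g u0 <> 0)) as [(u0 & Hu0 & Hg0)|N].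
  - exists (f u0 / g u0); intros u Hu.
    assert (K : f (add u (mul (- (g u / g u0)) u0)) = 0).
    { apply H; auto; rewrite G1, G2 by auto; field; auto. }
    rewrite F1, F2 in K by auto.
    apply (Rplus_eq_reg_r (- (g u / g u0) * f u0)); rewrite K; field; auto.
  - exists 0; intros u Hu; rewrite Rmult_0_l; apply H; auto.
    destruct (Req_dec (g u) 0); auto; exfalso; eauto.
Qed.

(** Induction on the constraints: on the kernel of the head, the tail supplies coefficients; the
    difference [f - lincomb cs gs] then vanishes on that kernel and is a multiple of the head. *)
Lemma lagrange_multipliers (gs : list (X -> R)) : forall (V : X -> Prop) (f : X -> R),
  closed_under V -> linear_on V f -> (forall g, In g gs -> linear_on V g) ->
  (forall u, V u -> (forall g, In g gs -> g u = 0) -> f u = 0) ->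
  exists cs, length cs = length gs /\ forall u, V u -> f u = lincomb cs gs u.
Proof.
  induction gs as [|g gs IH]; intros V f HV Hf Hg H.
  { exists nil; split; auto; intros u Hu; apply H; auto; intros g []. }
  assert (Lg : linear_on V g) by (apply Hg; simpl; auto).
  assert (Lgs : forall h, In h gs -> linear_on V h) by (intros; apply Hg; simpl; auto).
  set (W := fun u => V u /\ g u = 0).
  assert (HW : closed_under W).
  { destruct HV as [V1 V2], Lg as [G1 G2]; split.
    - intros u w [Hu Eu] [Hw Ew]; split; auto; rewrite G1, Eu, Ew by auto; ring.
    - intros k u [Hu Eu]; split; auto; rewrite G2, Eu by auto; ring. }
  assert (WV : forall u, W u -> V u) by (intros u []; auto).
  destruct (IH W f HW) as (cs & Hlen & Hcs).
  - now apply (linear_on_subset V).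
  - intros; apply (linear_on_subset V); auto.
  - intros u [Hu Eu] Hgs; apply H; auto; intros h [<-|Hh]; auto.
  - pose proof (linear_on_lincomb V gs cs Lgs) as [L1 L2]; destruct (Hf) as [F1 F2].
    destruct (lagrange_multiplier V (fun u => f u - lincomb cs gs u) g HV) as (c & Hc); auto.
    + split; intros; simpl; [rewrite F1, L1|rewrite F2, L2]; auto; ring.
    + intros u Hu Eu; rewrite Hcs; [ring|split; auto].
    + exists (c :: cs); split; [simpl; auto|]; intros u Hu; simpl; rewrite <- Hc by auto; ring.
Qed.

End LagrangeMultipliers.

(** * Compactly supported fields *)

Lemma test_field_end a b v x : a < b -> test_field a b v -> x = a \/ x = b ->
  v x = (0)%R3 /\ Derive_on3 a b v x = (0)%R3.
Proof.
  intros Hab (Hv & c & d & Hc & Hd & E) Hx; split; [apply E; lra|].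
  assert (Hx' : a <= x <= b) by lra.
  assert (Z : Derive_on3 a b (fun _ => (0)%R3) x = (0)%R3)
    by (apply Derive_on3_eq; auto; now apply is_derive_on3_const).
  rewrite <- Z; apply Derive_on3_ext_loc; auto; [now apply smooth_on3_const|].
  destruct Hx; subst x.
  - apply (locally_interval _ a m_infty c); simpl; auto.
    intros y _ Hy Hyab; symmetry; apply E; simpl in Hy; lra.
  - apply (locally_interval _ b d p_infty); simpl; auto.
    intros y Hy _ Hyab; symmetry; apply E; simpl in Hy; lra.
Qed.

Lemma test_field_derive a b v : a < b -> test_field a b v -> test_field a b (Derive_on3 a b v).
Proof.
  intros Hab (Hv & c & d & Hc & Hd & E); split; [now apply smooth_on3_derive|].
  exists c, d; split; [auto|split; [auto|]]; intros x Hx Hout.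
  assert (Z : Derive_on3 a b (fun _ => (0)%R3) x = (0)%R3)
    by (apply Derive_on3_eq; auto; now apply is_derive_on3_const).
  rewrite <- Z; apply Derive_on3_ext_loc; auto; [now apply smooth_on3_const|].
  destruct Hout.
  - apply (locally_interval _ x m_infty c); simpl; auto.
    intros y _ Hy Hyab; symmetry; apply E; simpl in Hy; lra.
  - apply (locally_interval _ x d p_infty); simpl; auto.
    intros y Hy _ Hyab; symmetry; apply E; simpl in Hy; lra.
Qed.

(** To the right of the support, the primitive from [a] equals the total integral; the three zero
    means make it vanish there. This turns fields [u] with zero mean into derivatives of test
    fields. *)
Lemma test_field_primitive a b u : a < b -> test_field a b u ->
  RInt (comp1 u) a b = 0 -> RInt (comp2 u) a b = 0 -> RInt (comp3 u) a b = 0 ->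
  exists v, test_field a b v /\ forall x, a <= x <= b -> Derive_on3 a b v x = u x.
Proof.
  intros Hab (Hu & c & d & Hc & Hd & E) I1 I2 I3.
  assert (K : forall f : R -> R, smooth_on a b f ->
    (forall x, a <= x <= b -> x < c \/ d < x -> f x = 0) -> RInt f a b = 0 ->
    forall x, a <= x <= b -> x < c \/ d < x -> RInt f a x = 0).
  { intros f Hf Ef If x Hx Hout.
    assert (Z : forall p q, p <= q -> (forall y, p < y < q -> f y = 0) -> RInt f p q = 0).
    { intros p q Hpq Hy; rewrite (RInt_ext f (fun _ => 0)).
      - rewrite RInt_const; unfold scal; simpl; unfold mult; simpl; ring.
      - rewrite Rmin_left, Rmax_right by lra; auto. }
    destruct Hout.
    - apply Z; [lra|]; intros; apply Ef; lra.
    - assert (Ch : RInt f a x + RInt f x b = RInt f a b).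
      { apply (RInt_Chasles (V := R_CompleteNormedModule) f);
          apply (ex_RInt_ccont a b); try lra; now apply smooth_on_ccont. }
      rewrite (Z x b), If in Ch; [lra|lra|]; intros; apply Ef; lra. }
  destruct Hu as (U1 & U2 & U3).
  exists (fun x => (RInt (comp1 u) a x, RInt (comp2 u) a x, RInt (comp3 u) a x)); split.
  - split.
    + split; [|split].
      * now apply (smooth_on_RInt a b Hab (comp1 u)).
      * now apply (smooth_on_RInt a b Hab (comp2 u)).
      * now apply (smooth_on_RInt a b Hab (comp3 u)).
    + exists c, d; split; [auto|split; [auto|]]; intros x Hx Hout.
      rewrite !K; auto; intros; unfold comp1, comp2, comp3; rewrite E; auto.
  - intros x Hx; apply Derive_on3_eq; auto; split; [|split].
    + apply (is_derive_on_RInt a b Hab (comp1 u)); auto; now apply smooth_on_ccont.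
    + apply (is_derive_on_RInt a b Hab (comp2 u)); auto; now apply smooth_on_ccont.
    + apply (is_derive_on_RInt a b Hab (comp3 u)); auto; now apply smooth_on_ccont.
Qed.

(** * Straight-line variations and the fundamental lemma *)

Lemma Ck_rect_ext k c d a b F G : c < d -> a < b ->
  (forall t x, c <= t <= d -> a <= x <= b -> F t x = G t x) ->
  Ck_rect k c d a b F -> Ck_rect k c d a b G.
Proof.
  intros Hcd Hab; revert F G; induction k as [|k IH]; intros F G E H;
    destruct H as (H1 & H2).
  - split; auto; revert H1; apply continuous_on_ext; intros [t x] [Ht Hx]; auto.
  - destruct H2 as (H2 & H3 & H4); split; [|split; [|split]].
    + revert H1; apply continuous_on_ext; intros [t x] [Ht Hx]; auto.
    + intros t x Ht Hx; destruct (H2 t x Ht Hx) as [[l1 L1] [l2 L2]]; split.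
      * exists l1; apply (is_derive_on_ext c d (fun s => F s x)); auto.
      * exists l2; apply (is_derive_on_ext a b (F t)); auto.
    + revert H3; apply IH; intros t x Ht Hx; symmetry; apply Derive_on_eq; auto.
      apply (is_derive_on_ext c d (fun s => F s x)); auto.
      apply Derive_on_correct; auto; now apply H2.
    + revert H4; apply IH; intros t x Ht Hx; symmetry; apply Derive_on_eq; auto.
      apply (is_derive_on_ext a b (F t)); auto.
      apply Derive_on_correct; auto; now apply H2.
Qed.

(** The class [g + t w] is closed under both partial derivatives: they are [w + t 0] and
    [g' + t w'], which drives the induction for arbitrary [g] and [w]. *)
Lemma Ck_rect_affine k c d a b g w : c < d -> a < b -> smooth_on a b g -> smooth_on a b w ->
  Ck_rect k c d a b (fun t x => g x + t * w x).
Proof.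
  intros Hcd Hab; revert g w; induction k as [|k IH]; intros g w Hg Hw.
  all: assert (Hc : continuous_on (fun p : R * R => c <= fst p <= d /\ a <= snd p <= b)
    (fun p : R * R => g (snd p) + fst p * w (snd p))).
  1, 3: apply (continuous_on_ext _
      (fun p : R * R => g (clamp a b (snd p)) + fst p * w (clamp a b (snd p))));
      [intros [t x] [_ Hx]; simpl in *; rewrite clamp_id; auto|];
    apply continuous_on_forall; intros p _;
    apply (continuous_plus (fun p : R * R => g (clamp a b (snd p))));
      [apply (continuous_comp (fun p : R * R => snd p) (fun y => g (clamp a b y)));
        [apply continuous_snd|now apply smooth_on_ccont]|];
    apply (continuous_mult (fun p : R * R => fst p)); [apply continuous_fst|];
    apply (continuous_comp (fun p : R * R => snd p) (fun y => w (clamp a b y)));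
      [apply continuous_snd|now apply smooth_on_ccont].
  - split; auto.
  - assert (D1 : forall t x, c <= t <= d -> is_derive_on c d (fun s => g x + s * w x) t (w x)).
    { intros t x Ht; eapply is_derive_on_eq; [apply is_derive_on_plus; auto;
        [apply is_derive_on_const; auto|apply (is_derive_on_mult c d (fun s => s)); auto;
          [apply is_derive_on_id; auto|apply is_derive_on_const; auto]]|simpl; ring]. }
    assert (D2 : forall t x, a <= x <= b -> is_derive_on a b (fun x => g x + t * w x) x
      (Derive_on a b g x + t * Derive_on a b w x)).
    { intros t x Hx; eapply is_derive_on_eq; [apply is_derive_on_plus; auto;
        [now apply smooth_on_is_derive_on|apply (is_derive_on_mult a b (fun _ => t)); auto;
          [apply is_derive_on_const; auto|now apply smooth_on_is_derive_on]]|simpl; ring]. }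
    split; [exact Hc|split; [|split]].
    + intros t x Ht Hx; split; eexists; eauto.
    + apply (Ck_rect_ext k c d a b (fun t x => w x + t * (fun _ => 0) x)); auto.
      * intros t x Ht Hx; symmetry; apply Derive_on_eq; auto.
        eapply is_derive_on_eq; [apply D1; auto|ring].
      * apply IH; auto; now apply smooth_on_const.
    + apply (Ck_rect_ext k c d a b (fun t x => Derive_on a b g x + t * Derive_on a b w x)); auto.
      * intros t x Ht Hx; symmetry; apply Derive_on_eq; auto.
      * apply IH; now apply smooth_on_derive.
Qed.

Lemma linear_variation a b gamma v : a < b -> curve a b gamma ->
  arclength_parametrized a b gamma -> test_field a b v ->
  (forall x, a <= x <= b -> dot (Derive_on3 a b v x) (Derive_on3 a b gamma x) = 0) ->
  compactly_supported_variation a b gamma 1 (fun t x => gamma x + t *: v x)%R3 /\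
  forall x, variational_field (fun t x => gamma x + t *: v x)%R3 x = v x.
Proof.
  intros Hab Hg Harc (Hv & c & d & Hc & Hd & E) Hort; split.
  - split; [split; [lra|split; [|split]]|].
    + destruct Hg as [(G1 & G2 & G3) _], Hv as (V1 & V2 & V3).
      intros k; split; [|split].
      * apply (Ck_rect_affine k _ _ a b (comp1 gamma) (comp1 v)); auto; lra.
      * apply (Ck_rect_affine k _ _ a b (comp2 gamma) (comp2 v)); auto; lra.
      * apply (Ck_rect_affine k _ _ a b (comp3 gamma) (comp3 v)); auto; lra.
    + intros t Ht.
      assert (S : smooth_on3 a b (fun x => gamma x + t *: v x)%R3).
      { apply smooth_on3_plus; auto; [apply Hg|].
        apply (smooth_on3_scal a b Hab (fun _ => t)); auto; now apply smooth_on_const. }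
      split; auto; intros x Hx H0.
      assert (D : Derive_on3 a b (fun x => gamma x + t *: v x)%R3 x =
        (Derive_on3 a b gamma x + (0%R *: v x + t *: Derive_on3 a b v x))%R3).
      { apply Derive_on3_eq; auto; apply is_derive_on3_plus; auto.
        - apply smooth_on3_is_derive_on3; auto; apply Hg.
        - apply (is_derive_on3_scal a b (fun _ => t)); auto;
            [now apply is_derive_on_const|now apply smooth_on3_is_derive_on3]. }
      rewrite D in H0.
      (* The component of [gamma' + t v'] along [gamma'] is 1 for every [t], so each curve of the
         family is regular; the bound 1 on [t] is an arbitrary choice. *)
      assert (K : dot (Derive_on3 a b gamma x + (0%R *: v x + t *: Derive_on3 a b v x))%R3
        (Derive_on3 a b gamma x) = 1).
      { transitivity (dot (Derive_on3 a b gamma x) (Derive_on3 a b gamma x)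
          + t * dot (Derive_on3 a b v x) (Derive_on3 a b gamma x)); [vec|].
        rewrite Hort by auto; rewrite <- norm3_sqr, Harc by auto; ring. }
      rewrite H0 in K; autorewrite with vec in K; lra.
    + intros x Hx; vec.
    + exists c, d; split; [auto|split; [auto|]].
      intros t x _ Hx Hout; rewrite E by auto; vec.
  - intros x; unfold variational_field; apply R3_ext; autorewrite with vec;
      apply is_derive_unique.
    + apply (is_derive_ext (fun t => coord1 (gamma x) + t * coord1 (v x)));
        [reflexivity|auto_derive; auto; ring].
    + apply (is_derive_ext (fun t => coord2 (gamma x) + t * coord2 (v x)));
        [reflexivity|auto_derive; auto; ring].
    + apply (is_derive_ext (fun t => coord3 (gamma x) + t * coord3 (v x)));
        [reflexivity|auto_derive; auto; ring].
Qed.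

Lemma exists_unit_normal (T : R3) : exists W, dot W W = 1 /\ dot W T = 0.
Proof.
  destruct T as [[t1 t2] t3].
  destruct (Req_dec (t1 * t1 + t2 * t2) 0) as [Z|N].
  - exists (1, 0, 0); simpl; split; [ring|nra].
  - assert (P : 0 < t1 * t1 + t2 * t2) by nra.
    assert (Q : sqrt (t1 * t1 + t2 * t2) * sqrt (t1 * t1 + t2 * t2) = t1 * t1 + t2 * t2)
      by (apply sqrt_sqrt; lra).
    assert (0 < sqrt (t1 * t1 + t2 * t2)) by now apply sqrt_lt_R0.
    set (s := sqrt _) in *.
    exists (- t2 / s, t1 / s, 0); simpl; split; [|field; lra].
    transitivity ((t1 * t1 + t2 * t2) / (s * s)); [field; lra|rewrite Q; field; lra].
Qed.

(** The test field is a bump function times the normal part [N] of [K], for which [<K, N> = |N|^2].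
    End points follow by continuity. *)
Lemma normal_fundamental_lemma a b (T K : R -> R3) : a < b -> smooth_on3 a b T ->
  smooth_on3 a b K -> (forall x, a <= x <= b -> dot (T x) (T x) = 1) ->
  (forall u, test_field a b u -> (forall x, a <= x <= b -> dot (u x) (T x) = 0) ->
     RInt (fun x => dot (K x) (u x)) a b = 0) ->
  forall x, a <= x <= b -> (K x - dot (K x) (T x) *: T x = 0)%R3.
Proof.
  intros Hab HT HK HT1 H.
  set (N := fun x => (K x - dot (K x) (T x) *: T x)%R3).
  assert (SN : smooth_on3 a b N).
  { apply smooth_on3_minus; auto; apply smooth_on3_scal; auto; now apply smooth_on3_dot. }
  assert (SNN : smooth_on a b (fun x => dot (N x) (N x))) by now apply smooth_on3_dot.
  assert (Hin : forall x, a < x < b -> dot (N x) (N x) = 0).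
  { intros x Hx.
    (* The midpoints towards [a] and [b] enclose [x] and keep the support away from the end
       points. *)
    destruct (bump_exists a b ((a + x) / 2) ((x + b) / 2) Hab) as (phi & Sphi & P0 & P1 & P2).
    assert (Ku : forall y, a <= y <= b ->
      dot (K y) (phi y *: N y)%R3 = phi y * dot (N y) (N y)).
    { intros y Hy; unfold N; transitivity (phi y * dot (K y) (N y)); [unfold N; vec|].
      unfold N; transitivity (phi y * (dot (K y) (K y) - dot (K y) (T y) * dot (K y) (T y)));
        [vec|].
      transitivity (phi y * (dot (K y) (K y) - 2 * (dot (K y) (T y) * dot (K y) (T y))
        + dot (K y) (T y) * dot (K y) (T y) * dot (T y) (T y)));
        [rewrite HT1 by auto; ring|vec]. }
    assert (I : RInt (fun y => phi y * dot (N y) (N y)) a b = 0).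
    { rewrite <- (H (fun y => phi y *: N y)%R3).
      - apply RInt_ext; rewrite Rmin_left, Rmax_right by lra; intros y Hy.
        symmetry; apply Ku; lra.
      - split; [now apply smooth_on3_scal|].
        exists ((a + x) / 2), ((x + b) / 2); split; [lra|split; [lra|]].
        intros y Hy Hout; rewrite P2 by lra; vec.
      - intros y Hy; unfold N.
        transitivity (phi y * dot (K y) (T y) * (1 - dot (T y) (T y))); [vec|].
        rewrite HT1 by auto; ring. }
    assert (Z : phi x * dot (N x) (N x) = 0).
    { apply (RInt_nonneg_eq0 a b Hab (fun y => phi y * dot (N y) (N y))); auto; try lra.
      - apply smooth_on_ccont; auto; now apply smooth_on_mult.
      - intros y Hy; apply Rmult_le_pos; auto; apply dot_self_ge0. }
    specialize (P1 x ltac:(lra)); apply Rmult_integral in Z; lra. }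
  intros x Hx; apply dot_self_eq0.
  apply (ccont_zero_interior a b Hab (fun x => dot (N x) (N x))); auto.
  now apply smooth_on_ccont.
Qed.

(** * The Euler-Lagrange equation *)

Lemma is_derive_on3_zero_const a b h : a < b ->
  (forall x, a <= x <= b -> is_derive_on3 a b h x (0)%R3) ->
  forall x, a <= x <= b -> h x = h a.
Proof.
  intros Hab H x Hx; apply R3_ext.
  - apply (is_derive_on_zero_const a b Hab (comp1 h)); auto; intros; now apply H.
  - apply (is_derive_on_zero_const a b Hab (comp2 h)); auto; intros; now apply H.
  - apply (is_derive_on_zero_const a b Hab (comp3 h)); auto; intros; now apply H.
Qed.

Lemma RInt_dot_linear_on a b (w : R -> R3) (V : (R -> R3) -> Prop) : a < b ->
  smooth_on3 a b w -> (forall u, V u -> smooth_on3 a b u) ->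
  linear_on (fun u w x => u x + w x)%R3 (fun k u x => k *: u x)%R3 V
    (fun u : R -> R3 => RInt (fun x => dot (w x) (u x)) a b).
Proof.
  intros Hab Hw HV; split.
  - intros u1 u2 H1 H2.
    assert (I : forall u, V u -> ex_RInt (fun x => dot (w x) (u x)) a b).
    { intros u Hu; apply (ex_RInt_ccont a b); try lra; apply smooth_on_ccont; auto.
      apply smooth_on3_dot; auto. }
    etransitivity;
      [|exact (RInt_plus (V := R_CompleteNormedModule) _ _ a b (I u1 H1) (I u2 H2))].
    apply RInt_ext; intros x _.
    change (dot (w x) (u1 x + u2 x)%R3 = dot (w x) (u1 x) + dot (w x) (u2 x)); vec.
  - intros k u Hu.
    assert (I : ex_RInt (fun x => dot (w x) (u x)) a b).
    { apply (ex_RInt_ccont a b); try lra; apply smooth_on_ccont; auto.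
      apply smooth_on3_dot; auto. }
    etransitivity; [|exact (RInt_scal (V := R_CompleteNormedModule) _ a b k I)].
    apply RInt_ext; intros x _.
    change (dot (w x) (k *: u x)%R3 = k * dot (w x) (u x)); vec.
Qed.

Section EulerLagrange.
Context (a b : R) (hab : a < b) (gamma : R -> R3) (hgamma : curve a b gamma).
Context (harc : arclength_parametrized a b gamma).
Context (rho : R -> R) (hrho : stiffness a b rho).

Let T := Derive_on3 a b gamma.
Let T' := Derive_on3 a b T.
Let T'' := Derive_on3 a b T'.
Let rho' := Derive_on a b rho.

(** The expanded derivative of [rho T']. *)
Let F (x : R) : R3 := (rho x *: T'' x + rho' x *: T' x)%R3.

Lemma gamma'_smooth : smooth_on3 a b T. Proof. apply smooth_on3_derive, hgamma. Qed.
Lemma gamma''_smooth : smooth_on3 a b T'. Proof. apply smooth_on3_derive, gamma'_smooth. Qed.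
Lemma gamma'''_smooth : smooth_on3 a b T''. Proof. apply smooth_on3_derive, gamma''_smooth. Qed.

Lemma is_derive_gamma x : a <= x <= b -> is_derive_on3 a b gamma x (T x).
Proof. intros; apply smooth_on3_is_derive_on3; auto; apply hgamma. Qed.
Lemma is_derive_gamma' x : a <= x <= b -> is_derive_on3 a b T x (T' x).
Proof. intros; apply smooth_on3_is_derive_on3; auto; apply gamma'_smooth. Qed.
Lemma is_derive_gamma'' x : a <= x <= b -> is_derive_on3 a b T' x (T'' x).
Proof. intros; apply smooth_on3_is_derive_on3; auto; apply gamma''_smooth. Qed.
Lemma is_derive_rho x : a <= x <= b -> is_derive_on a b rho x (rho' x).
Proof. intros; apply smooth_on_is_derive_on; auto; apply hrho. Qed.

Lemma gamma'_unit x : a <= x <= b -> dot (T x) (T x) = 1.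
Proof. intros; apply norm3_eq1; now apply harc. Qed.

Lemma gamma'_gamma''_orthogonal x : a <= x <= b -> dot (T' x) (T x) = 0.
Proof.
  intros Hx; rewrite dot_comm; apply (dot_T_dT a b hab T gamma'_smooth); auto.
  exact gamma'_unit.
Qed.

Lemma F_smooth : smooth_on3 a b F.
Proof.
  apply smooth_on3_plus; auto; apply smooth_on3_scal; auto.
  - apply hrho.
  - apply gamma'''_smooth.
  - apply smooth_on_derive, hrho.
  - apply gamma''_smooth.
Qed.

Lemma bending_by_parts u : test_field a b u ->
  RInt (fun x => rho x * dot (T' x) (Derive_on3 a b u x)) a b =
  - RInt (fun x => dot (F x) (u x)) a b.
Proof.
  intros Hu; pose proof (proj1 Hu) as Su.
  assert (SF : smooth_on a b (fun x => dot (F x) (u x)))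
    by (apply smooth_on3_dot; auto; apply F_smooth).
  assert (SR : smooth_on a b (fun x => rho x * dot (T' x) (Derive_on3 a b u x))).
  { apply smooth_on_mult; auto; [apply hrho|].
    apply smooth_on3_dot; auto; [apply gamma''_smooth|now apply smooth_on3_derive]. }
  assert (K : RInt (fun x => dot (F x) (u x) + rho x * dot (T' x) (Derive_on3 a b u x)) a b = 0).
  { rewrite (RInt_derive_on a b hab (fun x => dot (rho x *: T' x)%R3 (u x))); try lra.
    - rewrite (proj1 (test_field_end a b u a hab Hu (or_introl eq_refl))).
      rewrite (proj1 (test_field_end a b u b hab Hu (or_intror eq_refl))).
      vec.
    - intros y Hy; eapply is_derive_on_eq.
      + apply is_derive_on3_dot; [auto| |apply smooth_on3_is_derive_on3; auto].
        apply is_derive_on3_scal; [auto|apply is_derive_rho; auto|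
          apply is_derive_gamma''; auto].
      + unfold F; vec.
    - apply smooth_on_ccont; auto; now apply smooth_on_plus. }
  assert (E : RInt (fun x => dot (F x) (u x) + rho x * dot (T' x) (Derive_on3 a b u x)) a b =
    RInt (fun x => dot (F x) (u x)) a b +
    RInt (fun x => rho x * dot (T' x) (Derive_on3 a b u x)) a b).
  { apply (RInt_plus (V := R_CompleteNormedModule)); apply (ex_RInt_ccont a b); try lra;
      now apply smooth_on_ccont. }
  lra.
Qed.

Lemma elastic_first_variation v : holonomy_constrained_elastic a b rho gamma ->
  test_field a b v -> (forall x, a <= x <= b -> dot (Derive_on3 a b v x) (T x) = 0) ->
  RInt (fun x => dot (Derive_on3 a b v x) (T x >< T' x)%R3) a b = 0 ->
  RInt (fun x => dot (F x) (Derive_on3 a b v x)) a b = 0.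
Proof.
  intros H1 Hv Hort HH.
  destruct (exists_unit_normal (T a)) as (Wa & Wa1 & WaT).
  destruct (exists_unit_normal (T b)) as (Wb & Wb1 & WbT).
  assert (UWa : unit_normal a b gamma a Wa).
  { split; [now apply norm3_eq1|rewrite tangent_arclength by (auto; lra); auto]. }
  assert (UWb : unit_normal a b gamma b Wb).
  { split; [now apply norm3_eq1|rewrite tangent_arclength by (auto; lra); auto]. }
  destruct (linear_variation a b gamma v hab hgamma harc Hv Hort) as [HG HGv].
  assert (Hhol : is_d_holonomy a b Wa Wb gamma v 0).
  { intros eps G HG' HGv'.
    destruct (holonomy_variation a b hab gamma hgamma harc eps G HG' v HGv' Hort
      Wa Wb UWa UWb) as (theta & Ht1 & Ht2).
    exists theta; split; auto; fold T T' in Ht2; rewrite HH, Ropp_0 in Ht2; exact Ht2. }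
  pose proof (H1 Wa Wb UWa UWb v Hv Hort Hhol 1 _ HG (fun x _ => HGv x)) as D1.
  pose proof (is_derive_bending_energy a b hab gamma hgamma harc 1 _ HG v (proj1 Hv)
    (fun x _ => HGv x) Hort rho (proj1 hrho)) as D2.
  apply is_derive_unique in D1; apply is_derive_unique in D2.
  fold T T' in D2; rewrite D1 in D2.
  rewrite (bending_by_parts (Derive_on3 a b v)) in D2 by now apply test_field_derive.
  lra.
Qed.

Lemma elastic_equation : holonomy_constrained_elastic a b rho gamma ->
  exists (mu : R) (va : R3), forall x, a <= x <= b ->
    (rho x *: T'' x - (rho x * dot (T'' x) (T x)) *: T x + rho' x *: T' x
     + va - dot va (T x) *: T x - mu *: (T x >< T' x) = 0)%R3.
Proof.
  intros H1.
  set (V := fun u => test_field a b u /\ forall x, a <= x <= b -> dot (u x) (T x) = 0).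
  set (I := fun (w u : R -> R3) => RInt (fun x => dot (w x) (u x)) a b).
  set (e1 := fun _ : R => (1, 0, 0)); set (e2 := fun _ : R => (0, 1, 0)).
  set (e3 := fun _ : R => (0, 0, 1)); set (B := fun x => (T x >< T' x)%R3).
  assert (SB : smooth_on3 a b B)
    by (apply smooth_on3_cross; auto; [apply gamma'_smooth|apply gamma''_smooth]).
  assert (VS : forall u, V u -> smooth_on3 a b u) by (intros u [[]]; auto).
  (* The functionals of [e1], [e2], [e3] are the components of the integral of [u]: their vanishing
     makes [u] the derivative of a test field. The functional of [B] is the holonomy rate up to
     sign. *)
  destruct (lagrange_multipliers (fun u w x => u x + w x)%R3 (fun k u x => k *: u x)%R3
    (I e1 :: I e2 :: I e3 :: I B :: nil) V (I F)) as (cs & Hlen & Hcs).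
  - split.
    + intros u w [(Su & c & d & Hc & Hd & Eu) Nu] [(Sw & c' & d' & Hc' & Hd' & Ew) Nw].
      split; [split|].
      * apply (smooth_on3_plus a b hab u w Su Sw).
      * exists (Rmin c c'), (Rmax d d').
        split; [now apply Rmin_glb_lt|split; [now apply Rmax_lub_lt|]].
        intros x Hx Hout.
        pose proof (Rmin_l c c'); pose proof (Rmin_r c c').
        pose proof (Rmax_l d d'); pose proof (Rmax_r d d').
        change (u x + w x = 0)%R3; rewrite Eu, Ew by lra; vec.
      * intros x Hx; change (dot (u x + w x)%R3 (T x) = 0).
        transitivity (dot (u x) (T x) + dot (w x) (T x)); [vec|].
        rewrite Nu, Nw by auto; ring.
    + intros k u [(Su & c & d & Hc & Hd & Eu) Nu]; split; [split|].
      * apply (smooth_on3_scal a b hab (fun _ => k) u); auto; now apply smooth_on_const.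
      * exists c, d; split; [auto|split; [auto|]]; intros x Hx Hout.
        change (k *: u x = 0)%R3; rewrite Eu by auto; vec.
      * intros x Hx; change (dot (k *: u x)%R3 (T x) = 0).
        transitivity (k * dot (u x) (T x)); [vec|rewrite Nu by auto; ring].
  - apply RInt_dot_linear_on; auto; apply F_smooth.
  - intros g Hg; repeat destruct Hg as [<-|Hg]; try now destruct Hg.
    + apply RInt_dot_linear_on; auto; now apply smooth_on3_const.
    + apply RInt_dot_linear_on; auto; now apply smooth_on3_const.
    + apply RInt_dot_linear_on; auto; now apply smooth_on3_const.
    + now apply RInt_dot_linear_on.
  - intros u [Hu Nu] Hg.
    assert (Z : forall w (f : R -> R), In (I w) (I e1 :: I e2 :: I e3 :: I B :: nil) ->
      (forall x, f x = dot (w x) (u x)) -> RInt f a b = 0).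
    { intros w f Hw Ef; rewrite <- (Hg _ Hw); apply RInt_ext; auto. }
    destruct (test_field_primitive a b u hab Hu) as (v & Hv & Ev).
    + apply (Z e1); [simpl; auto|]; intros x; unfold e1, comp1; vec.
    + apply (Z e2); [simpl; auto|]; intros x; unfold e2, comp2; vec.
    + apply (Z e3); [simpl; auto|]; intros x; unfold e3, comp3; vec.
    + unfold I; rewrite <- (elastic_first_variation v H1 Hv).
      * apply RInt_ext; rewrite Rmin_left, Rmax_right by lra; intros x Hx.
        rewrite Ev by lra; auto.
      * intros x Hx; rewrite Ev by auto; auto.
      * transitivity (RInt (fun x => dot (u x) (T x >< T' x)%R3) a b).
        -- apply RInt_ext; rewrite Rmin_left, Rmax_right by lra; intros x Hx.
           rewrite Ev by lra; auto.
        -- apply (Z B); [simpl; auto 6|]; intros x; apply dot_comm.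
  - destruct cs as [|c1 [|c2 [|c3 [|c4 [|]]]]]; try discriminate Hlen.
    (* The multipliers make the integral of [<K, u>] zero for every normal test field, so [K] is
       purely tangential; the constant vector enters (3) with the opposite sign. *)
    set (K := fun x => (F x - (c1, c2, c3) - c4 *: B x)%R3).
    assert (SK : smooth_on3 a b K).
    { apply smooth_on3_minus; auto; [apply smooth_on3_minus; auto;
        [apply F_smooth|now apply smooth_on3_const]|].
      apply (smooth_on3_scal a b hab (fun _ => c4)); auto; now apply smooth_on_const. }
    pose proof (normal_fundamental_lemma a b T K hab gamma'_smooth SK gamma'_unit) as HK.
    exists c4, (- c1, - c2, - c3); intros x Hx; rewrite <- (HK) with (x := x); auto.
    + pose proof (gamma'_gamma''_orthogonal x Hx) as N.
      (* The left side of (3) is the normal part of [K]: the added term [rho' <T', T>] is zero, and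
         [B] has no tangential component. *)
      transitivity (K x - (rho x * dot (T'' x) (T x) + rho' x * dot (T' x) (T x)
        + dot (- c1, - c2, - c3) (T x)) *: T x)%R3.
      * rewrite N; unfold K, F, B; vec.
      * f_equal; f_equal; unfold K, F, B; vec.
    + intros u Hu Nu.
      assert (E : RInt (fun y => dot (K y) (u y)) a b =
        I F u - lincomb (c1 :: c2 :: c3 :: c4 :: nil) (I e1 :: I e2 :: I e3 :: I B :: nil) u).
      { assert (J : forall w, smooth_on3 a b w ->
          ex_RInt (fun y => dot (w y) (u y)) a b).
        { intros w Sw; apply (ex_RInt_ccont a b); try lra; apply smooth_on_ccont; auto.
          apply smooth_on3_dot; auto; apply Hu. }
        pose proof (is_RInt_plus (V := R_NormedModule)) as P.
        pose proof (is_RInt_scal (V := R_NormedModule)) as Q.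
        assert (J' : forall w, smooth_on3 a b w ->
          is_RInt (fun y => dot (w y) (u y)) a b (I w u)).
        { intros w Sw; apply (RInt_correct (V := R_CompleteNormedModule)); auto. }
        pose proof (J' F F_smooth) as JF.
        pose proof (Q _ _ _ (- c1) _ (J' e1 (smooth_on3_const a b hab (1, 0, 0)))) as J1.
        pose proof (Q _ _ _ (- c2) _ (J' e2 (smooth_on3_const a b hab (0, 1, 0)))) as J2.
        pose proof (Q _ _ _ (- c3) _ (J' e3 (smooth_on3_const a b hab (0, 0, 1)))) as J3.
        pose proof (Q _ _ _ (- c4) _ (J' B SB)) as J4.
        pose proof (P _ _ _ _ _ _ JF (P _ _ _ _ _ _ J1 (P _ _ _ _ _ _ J2
          (P _ _ _ _ _ _ J3 J4)))) as J5.
        apply (is_RInt_unique (V := R_CompleteNormedModule)) in J5.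
        transitivity (I F u + (- c1 * I e1 u + (- c2 * I e2 u + (- c3 * I e3 u + - c4 * I B u))));
          [|simpl; ring].
        etransitivity; [|exact J5]; apply RInt_ext; intros y _.
        change (dot (K y) (u y) = dot (F y) (u y) + (- c1 * dot (e1 y) (u y) +
          (- c2 * dot (e2 y) (u y) + (- c3 * dot (e3 y) (u y) + - c4 * dot (B y) (u y))))).
        unfold K, e1, e2, e3; vec. }
      rewrite E, <- Hcs by (split; auto); real_eq; ring.
Qed.

(** The constraint provides some lift with rate 0, and by uniqueness of the rate the integral of
    [<v', T x T'>] vanishes. Pairing the equation with [v'] removes the multiples of [T], and the
    constant vector integrates to a boundary term of [v], which is zero. *)
Lemma equation_elastic (Lambda : R -> R) (mu : R) (va : R3) : (forall x, a <= x <= b ->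
    (rho x *: T'' x + (3 / 2 * rho x * dot (T' x) (T' x)) *: T x
     + rho' x *: T' x - Lambda x *: T x - mu *: (T x >< T' x) + va = 0)%R3) ->
  holonomy_constrained_elastic a b rho gamma.
Proof.
  intros H Wa Wb UWa UWb v Hv Hort Hhol eps G HG HGv.
  destruct (Hhol eps G HG HGv) as (th1 & L1 & D1).
  destruct (holonomy_variation a b hab gamma hgamma harc eps G HG v HGv Hort
    Wa Wb UWa UWb) as (th2 & L2 & D2).
  pose proof (holonomy_rate_unique a b hab gamma hgamma harc eps G HG Wa Wb UWb
    th1 th2 _ _ L1 L2 D1 D2) as HH; fold T T' in HH.
  pose proof (is_derive_bending_energy a b hab gamma hgamma harc eps G HG v (proj1 Hv)
    HGv Hort rho (proj1 hrho)) as D.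
  fold T T' in D; rewrite (bending_by_parts (Derive_on3 a b v)) in D
    by now apply test_field_derive.
  set (v' := Derive_on3 a b v) in *.
  pose proof (proj1 Hv) as Sv.
  assert (Dv : forall x, a <= x <= b -> is_derive_on3 a b v x (v' x))
    by (intros; now apply smooth_on3_is_derive_on3).
  assert (SB : smooth_on a b (fun x => mu * dot (v' x) (T x >< T' x)%R3)).
  { apply smooth_on_mult; auto; [now apply smooth_on_const|].
    apply smooth_on3_dot; auto; [now apply smooth_on3_derive|].
    apply smooth_on3_cross; auto; [apply gamma'_smooth|apply gamma''_smooth]. }
  assert (SA : smooth_on a b (fun x => -1 * dot va (v' x))).
  { apply smooth_on_mult; auto; [now apply smooth_on_const|].
    apply (smooth_on3_dot a b hab (fun _ => va)); auto;
      [now apply smooth_on3_const|now apply smooth_on3_derive]. }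
  assert (EF : RInt (fun x => dot (F x) (v' x)) a b =
    RInt (fun x => mu * dot (v' x) (T x >< T' x)%R3 + -1 * dot va (v' x)) a b).
  { apply RInt_ext; rewrite Rmin_left, Rmax_right by lra; intros x Hx.
    assert (Hx' : a <= x <= b) by lra.
    pose proof (f_equal (fun z => dot z (v' x)) (H x Hx')) as K; simpl in K.
    specialize (Hort x Hx'); fold T in Hort.
    transitivity (dot (rho x *: T'' x + (3 / 2 * rho x * dot (T' x) (T' x)) *: T x
      + rho' x *: T' x - Lambda x *: T x - mu *: (T x >< T' x) + va)%R3 (v' x)
      - (3 / 2 * rho x * dot (T' x) (T' x) - Lambda x) * dot (v' x) (T x)
      + (mu * dot (v' x) (T x >< T' x)%R3 + -1 * dot va (v' x))).
    - generalize (dot (T' x) (T' x)); intros r; unfold F; vec.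
    - rewrite (H x Hx'), Hort; real_eq.
      autorewrite with vec; ring. }
  assert (E1 : RInt (fun x => mu * dot (v' x) (T x >< T' x)%R3 + -1 * dot va (v' x)) a b =
    RInt (fun x => mu * dot (v' x) (T x >< T' x)%R3) a b + RInt (fun x => -1 * dot va (v' x)) a b).
  { apply (RInt_plus (V := R_CompleteNormedModule)); apply (ex_RInt_ccont a b); try lra;
      now apply smooth_on_ccont. }
  assert (E2 : RInt (fun x => mu * dot (v' x) (T x >< T' x)%R3) a b =
    mu * RInt (fun x => dot (v' x) (T x >< T' x)%R3) a b).
  { apply (RInt_scal (V := R_CompleteNormedModule) (fun x => dot (v' x) (T x >< T' x)%R3)).
    apply (ex_RInt_ccont a b); try lra; apply smooth_on_ccont; auto.
    apply smooth_on3_dot; auto; [now apply smooth_on3_derive|].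
    apply smooth_on3_cross; auto; [apply gamma'_smooth|apply gamma''_smooth]. }
  assert (E3 : RInt (fun x => -1 * dot va (v' x)) a b = 0).
  { rewrite (RInt_derive_on a b hab (fun x => -1 * dot va (v x))); try lra.
    - rewrite (proj1 (test_field_end a b v a hab Hv (or_introl eq_refl))).
      rewrite (proj1 (test_field_end a b v b hab Hv (or_intror eq_refl))); vec.
    - intros y Hy; eapply is_derive_on_eq.
      + apply (is_derive_on_mult a b (fun _ => -1)); [auto|apply is_derive_on_const; auto|].
        apply (is_derive_on3_dot a b (fun _ => va)); [auto|apply is_derive_on3_const; auto|].
        apply Dv; auto.
      + vec.
    - now apply smooth_on_ccont. }
  rewrite EF, E1, E2, E3 in D.
  replace (RInt (fun x => dot (v' x) (T x >< T' x)%R3) a b) with 0 in D by lra.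
  rewrite Rmult_0_r, Rplus_0_l, Ropp_0 in D; exact D.
Qed.

(** * Equivalence of the equations (2) to (5) *)

Lemma multiplier_elimination :
  (exists (Lambda : R -> R) (mu : R) (va : R3), smooth_on a b Lambda /\
    forall x, a <= x <= b ->
      (rho x *: T'' x + (3 / 2 * rho x * dot (T' x) (T' x)) *: T x
       + rho' x *: T' x - Lambda x *: T x - mu *: (T x >< T' x) + va = 0)%R3) <->
  (exists (mu : R) (va : R3), forall x, a <= x <= b ->
    (rho x *: T'' x - (rho x * dot (T'' x) (T x)) *: T x + rho' x *: T' x
     + va - dot va (T x) *: T x - mu *: (T x >< T' x) = 0)%R3).
Proof.
  split.
  - intros (L & mu & va & _ & H); exists mu, va; intros x Hx.
    set (k := 3 / 2 * rho x * dot (T' x) (T' x)) in *.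
    assert (EL : L x = rho x * dot (T'' x) (T x) + k + dot va (T x)).
    { pose proof (gamma'_unit x Hx) as U; pose proof (gamma'_gamma''_orthogonal x Hx) as N.
      pose proof (f_equal (fun z => dot z (T x)) (H x Hx)) as K; cbv beta in K.
      assert (K0 : rho x * dot (T'' x) (T x) + k * dot (T x) (T x)
        + rho' x * dot (T' x) (T x) - L x * dot (T x) (T x) + dot va (T x) = 0).
      { transitivity (dot (0)%R3 (T x)); [rewrite <- K|]; fold k; vec. }
      rewrite U, N in K0; lra. }
    rewrite <- (H x Hx); fold k; rewrite EL; vec.
  - intros (mu & va & H).
    (* As [<T'', T> = - <T', T'>] for a unit tangent, this multiplier equals
       [rho <T', T'> / 2 + <a, T>]. *)
    exists (fun x => rho x * dot (T'' x) (T x) + 3 / 2 * rho x * dot (T' x) (T' x)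
      + dot va (T x)), mu, va; split.
    + repeat apply smooth_on_plus; auto.
      * apply smooth_on_mult; auto; [apply hrho|].
        apply smooth_on3_dot; auto; [apply gamma'''_smooth|apply gamma'_smooth].
      * apply smooth_on_mult; auto.
        -- apply smooth_on_mult; auto; [now apply smooth_on_const|apply hrho].
        -- apply smooth_on3_dot; auto; apply gamma''_smooth.
      * apply (smooth_on3_dot a b hab (fun _ => va)); auto;
          [now apply smooth_on3_const|apply gamma'_smooth].
    + intros x Hx; rewrite <- (H x Hx).
      set (k := 3 / 2 * rho x * dot (T' x) (T' x)); vec.
Qed.

(** The vector [rho T x T' + mu T - a x gamma] is conserved: its derivative is [T x] the left side
    of (3), where [mu T'] arises from [T x (T x T') = - T']. Its constant value is the vector
    [vb]. *)
Lemma torque_balance :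
  (exists (mu : R) (va : R3), forall x, a <= x <= b ->
    (rho x *: T'' x - (rho x * dot (T'' x) (T x)) *: T x + rho' x *: T' x
     + va - dot va (T x) *: T x - mu *: (T x >< T' x) = 0)%R3) <->
  (exists (mu : R) (va vb : R3), forall x, a <= x <= b ->
    (rho x *: (T x >< T' x) = (- mu) *: T x + va >< gamma x + vb)%R3).
Proof.
  assert (D : forall mu va x, a <= x <= b ->
    is_derive_on3 a b (fun y => rho y *: (T y >< T' y) + mu *: T y - va >< gamma y)%R3 x
      ((rho' x *: (T x >< T' x) + rho x *: (T' x >< T' x + T x >< T'' x))
        + (0%R *: T x + mu *: T' x) - (((0 : R3) >< gamma x) + va >< T x))%R3).
  { intros mu va x Hx; apply is_derive_on3_minus; auto; [apply is_derive_on3_plus; auto|].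
    - apply (is_derive_on3_scal a b rho (fun y => T y >< T' y)%R3); auto;
        [now apply is_derive_rho|].
      apply is_derive_on3_cross; auto; [now apply is_derive_gamma'|
        now apply is_derive_gamma''].
    - apply (is_derive_on3_scal a b (fun _ => mu)); auto;
        [now apply is_derive_on_const|now apply is_derive_gamma'].
    - apply (is_derive_on3_cross a b (fun _ => va)); auto;
        [now apply is_derive_on3_const|now apply is_derive_gamma]. }
  split.
  - intros (mu & va & H).
    set (M := fun y => (rho y *: (T y >< T' y) + mu *: T y - va >< gamma y)%R3).
    exists mu, va, (M a); intros x Hx.
    rewrite <- (is_derive_on3_zero_const a b M hab) with (x := x); auto.
    + unfold M; vec.
    + intros y Hy; apply (is_derive_on3_eq a b M y _ _ (D mu va y Hy)).
      pose proof (gamma'_unit y Hy) as U; pose proof (gamma'_gamma''_orthogonal y Hy) as N.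
      transitivity (T y >< (rho y *: T'' y - (rho y * dot (T'' y) (T y)) *: T y + rho' y *: T' y
        + va - dot va (T y) *: T y - mu *: (T y >< T' y))
        + mu *: (dot (T' y) (T y) *: T y + (1 - dot (T y) (T y)) *: T' y))%R3.
      * generalize (dot (T'' y) (T y)) (dot va (T y)); intros r s; vec.
      * rewrite (H y Hy), N, U; vec.
  - intros (mu & va & vb & H); exists mu, va; intros x Hx.
    pose proof (gamma'_unit x Hx) as U; pose proof (gamma'_gamma''_orthogonal x Hx) as N.
    assert (Z : ((rho' x *: (T x >< T' x) + rho x *: (T' x >< T' x + T x >< T'' x))
        + (0%R *: T x + mu *: T' x) - (((0 : R3) >< gamma x) + va >< T x))%R3 = (0)%R3).
    { rewrite <- (Derive_on3_eq a b _ x _ hab Hx (D mu va x Hx)).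
      apply Derive_on3_eq; auto; apply (is_derive_on3_ext a b (fun _ => vb)); auto.
      - intros y Hy; rewrite (H y Hy); vec.
      - now apply is_derive_on3_const. }
    (* Crossing the vanishing derivative with [T] recovers the normal part of the equation, and the
       left side of (3) is entirely normal. *)
    transitivity (((rho' x *: (T x >< T' x) + rho x *: (T' x >< T' x + T x >< T'' x))
        + (0%R *: T x + mu *: T' x) - (((0 : R3) >< gamma x) + va >< T x)) >< T x
      + (rho' x * dot (T' x) (T x)) *: T x
      + (1 - dot (T x) (T x)) *: (rho x *: T'' x + rho' x *: T' x + va))%R3.
    + vec.
    + rewrite Z, U, N; vec.
Qed.

Lemma torque_balance_cross :
  (exists (mu : R) (va vb : R3), forall x, a <= x <= b ->
    (rho x *: (T x >< T' x) = (- mu) *: T x + va >< gamma x + vb)%R3) <->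
  (exists va vb : R3, forall x, a <= x <= b ->
    (rho x *: T' x = (va >< gamma x + vb) >< T x)%R3).
Proof.
  split.
  - intros (mu & va & vb & H); exists va, vb; intros x Hx.
    pose proof (gamma'_unit x Hx) as U; pose proof (gamma'_gamma''_orthogonal x Hx) as N.
    transitivity ((rho x *: (T x >< T' x)) >< T x + (rho x * dot (T' x) (T x)) *: T x
      + (rho x * (1 - dot (T x) (T x))) *: T' x)%R3; [vec|].
    rewrite (H x Hx), N, U; vec.
  - intros (va & vb & H).
    set (w := fun x => (va >< gamma x + vb)%R3) in *.
    assert (Dw : forall x, a <= x <= b ->
      is_derive_on3 a b w x (((0 : R3) >< gamma x + va >< T x) + 0)%R3).
    { intros x Hx; apply is_derive_on3_plus; auto; [|now apply is_derive_on3_const].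
      apply (is_derive_on3_cross a b (fun _ => va)); auto;
        [now apply is_derive_on3_const|now apply is_derive_gamma]. }
    assert (C : forall x, a <= x <= b -> dot (w x) (T x) = dot (w a) (T a)).
    { apply (is_derive_on_zero_const a b hab (fun x => dot (w x) (T x))).
      intros x Hx; eapply is_derive_on_eq.
      - apply is_derive_on3_dot; [auto|apply Dw; auto|apply is_derive_gamma'; auto].
      - pose proof (proj2 hrho x Hx) as Hr.
        (* By (5), [rho T' = w x T] is orthogonal to [w]; with [rho > 0] and [<a x T, T> = 0] the
           product [<w, T>] is constant. *)
        assert (K : rho x * dot (w x) (T' x) = 0).
        { transitivity (dot (w x) (rho x *: T' x)%R3); [vec|].
          rewrite (H x Hx); fold (w x); vec. }
        apply Rmult_integral in K; destruct K as [K|K]; [lra|rewrite K].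
        vec. }
    exists (dot (w a) (T a)), va, vb; intros x Hx.
    pose proof (gamma'_unit x Hx) as U.
    transitivity (T x >< (rho x *: T' x))%R3; [vec|].
    rewrite (H x Hx); fold (w x).
    transitivity ((- dot (w x) (T x)) *: T x + dot (T x) (T x) *: w x)%R3; [vec|].
    rewrite U, C by auto; unfold w; vec.
Qed.

End EulerLagrange.

Theorem theorem4p1 (a b : R) (hab : a < b)
  (gamma : R -> R3) (hgamma : curve a b gamma)
  (harc : arclength_parametrized a b gamma)
  (rho : R -> R) (hrho : stiffness a b rho) :
  let gamma' := Derive_on3 a b gamma in
  let gamma'' := Derive_on3 a b gamma' in
  let T := gamma' in
  let T' := Derive_on3 a b T in
  let T'' := Derive_on3 a b T' in
  let rho' := Derive_on a b rho in
  let stmt1 := holonomy_constrained_elastic a b rho gamma in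
  let stmt2 :=
    exists (Lambda : R -> R) (mu : R) (va : R3), smooth_on a b Lambda /\
      forall x, a <= x <= b ->
        (rho x *: T'' x + (3 / 2 * rho x * dot (T' x) (T' x)) *: T x
         + rho' x *: T' x - Lambda x *: T x - mu *: (T x >< T' x) + va = 0)%R3 in
  let stmt3 :=
    exists (mu : R) (va : R3),
      forall x, a <= x <= b ->
        (rho x *: T'' x - (rho x * dot (T'' x) (T x)) *: T x + rho' x *: T' x
         + va - dot va (T x) *: T x - mu *: (T x >< T' x) = 0)%R3 in
  let stmt4 :=
    exists (mu : R) (va vb : R3),
      forall x, a <= x <= b ->
        (rho x *: (gamma' x >< gamma'' x)
         = (- mu) *: T x + va >< gamma x + vb)%R3 in
  let stmt5 :=
    exists va vb : R3,
      forall x, a <= x <= b ->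
        (rho x *: gamma'' x = (va >< gamma x + vb) >< gamma' x)%R3 in
  (stmt1 <-> stmt2) /\ (stmt2 <-> stmt3) /\ (stmt3 <-> stmt4) /\
  (stmt4 <-> stmt5).
Proof.
  intros gamma' gamma'' T T' T'' rho' stmt1 stmt2 stmt3 stmt4 stmt5.
  split; [split|split; [|split]].
  - intros H1; apply (multiplier_elimination a b hab gamma hgamma harc rho hrho).
    now apply (elastic_equation a b hab gamma hgamma harc rho hrho).
  - intros (Lambda & mu & va & _ & H).
    now apply (equation_elastic a b hab gamma hgamma harc rho hrho Lambda mu va).
  - now apply multiplier_elimination.
  - now apply torque_balance.
  - now apply torque_balance_cross with (rho := rho).
Qed.
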